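(* (Open Mapping Theorem.) Assume $T$ is stable, and let $A\subseteq B$ be sets of parameters. Let $X\subseteq S_n(B)$ be the set of complete types over $B$ which do not fork over $A$. Then $X$ is compact and the restriction map $\rho_A\colon X\to S_n(A)$, $p\mapsto p{\restriction}_A$, is an open continuous surjective map.
   Context: Continuous first order logic: formulas take values in $[0,1]$; $T$ is a continuous theory; $S_n(B)$ is the compact space of complete $n$-types over $B$ with the logic topology. $T$ is stable if no formula has the order property in any model of $T$. For a stable formula $\varphi(\bar x,\bar y)$, every $\varphi$-type over a model $M$ is definable by an $M$-definable predicate; a $\varphi$-type over $B$ does not fork over $A\subseteq B$ if it extends to a $\varphi$-type over a model containing $B$ whose definition is over $\mathrm{acl}^{eq}(A)$ (algebraic closure with imaginary sorts). When $T$ is stable, a complete type over $B$ does not fork over $A$ if all its $\varphi$-restrictions do not fork over $A$. *)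

(* Defs.v *)
From HB Require Import structures.
From mathcomp Require Import all_boot all_order all_algebra.
From mathcomp Require Import all_classical all_reals topology normedtype sequences.
From mathcomp Require Import lra.
Set Implicit Arguments.
Unset Strict Implicit.
Unset Printing Implicit Defensive.
Import Order.TTheory GRing.Theory Num.Theory.
Import numFieldNormedType.Exports.
Local Open Scope classical_set_scope.
Local Open Scope ring_scope.

(* The places of a symbol are indexed by a finite type rather than by 'I_n, so
   that a place can be added to a symbol (as option) without transports.  The
   distance of each sort is not listed among the symbols. *)
Record symbols := Symbols {
  srt : Type;
  fsym : Type;
  fplace : fsym -> finType;
  fdom : forall f, fplace f -> srt;
  fcod : fsym -> srt;
  rsym : Type;
  rplace : rsym -> finType;
  rdom : forall r, rplace r -> srt }.
Arguments fdom {s} f _.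
Arguments rdom {s} r _.

(* A context gives the type of variables (or of constants) of each sort. *)
Definition ctx (S : symbols) := srt S -> Type.

Definition ctx0 (S : symbols) : ctx S := fun=> void.
Arguments ctx0 {S} _.

Inductive vars (S : symbols) (I : Type) (xs : I -> srt S) : srt S -> Type :=
  VarOf (i : I) : vars xs (xs i).

Definition ctx_cat (S : symbols) (V W : ctx S) : ctx S :=
  fun s => (V s + W s)%type.

Inductive ctx_ext (S : symbols) (V : ctx S) (s : srt S) : srt S -> Type :=
| Old s' : V s' -> ctx_ext V s s'
| New : ctx_ext V s s.
Arguments New {S V s}.

Section Connectives.
Variable R : realType.

Definition unit_cube {k : nat} : set 'rV[R]_k :=
  [set v | forall i, 0 <= v ord0 i <= 1].

Record connective (k : nat) := Connective {
  conn_fun :> 'rV[R]_k -> R;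
  conn_cont : {within unit_cube, continuous conn_fun};
  conn_range : forall v, unit_cube v -> 0 <= conn_fun v <= 1 }.
End Connectives.

Section Syntax.
Variables (R : realType) (S : symbols).

Inductive term (V : ctx S) : srt S -> Type :=
| Var s : V s -> term V s
| App f : (forall i, term V (fdom f i)) -> term V (fcod f).

Inductive formula (V : ctx S) : Type :=
| Dist s : term V s -> term V s -> formula V
| Rel r : (forall i, term V (rdom r i)) -> formula V
| Conn k : connective R k -> ('I_k -> formula V) -> formula V
| Sup s : formula (ctx_ext V s) -> formula V
| Inf s : formula (ctx_ext V s) -> formula V.

Definition ctx_map (V W : ctx S) := forall s, V s -> W s.

Definition ext_map (V W : ctx S) (f : ctx_map V W) s :
    ctx_map (ctx_ext V s) (ctx_ext W s) :=
  fun s' v => match v with Old s1 v1 => Old s (f s1 v1) | New => New end.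

Definition cat_map (V V' W W' : ctx S) (f : ctx_map V V') (g : ctx_map W W') :
    ctx_map (ctx_cat V W) (ctx_cat V' W') :=
  fun s v => match v with inl x => inl (f s x) | inr y => inr (g s y) end.

Fixpoint tren (V W : ctx S) (f : ctx_map V W) s (t : term V s) : term W s :=
  match t in term _ s return term W s with
  | Var s v => Var (f s v)
  | App g ts => App (fun i => tren f (ts i))
  end.

Fixpoint fren (V W : ctx S) (f : ctx_map V W) (phi : formula V) : formula W :=
  match phi with
  | Dist s t u => Dist (tren f t) (tren f u)
  | Rel r ts => Rel (fun i => tren f (ts i))
  | Conn k u phis => Conn u (fun i => fren f (phis i))
  | Sup s psi => Sup (fren (@ext_map V W f s) psi)
  | Inf s psi => Inf (fren (@ext_map V W f s) psi)
  end.
End Syntax.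
Arguments Var {S V s} _.
Arguments App {S V} f _.
Arguments Dist {R S V s} _ _.
Arguments Rel {R S V} r _.
Arguments Sup {R S V} s _.
Arguments Inf {R S V} s _.

(* Interpretations are not required to be complete or to respect moduli of
   continuity; this is added in the record structure below. *)
Record interp (R : realType) (S : symbols) := Interp {
  carrier :> srt S -> metricType R;
  elt : forall s, carrier s;
  mdist_le1 : forall s (x y : carrier s), mdist x y <= 1;
  fint : forall f, (forall i, carrier (fdom f i)) -> carrier (fcod f);
  rint : forall r, (forall i, carrier (rdom r i)) -> R;
  rint_range : forall r a, 0 <= @rint r a <= 1 }.
Arguments elt {R S} M s : rename.
Arguments fint {R S} M f _ : rename.
Arguments rint {R S} M r _ : rename.

Section Semantics.
Variables (R : realType) (S : symbols).
Implicit Types M : interp R S.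

Definition env M (V : ctx S) := forall s, V s -> M s.

Definition tup M (I : Type) (xs : I -> srt S) := forall i, M (xs i).

Definition env0 M : env M ctx0 := fun s v => match v with end.

Definition tuple_env M I (xs : I -> srt S) (a : tup M xs) :
    env M (vars xs) :=
  fun s v => match v in vars _ s return M s with VarOf i => a i end.

Definition env_cat M (V W : ctx S) (e : env M V) (e' : env M W) :
    env M (ctx_cat V W) :=
  fun s v => match v with inl x => e s x | inr y => e' s y end.

Definition env_ext M (V : ctx S) (e : env M V) s (a : M s) :
    env M (ctx_ext V s) :=
  fun s' v => match v in ctx_ext _ _ s' return M s -> M s' with
              | Old s1 v1 => fun=> e s1 v1
              | New => id
              end a.

Fixpoint teval M (V : ctx S) (e : env M V) s (t : term V s) : M s :=
  match t in term _ s return M s with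
  | Var s v => e s v
  | App f ts => fint M f (fun i => teval e (ts i))
  end.

Fixpoint feval M (V : ctx S) (phi : formula R V) : env M V -> R :=
  match phi with
  | Dist s t u => fun e => mdist (teval e t) (teval e u)
  | Rel r ts => fun e => rint M r (fun i => teval e (ts i))
  | Conn k u phis => fun e => u (\row_i feval (phis i) e)
  | Sup s psi => fun e => sup [set feval psi (env_ext e a) | a in [set: M s]]
  | Inf s psi => fun e => inf [set feval psi (env_ext e a) | a in [set: M s]]
  end.

Lemma feval_range M (V : ctx S) (phi : formula R V) (e : env M V) :
  0 <= feval phi e <= 1.
Proof.
elim: phi e => {V} [V s t u|V r ts|V k u phis IH|V s psi IH|V s psi IH] e /=.
- by rewrite mdist_ge0 mdist_le1.
- exact: rint_range.
- by apply: conn_range => i; rewrite mxE.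
- set E := [set _ | _ in _].
  have E0 : E (feval psi (env_ext e (elt M s))) by exists (elt M s).
  have [h0 _] := andP (IH (env_ext e (elt M s))).
  have ub1 : ubound E 1 by move=> _ [a _ <-]; case/andP: (IH (env_ext e a)).
  apply/andP; split; last by apply: ge_sup => //; exists (feval psi (env_ext e (elt M s))).
  apply: (le_trans h0); apply: ub_le_sup => //; by exists 1.
- set E := [set _ | _ in _].
  have E0 : E (feval psi (env_ext e (elt M s))) by exists (elt M s).
  have [_ h1] := andP (IH (env_ext e (elt M s))).
  have lb0 : lbound E 0 by move=> _ [a _ <-]; case/andP: (IH (env_ext e a)).
  apply/andP; split; first by apply: lb_le_inf => //; exists (feval psi (env_ext e (elt M s))).
  by apply: le_trans h1; apply: ge_inf => //; exists 0.
Qed.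

Lemma teval_ren M (V W : ctx S) (f : ctx_map V W) (e : env M W) s
    (t : term V s) :
  teval e (tren f t) = teval (fun s v => e s (f s v)) t.
Proof.
elim: t => //= g ts IH; congr (fint M g _).
by apply: functional_extensionality_dep => i; exact: IH.
Qed.

Lemma env_ext_map M (V W : ctx S) (f : ctx_map V W) (e : env M W) s (a : M s) :
  (fun s' v => env_ext e a (@ext_map S V W f s s' v)) =
  env_ext (fun s' v => e s' (f s' v)) a.
Proof.
by apply: functional_extensionality_dep => s';
   apply: functional_extensionality_dep; case.
Qed.

Lemma feval_ren M (V W : ctx S) (f : ctx_map V W) (e : env M W)
    (phi : formula R V) :
  feval (fren f phi) e = feval phi (fun s v => e s (f s v)).
Proof.
elim: phi W f e => {V} [V s t u|V r ts|V k u phis IH|V s psi IH|V s psi IH]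
  W f e /=.
- by rewrite !teval_ren.
- congr (rint M r _); apply: functional_extensionality_dep => i.
  exact: teval_ren.
- by congr (conn_fun u _); apply/rowP => i; rewrite !mxE IH.
- by congr sup; congr image; apply/funext => a; rewrite IH env_ext_map.
- by congr inf; congr image; apply/funext => a; rewrite IH env_ext_map.
Qed.
End Semantics.

Section Definability.
Variables (R : realType) (S : symbols) (M : interp R S).

Definition params := forall s, set (M s).

Definition pctx (A : params) : ctx S := fun s => {b : M s | A s b}.

Definition incl (A : params) : env M (pctx A) := fun s b => sval b.
Arguments incl : clear implicits.

Definition definable (A : params) n (xs : 'I_n -> srt S)
    (P : tup M xs -> R) : Prop :=
  forall eps : R, 0 < eps ->
    exists phi : formula R (ctx_cat (vars xs) (pctx A)),
      forall a, `|P a - feval phi (env_cat (tuple_env a) (incl A))| <= eps.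

(* The algebraic elements over A are those of the compact sets definable over
   A; a (closed, nonempty) set is definable if the distance to it is a
   definable predicate. *)
Definition acl (A : params) : params := fun s =>
  [set e | exists C : set (M s),
     [/\ C e, compact C &
         definable A (fun x : tup M (fun _ : 'I_1 => s) =>
                        inf [set mdist (x ord0) c | c in C])]].
End Definability.
Arguments params {R S} M.
Arguments incl {R S M} A.

Record signature (R : realType) := Signature {
  sig_sym :> symbols;
  fmod : fsym sig_sym -> R -> R;
  rmod : rsym sig_sym -> R -> R;
  fmod_gt0 : forall f eps, 0 < eps -> 0 < fmod f eps;
  rmod_gt0 : forall r eps, 0 < eps -> 0 < rmod r eps }.

Record structure (R : realType) (L : signature R) := Structure {
  str_interp :> interp R L;
  str_complete : forall s (F : set_system (str_interp s)),
    ProperFilter F -> cauchy F -> exists x : str_interp s, F --> x;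
  fint_mod : forall (f : fsym L) eps
      (a b : forall i, str_interp (fdom f i)), 0 < eps ->
    (forall i, mdist (a i) (b i) < fmod f eps) ->
    mdist (fint str_interp f a) (fint str_interp f b) <= eps;
  rint_mod : forall (r : rsym L) eps
      (a b : forall i, str_interp (rdom r i)), 0 < eps ->
    (forall i, mdist (a i) (b i) < rmod r eps) ->
    `|rint str_interp r a - rint str_interp r b| <= eps }.

Section Theories.
Variables (R : realType) (L : signature R).

(* The sentence sigma stands for the condition sigma = 0. *)
Definition theory := set (formula R (@ctx0 L)).

Definition models (T : theory) (M : structure L) :=
  forall sigma, T sigma -> feval sigma (@env0 R L M) = 0.

Definition order_property n m (xs : 'I_n -> srt L) (ys : 'I_m -> srt L)
    (phi : formula R (ctx_cat (vars xs) (vars ys))) (M : structure L) :=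
  exists2 eps : R, 0 < eps &
  exists (a : nat -> tup M xs) (b : nat -> tup M ys),
    forall i j, (i < j)%N ->
      eps <= `|feval phi (env_cat (tuple_env (a i)) (tuple_env (b j))) -
               feval phi (env_cat (tuple_env (a j)) (tuple_env (b i)))|.

Definition stable (T : theory) :=
  forall n m (xs : 'I_n -> srt L) (ys : 'I_m -> srt L)
    (phi : formula R (ctx_cat (vars xs) (vars ys))) (M : structure L),
    models T M -> ~ order_property phi M.
End Theories.

Section Imaginaries.
Variables (R : realType) (L : signature R) (T : theory L).

(* A definable predicate chi(x, Y) of T without parameters, x being finite and Y
   countable: the uniform limit of formulas chi_j(x, Y) such that
   |chi_j - chi_j+1| <= 2^-j in all models of T. *)
Record defpred := Defpred {
  dp_n : nat;
  dp_x : 'I_dp_n -> srt L;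
  dp_y : nat -> srt L;
  dp_seq : nat -> formula R (ctx_cat (vars dp_x) (vars dp_y));
  dp_fast : forall (N : structure L), models T N ->
    forall (e : env N _) j,
      `|feval (dp_seq j) e - feval (dp_seq j.+1) e| <= 2^-1 ^+ j }.
Arguments dp_x : clear implicits.
Arguments dp_y : clear implicits.
Arguments dp_seq : clear implicits.

Definition dp_eval (N : interp R L) (chi : defpred)
    (a : tup N (dp_x chi)) (b : tup N (dp_y chi)) : R :=
  lim (feval (dp_seq chi j) (env_cat (tuple_env a) (tuple_env b))
         @[j --> \oo]).

(* The sort of canonical parameters of the predicates chi(-, b): the completion
   of the quotient of N^Y by the pseudo-metric sup_x |chi(x, b) - chi(x, b')|.
   The canonical parameter of chi(-, b) is represented by the function chi(-, b)
   itself, and the completion by the uniform closure of these functions. *)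
Definition imag (N : interp R L) (chi : defpred) : Type :=
  {z : tup N (dp_x chi) -> R |
    forall eps : R, 0 < eps -> exists b, forall a, `|z a - dp_eval a b| <= eps}.

HB.instance Definition _ N chi := gen_eqMixin (imag N chi).
HB.instance Definition _ N chi := gen_choiceMixin (imag N chi).

Section ImagMetric.
Variables (N : interp R L) (chi : defpred).
Implicit Types z w : imag N chi.

Definition imag_dist z w : R :=
  sup [set `|sval z a - sval w a| | a in [set: tup N (dp_x chi)]].

Let a0 : tup N (dp_x chi) := fun i => elt N (dp_x chi i).

Lemma dp_eval_range (a : tup N (dp_x chi)) b : 0 <= dp_eval a b <= 1.
Proof.
rewrite /dp_eval; set u := fun j => feval _ _.
have [cu|ncu] := pselect (cvgn u); last by rewrite dvgP // lexx ler01.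
apply/andP; split.
- by apply: limr_ge => //; near=> j; case/andP: (feval_range (dp_seq chi j)
    (env_cat (tuple_env a) (tuple_env b))).
- by apply: limr_le => //; near=> j; case/andP: (feval_range (dp_seq chi j)
    (env_cat (tuple_env a) (tuple_env b))).
Unshelve. all: by end_near.
Qed.

Lemma imag_range z a : 0 <= sval z a <= 1.
Proof.
apply/andP; split; apply/ler_addgt0Pr => eps eps0;
  have [b /(_ a)] := svalP z eps eps0; rewrite ler_norml => /andP[h1 h2];
  have /andP[h3 h4] := dp_eval_range a b.
- by move: h1; rewrite lerBrDr; lra.
- by lra.
Qed.

Lemma imag_dist_ge z w a : `|sval z a - sval w a| <= imag_dist z w.
Proof.
apply: ub_le_sup; last by exists a.
exists 1 => _ [b _ <-].
have := imag_range z b; have := imag_range w b; rewrite ler_norml; lra.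
Qed.

Lemma imag_dist_le z w r :
  (forall a, `|sval z a - sval w a| <= r) -> imag_dist z w <= r.
Proof.
move=> h; apply: ge_sup; first by exists `|sval z a0 - sval w a0|, a0.
by move=> _ [a _ <-].
Qed.

Lemma imag_distxx z : imag_dist z z = 0.
Proof.
apply/eqP; rewrite eq_le; apply/andP; split.
  by apply: imag_dist_le => a; rewrite subrr normr0.
by apply: le_trans (imag_dist_ge z z a0).
Qed.

Lemma imag_dist_eq0 z w : imag_dist z w = 0 -> z = w.
Proof.
move=> h; have zw : sval z = sval w.
  apply/funext => a; apply/eqP; rewrite -subr_eq0 -normr_le0.
  by apply: le_trans (imag_dist_ge z w a) _; rewrite h.
case: z w zw {h} => [z hz] [w hw] /= zw; case: _ / zw hw => hw.
by congr exist; exact: Prop_irrelevance.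
Qed.

Lemma imag_distC z w : imag_dist z w = imag_dist w z.
Proof. by congr sup; congr image; apply/funext => a; rewrite distrC. Qed.

Lemma imag_dist_triangle w z v :
  imag_dist z v <= imag_dist z w + imag_dist w v.
Proof.
apply: imag_dist_le => a; apply: le_trans (ler_distD (sval w a) _ _) _.
by apply: lerD; exact: imag_dist_ge.
Qed.

HB.instance Definition _ := isMetric.Build R (imag N chi)
  imag_distxx imag_dist_eq0 imag_distC imag_dist_triangle.

Lemma imag_mdist_le1 (z w : imag N chi) : mdist z w <= 1.
Proof.
apply: imag_dist_le => a.
have := imag_range z a; have := imag_range w a; rewrite ler_norml; lra.
Qed.
End ImagMetric.
End Imaginaries.
Arguments dp_x {R L T} chi _ : rename.
Arguments dp_y {R L T} chi _ : rename.
Arguments dp_seq {R L T} chi _ : rename.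

(* The structure M^eq: a new sort for every definable predicate chi, with the
   predicate (x, z) |-> z(x), where the place of z is None.  As M^eq is the only
   expansion of M to these symbols which satisfies the axioms of T^eq, it is
   introduced as an interpretation, without axioms. *)
Section Eq.
Variables (R : realType) (L : signature R) (T : theory L).

Definition eq_place (r : rsym L + defpred T) : finType :=
  match r with inl r => rplace r | inr chi => option 'I_(dp_n chi) end.

Definition eq_dom (r : rsym L + defpred T) :
    eq_place r -> srt L + defpred T :=
  match r return eq_place r -> srt L + defpred T with
  | inl r => fun i => inl (rdom r i)
  | inr chi => fun i => match i with
                        | None => inr chi
                        | Some i => inl (dp_x chi i)
                        end
  end.

Definition eq_symbols : symbols := {|
  srt := srt L + defpred T;
  fsym := fsym L;
  fplace := @fplace L;
  fdom := fun f i => inl (fdom f i);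
  fcod := fun f => inl (fcod f);
  rsym := rsym L + defpred T;
  rplace := eq_place;
  rdom := eq_dom |}.

Variable M : structure L.

Definition eq_carrier (s : srt eq_symbols) : metricType R :=
  match s with inl s => M s | inr chi => imag M chi end.

Definition eq_elt (s : srt eq_symbols) : eq_carrier s.
Proof.
case: s => [s|chi]; first exact: elt M s.
pose b : tup M (dp_y chi) := fun j => elt M (dp_y chi j).
exists (fun a => dp_eval a b) => eps eps0; exists b => a.
by rewrite subrr normr0 ltW.
Defined.

Lemma eq_mdist_le1 s (x y : eq_carrier s) : mdist x y <= 1.
Proof. by case: s x y => [s|chi] x y; [exact: mdist_le1|exact: imag_mdist_le1]. Qed.

Definition eq_rint (r : rsym eq_symbols) :
    (forall i, eq_carrier (eq_dom (r := r) i)) -> R :=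
  match r return (forall i, eq_carrier (eq_dom (r := r) i)) -> R with
  | inl r => fun a => rint M r a
  | inr chi => fun a => sval (a None : imag M chi) (fun i => a (Some i))
  end.

Lemma eq_rint_range r a : 0 <= @eq_rint r a <= 1.
Proof. by case: r a => [r|chi] a; [exact: rint_range|exact: imag_range]. Qed.

Definition eq_struct : interp R eq_symbols :=
  @Interp R eq_symbols eq_carrier eq_elt eq_mdist_le1
    (fun f a => fint M f a) eq_rint eq_rint_range.

Definition eq_params (A : params M) : params eq_struct :=
  fun s => match s return set (eq_carrier s) with
           | inl s => A s
           | inr chi => set0
           end.

Definition acl_eq (A : params M) : params eq_struct := acl (eq_params A).
End Eq.
Arguments acl_eq {R L} T {M} A.

Section Types.
Variables (R : realType) (L : signature R).

(* (M, c) and (N, d) are elementarily equivalent with the constants named. *)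
Definition elem_equiv (G : ctx L) (M N : structure L) (c : env M G)
    (d : env N G) :=
  forall sigma : formula R G, feval sigma c = feval sigma d.

(* A complete type in the variables xs over the constants c of M, that is, in
   the theory of (M, c), is identified with the function phi |-> phi^p: it is
   the type of some tuple in some model of this theory. *)
Definition is_type (G : ctx L) (M : structure L) (c : env M G) n
    (xs : 'I_n -> srt L) (p : formula R (ctx_cat (vars xs) G) -> R) :=
  exists (N : structure L) (d : env N G) (a : tup N xs),
    elem_equiv c d /\ forall phi, p phi = feval phi (env_cat (tuple_env a) d).

(* The logic topology is that of pointwise convergence of phi |-> phi^p. *)
Definition types (G : ctx L) (M : structure L) (c : env M G) n
    (xs : 'I_n -> srt L) : topologicalType :=
  set_type ([set p | is_type c p] :
    set (prod_topology (fun _ : formula R (ctx_cat (vars xs) G) => R))).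

Section Restriction.
Variables (G H : ctx L) (M N : structure L) (c : env M G) (d : env N H).
Variables (f : ctx_map G H).
Arguments d : clear implicits.
Arguments f : clear implicits.
Hypothesis cd : elem_equiv c (fun s v => d s (f s v)).
Variables (n : nat) (xs : 'I_n -> srt L).

Definition restr_fun (p : formula R (ctx_cat (vars xs) H) -> R) :
    formula R (ctx_cat (vars xs) G) -> R :=
  fun phi => p (fren (cat_map (fun s => id) f) phi).

Lemma restr_is_type p : is_type d p -> is_type c (restr_fun p).
Proof.
move=> [K [e [a [de pE]]]].
exists K, (fun s v => e s (f s v)), a; split=> [sigma|phi].
  by rewrite cd -(feval_ren f d) de feval_ren.
rewrite /restr_fun pE feval_ren; congr (feval phi _).
by apply: functional_extensionality_dep => s;
   apply: functional_extensionality_dep; case.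
Qed.

Definition restr (p : types d xs) : types c xs :=
  exist _ (restr_fun (val p)) (mem_set (restr_is_type (set_mem (valP p)))).
End Restriction.

(* S_n(B) is types_over; S_n(M) is model_types below. *)
Definition types_over (M : structure L) (B : params M) n
    (xs : 'I_n -> srt L) : topologicalType :=
  types (incl B) xs.

Definition self (M : structure L) : env M (fun s => M s) := fun s a => a.

Definition model_types (M : structure L) n (xs : 'I_n -> srt L) :=
  types (@self M) xs.

Definition incl_map (M : structure L) (A B : params M)
    (AB : forall s, A s `<=` B s) : ctx_map (pctx A) (pctx B) :=
  fun s b => exist _ (sval b) (AB s _ (svalP b)).

Lemma incl_map_equiv (M : structure L) (A B : params M)
    (AB : forall s, A s `<=` B s) :
  elem_equiv (incl A) (fun s v => incl B s (incl_map AB v)).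
Proof. by []. Qed.

Definition restriction (M : structure L) (A B : params M)
    (AB : forall s, A s `<=` B s) n (xs : 'I_n -> srt L) :
    types_over B xs -> types_over A xs :=
  restr (incl_map_equiv AB) (xs := xs).

Definition model_restriction (M : structure L) (B : params M) (N : structure L)
    (c : env N (pctx B)) (cE : elem_equiv (incl B) c) n
    (xs : 'I_n -> srt L) : model_types N xs -> types_over B xs :=
  restr (d := @self N) (f := c) cE (xs := xs).
End Types.

Section Local.
Variables (R : realType) (L : signature R) (M : structure L) (B : params M).
Variables (n m : nat) (xs : 'I_n -> srt L) (ys : 'I_m -> srt L).
Variable phi : formula R (ctx_cat (vars xs) (vars ys)).

(* A B-definable predicate P(x), as the limit of L(B)-formulas. *)
Record defpred_over := DefpredOver {
  dpo_seq : nat -> formula R (ctx_cat (vars xs) (pctx B));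
  dpo_fast : forall (a : tup M xs) j,
    `|feval (dpo_seq j) (env_cat (tuple_env a) (incl B)) -
      feval (dpo_seq j.+1) (env_cat (tuple_env a) (incl B))|
      <= 2^-1 ^+ j }.

Definition dpo_eval (P : defpred_over) (a : tup M xs) : R :=
  lim (feval (dpo_seq P j) (env_cat (tuple_env a) (incl B))
         @[j --> \oo]).

Definition dpo_type (P : defpred_over) (p : types_over B xs) : R :=
  lim (val p (dpo_seq P j) @[j --> \oo]).

(* P is a phi-predicate: a continuous combination, or a uniform limit of
   continuous combinations, of instances phi(x, b) with b in M.  The parameters
   b need not be in B. *)
Definition phi_predicate (P : defpred_over) : Prop :=
  forall eps : R, 0 < eps ->
    exists k (u : connective R k) (b : 'I_k -> tup M ys),
      forall a, `|dpo_eval P a -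
        u (\row_i feval phi (env_cat (tuple_env a) (tuple_env (b i))))| <= eps.

(* S_phi(B) is the quotient of S_n(B) by this relation: a phi-type over B gives
   the values of the B-definable phi-predicates.  If B is the whole model, these
   values are determined by those of the instances phi(x, b). *)
Definition same_phi_type (p q : types_over B xs) : Prop :=
  forall P, phi_predicate P -> dpo_type P p = dpo_type P q.
End Local.

Section NonForking.
Variables (R : realType) (L : signature R) (T : theory L).

Definition instance (N : structure L) n m (xs : 'I_n -> srt L)
    (ys : 'I_m -> srt L) (phi : formula R (ctx_cat (vars xs) (vars ys)))
    (b : tup N ys) : formula R (ctx_cat (vars xs) (fun s => N s)) :=
  fren (cat_map (fun s => id) (tuple_env b)) phi.

(* The definition d_p phi(y) of the phi-type of p over the model N. *)
Definition phi_definition (N : structure L) n m (xs : 'I_n -> srt L)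
    (ys : 'I_m -> srt L) (phi : formula R (ctx_cat (vars xs) (vars ys)))
    (p : model_types N xs) : tup N ys -> R :=
  fun b => val p (instance phi b).

Definition image_params (M : structure L) (A B : params M) (N : structure L)
    (c : env N (pctx B)) : params N :=
  fun s => [set c s b | b in [set b : pctx B s | A s (sval b)]].

(* The phi-type of p over B does not fork over A.  A model N containing B is
   given with an elementary map c from B to N; a phi-type over N is given by a
   complete type q over N. *)
Definition phi_nonforking (M : structure L) (A B : params M) n m
    (xs : 'I_n -> srt L) (ys : 'I_m -> srt L)
    (phi : formula R (ctx_cat (vars xs) (vars ys))) (p : types_over B xs) :=
  exists (N : structure L) (c : env N (pctx B))
      (cE : elem_equiv (incl B) c) (q : model_types N xs),
    [/\ models T N,
        same_phi_type phi (model_restriction cE q) p &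
        definable (M := eq_struct T N) (acl_eq T (image_params A c))
          (xs := fun j => inl (ys j)) (phi_definition phi q)].

Definition nonforking (M : structure L) (A B : params M) n
    (xs : 'I_n -> srt L) : set (types_over B xs) :=
  [set p | forall m (ys : 'I_m -> srt L)
             (phi : formula R (ctx_cat (vars xs) (vars ys))),
             phi_nonforking A phi p].
End NonForking.

(* Main.v *)
(* A complete type over constants in a model M is represented by ultrafilters on
   the tuples of M, its values being the limits of formulas; stability enters
   through a bound on the length of ladders of definable predicates.

   Every type p0 over A extends to a compact set Z of ultrafilters over M, found
   from a maximal consistent family of A-definable conditions with parameters,
   such that the suprema y |-> sup_Z lim phi(x, y) are definable over A and the
   limits y |-> lim phi(x, y) form a uniformly compact set.  The latter are coded
   by an A-definable compact set of imaginaries, so that all members of Z are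
   nonforking extensions of p0.  Exchanging limits makes the suprema symmetric in
   x and y.

   Conversely, an algebraic imaginary e over A can be replaced by a supremum over
   the imaginaries close to the compact set of its conjugates, which is definable
   over A.  Together with symmetry in an amalgam of the models involved, this
   bounds a nonforking type p by these suprema: p(Theta) <= g(Theta, p|A), where
   g(Theta, -) is a uniform limit of formulas over A, hence continuous.  So X is
   the closed set of those p with p(Theta) <= g(Theta, p|A) for all Theta, and the
   restriction maps X /\ {Theta > 0} onto the open set {g(Theta, -) > 0}. *)
Require Import Defs.
From HB Require Import structures.
From mathcomp Require Import all_boot all_order all_algebra.
From mathcomp Require Import all_classical all_reals topology normedtype sequences.
From mathcomp Require Import lra.
Set Implicit Arguments.
Unset Strict Implicit.
Unset Printing Implicit Defensive.
Import Order.TTheory GRing.Theory Num.Theory.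
Import numFieldNormedType.Exports.
Local Open Scope classical_set_scope.
Local Open Scope ring_scope.

(** * Limits along ultrafilters *)

(** Only arbitrary models are available, without saturation or automorphisms. Invariance under
    automorphisms over A is therefore replaced by definability over A, and realizations in
    extensions by ultrafilters on the tuples of one model. When A is not algebraically closed, a
    single nonforking extension of a type over A need not be definable over A; only the supremum
    over all of them is. This is why [good] is a property of a set of ultrafilters, and why symmetry
    and the bound g speak of suprema. Maximality makes Z resemble a minimal flow: finitely many
    instances of an A-definable piece that meets Z cover Z. In a cover of least size by small pieces
    every piece meets Z, so the suprema can be read off from any such cover, and the cover itself
    can be quantified away. Stability enters three times through one device: a construction that
    never stops would produce ladders of every finite length. It bounds the oscillation on pieces,
    exchanges limits, and shows that finitely many instances determine a limit. The fractions of eps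
    in these places keep the two sides of a ladder apart. *)

Section UltraLimit.
Variables (R : realType) (I : Type).
Implicit Types (U : set_system I) (f g : I -> R) (e l : R).

Definition unitf f := forall x, 0 <= f x <= 1.

(** As a supremum the limit is a total function of [U] and [f]; [ulim_near] shows that it is the
    limit for ultrafilters and functions into [0,1]. *)
Definition ulim U f : R := sup [set r | U [set x | r <= f x]].

Lemma ultra_not U (P : set I) : UltraFilter U -> ~ U P -> U (~` P).
Proof. by move=> UU nP; have [] := in_ultra_setVsetC P UU. Qed.

Lemma ultra_exists U (J : finType) (P : J -> set I) : UltraFilter U ->
  U [set x | exists j, P j x] -> exists j, U (P j).
Proof.
move=> UU UP; apply: contrapT => nP.
have : U [set x | forall j, ~ P j x].
  by apply: filter_forall => j; apply: ultra_not => // UPj; apply: nP; exists j.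
move=> UnP; have [x [[j Pjx] nPx]] := filter_ex (filterI UP UnP).
exact: nPx Pjx.
Qed.

Lemma ulim_near U f e : UltraFilter U -> unitf f -> 0 < e ->
  U [set x | `|f x - ulim U f| < e].
Proof.
move=> UU uf e0; set S := [set r | U [set x | r <= f x]].
have S0 : S 0 by apply: filterE => x; case/andP: (uf x).
have ubS : ubound S 1.
  move=> r Sr; have [x /= rx] := filter_ex Sr.
  by apply: le_trans rx _; case/andP: (uf x).
have hS : has_sup S by split; [exists 0|exists 1].
have [r Sr rl] := sup_adherent e0 hS.
have lt1 : U [set x | f x < ulim U f + e / 2].
  have := @ultra_not U [set x | ulim U f + e / 2 <= f x] UU; apply: contraPP.
  move=> h /(_ _) /= h'; apply: h.
  have /h' : ~ U [set x | ulim U f + e / 2 <= f x].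
    by move=> h2; have := ub_le_sup (proj2 hS) h2; rewrite /ulim -/S; lra.
  by apply: filterS => x /= /negP; rewrite -ltNge.
apply: filterS2 Sr lt1 => x /= h1 h2; rewrite ltr_norml.
by move: rl; rewrite /ulim -/S in h2 *; lra.
Qed.

Lemma ulim_eq U f l : UltraFilter U -> unitf f ->
  (forall e, 0 < e -> U [set x | `|f x - l| <= e]) -> ulim U f = l.
Proof.
move=> UU uf h; apply/eqP; rewrite -subr_eq0 -normr_le0.
apply/ler_addgt0Pr => e e0; rewrite add0r; have e20 : 0 < e / 2 by lra.
have [x [/= h1 h2]] := filter_ex (filterI (h _ e20) (ulim_near UU uf e20)).
have := ler_distD (f x) (ulim U f) l; rewrite [`|ulim U f - f x|]distrC; lra.
Qed.

Lemma ulim_le U f g e : UltraFilter U -> unitf f -> unitf g ->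
  U [set x | f x <= g x + e] -> ulim U f <= ulim U g + e.
Proof.
move=> UU uf ug h; apply/ler_addgt0Pr => d d0; have d20 : 0 < d / 2 by lra.
have [x [/= h1 [h2 h3]]] := filter_ex (filterI h (filterI
  (ulim_near UU uf d20) (ulim_near UU ug d20))).
by move: h2 h3; rewrite !ltr_norml; lra.
Qed.

Lemma ulim_dist U f g e : UltraFilter U -> unitf f -> unitf g ->
  U [set x | `|f x - g x| <= e] -> `|ulim U f - ulim U g| <= e.
Proof.
move=> UU uf ug h; rewrite ler_distl; apply/andP; split.
  rewrite lerBlDr; apply: ulim_le => //; apply: filterS h => x /=.
  by rewrite ler_norml; lra.
by apply: ulim_le => //; apply: filterS h => x /=; rewrite ler_norml; lra.
Qed.

Lemma ulim_ge_cst U f l : UltraFilter U -> unitf f ->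
  U [set x | l <= f x] -> l <= ulim U f.
Proof.
move=> UU uf h; apply/ler_addgt0Pr => d d0.
have [x [/= h1 h2]] := filter_ex (filterI h (ulim_near UU uf d0)).
by move: h2; rewrite ltr_norml; lra.
Qed.

Lemma ulim_le_cst U f l : UltraFilter U -> unitf f ->
  U [set x | f x <= l] -> ulim U f <= l.
Proof.
move=> UU uf h; apply/ler_addgt0Pr => d d0.
have [x [/= h1 h2]] := filter_ex (filterI h (ulim_near UU uf d0)).
by move: h2; rewrite ltr_norml; lra.
Qed.

Lemma ulim_range U f : UltraFilter U -> unitf f -> 0 <= ulim U f <= 1.
Proof.
move=> UU uf; rewrite ulim_ge_cst ?ulim_le_cst//.
- by apply: filterE => x /=; case/andP: (uf x).
- by apply: filterE => x /=; case/andP: (uf x).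
Qed.

Lemma ulim_gt U f l : UltraFilter U -> unitf f -> l < ulim U f ->
  U [set x | l < f x].
Proof.
move=> UU uf h; have d0 : 0 < ulim U f - l by lra.
by apply: filterS (ulim_near UU uf d0) => x /=; rewrite ltr_norml; lra.
Qed.

Lemma ulim_lt U f l : UltraFilter U -> unitf f -> ulim U f < l ->
  U [set x | f x < l].
Proof.
move=> UU uf h; have d0 : 0 < l - ulim U f by lra.
by apply: filterS (ulim_near UU uf d0) => x /=; rewrite ltr_norml; lra.
Qed.

Lemma ulim_principal (x : I) f : unitf f -> ulim (principal_filter x) f = f x.
Proof.
move=> uf; have ? := principal_filter_ultra x.
by apply: ulim_eq => // e e0 y /= ->; rewrite subrr normr0 ltW.
Qed.

Lemma ulim_cst U l : UltraFilter U -> 0 <= l <= 1 -> ulim U (fun=> l) = l.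
Proof.
move=> UU l01; apply: ulim_eq => // e e0.
by apply: filterE => x /=; rewrite subrr normr0 ltW.
Qed.

Lemma eq_ulim U f g : f =1 g -> ulim U f = ulim U g.
Proof. by move=> /funext ->. Qed.

(** The usual form of compactness below: a directed family of nonempty sets takes the place of a
    finitely satisfiable set of conditions. *)
Lemma ultra_of_base (B : set (set I)) (B0 : exists P, B P) :
  (forall P Q, B P -> B Q -> exists2 S, B S & S `<=` P `&` Q) ->
  (forall P, B P -> P !=set0) ->
  exists2 U, UltraFilter U & forall P, B P -> U P.
Proof.
move=> BI Bne; have FB : Filter (filter_from B id) by exact: filter_from_filter.
have PB : ProperFilter (filter_from B id) by exact: filter_from_proper.
have [U [UU sU]] := ultraFilterLemma PB.
by exists U => // P BP; apply: sU; exists P.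
Qed.
End UltraLimit.

Lemma ultra_fmap (I J : Type) (f : I -> J) (U : set_system I) :
  UltraFilter U -> UltraFilter (f @ U).
Proof.
move=> UU; split; first exact: fmap_proper_filter.
move=> G PG sG; apply/seteqP; split; last by [].
move=> P GP; have [//|h] := in_ultra_setVsetC (f @^-1` P) UU.
have GnP : G (~` P) by apply: sG.
by have [x []] := filter_ex (filterI GP GnP).
Qed.

(** The integral of the ultrafilters [V i] along [U]. Limits along it are iterated limits, by
    [ulim_bind], which provides limits of types in the proof that X is compact. *)
Lemma ultra_bind (I J : Type) (U : set_system I) (V : I -> set_system J) :
  UltraFilter U -> (forall i, UltraFilter (V i)) ->
  UltraFilter [set P | U [set i | V i P]].
Proof.
move=> UU VU; have PF : ProperFilter [set P | U [set i | V i P]].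
  have FF : Filter [set P | U [set i | V i P]].
    split; first by apply: (@filterE _ U) => i; exact: filterT.
      by move=> P Q /= UP UQ; apply: filterS2 UP UQ => i; exact: filterI.
    by move=> P Q sPQ /= UP; apply: filterS UP => i /=; apply: filterS.
  by apply: Build_ProperFilter_ex => P /= /filter_ex [i /filter_ex].
split=> // G PG sG; apply/seteqP; split; last by [].
move=> P GP; have [//|h] := in_ultra_setVsetC [set i | V i P] UU.
have GnP : G (~` P).
  apply: sG => /=; apply: filterS h => i /= nV; exact: ultra_not.
by have [x []] := filter_ex (filterI GP GnP).
Qed.

Lemma ulim_bind (R : realType) (I J : Type) (U : set_system I)
    (V : I -> set_system J) (f : J -> R) :
  UltraFilter U -> (forall i, UltraFilter (V i)) -> unitf f ->
  ulim [set P | U [set i | V i P]] f = ulim U (fun i => ulim (V i) f).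
Proof.
move=> UU VU uf; have UB := ultra_bind UU VU.
have uV : unitf (fun i => ulim (V i) f) by move=> i; exact: ulim_range.
apply: ulim_eq => // e e0; have e20 : 0 < e / 2 by lra.
apply: filterS (ulim_near UU uV e20) => i /= h.
apply: filterS (ulim_near (VU i) uf e20) => x /= h'.
have := ler_distD (ulim (V i) f) (f x) (ulim U (fun i => ulim (V i) f)); lra.
Qed.

Lemma nat_free_ultra : exists2 U : set_system nat, UltraFilter U &
  forall n, U [set i | (n <= i)%N].
Proof.
pose B := [set P | exists n, P = [set i | (n <= i)%N]].
have B0 : exists P, B P by exists [set i | (0 <= i)%N], 0%N.
have BI P Q : B P -> B Q -> exists2 S, B S & S `<=` P `&` Q.
  move=> [n ->] [m ->]; exists [set i | (maxn n m <= i)%N]; first by eexists.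
  by move=> i /=; rewrite geq_max => /andP[].
have Bne P : B P -> P !=set0 by move=> [n ->]; exists n => /=.
have [U UU sU] := ultra_of_base B0 BI Bne.
by exists U => // n; apply: sU; exists n.
Qed.

(** * Truncation to [0,1] and continuous connectives *)

Section Clamp.
Variable R : realType.

(** A connective has to map the cube into [0,1]. Truncation turns every Lipschitz function into one,
    and by [clamp_dist] it does not worsen estimates. *)
Definition clamp (x : R) : R := Num.max 0 (Num.min 1 x).

Lemma clamp_range x : 0 <= clamp x <= 1.
Proof. by rewrite /clamp le_max lexx ge_max ler01 ge_min lexx. Qed.

Lemma clamp_id x : 0 <= x <= 1 -> clamp x = x.
Proof. by move=> /andP[x0 x1]; rewrite /clamp min_r// max_r. Qed.

Lemma clamp_ge x y : y <= 1 -> y <= x -> y <= clamp x.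
Proof. by move=> y1 yx; rewrite /clamp le_max le_min y1 yx orbT. Qed.

Lemma clamp_le x y : 0 <= y -> x <= y -> clamp x <= y.
Proof. by move=> y0 xy; rewrite /clamp ge_max ge_min y0 xy orbT. Qed.

Lemma clamp_gt0 x : (0 < clamp x) = (0 < x).
Proof. by rewrite /clamp lt_max ltxx lt_min ltr01. Qed.

Lemma clampP x : (x <= 0 /\ clamp x = 0) \/ (0 <= x <= 1 /\ clamp x = x) \/
  (1 <= x /\ clamp x = 1).
Proof.
have [x0|x0] := leP x 0; first by left; rewrite /clamp min_r ?max_l//; lra.
have [x1|x1] := leP x 1; last by right; right; rewrite /clamp min_l ?max_r//; lra.
by right; left; rewrite clamp_id ltW.
Qed.

Lemma clamp_dist x y : `|clamp x - clamp y| <= `|x - y|.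
Proof.
have := ler_norm (x - y); have := ler_normr (x - y) (x - y); rewrite ler_norml.
have := ler_norm (- (x - y)); rewrite normrN.
by case: (clampP x) => [[? ->]|[[/andP[? ?] ->]|[? ->]]];
   case: (clampP y) => [[? ->]|[[/andP[? ?] ->]|[? ->]]]; move=> ? _ ?; apply/andP; split; lra.
Qed.
End Clamp.

Section Connectives.
Variable R : realType.

Lemma rV_nbhs k (v : 'rV[R]_k) (e : R) : 0 < e ->
  nbhs v [set w : 'rV[R]_k | forall i, `|v ord0 i - w ord0 i| < e].
Proof.
move=> e0; exists (fun i j => ball (v i j) e).
  by move=> i j; exact: nbhsx_ballx.
by move=> w h i; exact: (h ord0 i).
Qed.

Lemma lip_connective_cont k (h : ('I_k -> R) -> R) C :
  (forall v w e, 0 <= e -> (forall i, `|v i - w i| <= e) -> `|h v - h w| <= C * e) ->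
  {within @unit_cube R k, continuous (fun v : 'rV[R]_k => clamp (h (v ord0)))}.
Proof.
move=> hC; apply: continuous_subspaceT => v.
apply/(@cvgrPdist_le _ _ _ (nbhs v) (nbhs_filter v)) => e e0.
have C0 : 0 < `|C| + 1 by rewrite ltr_wpDl.
have d0 : 0 < e / (`|C| + 1) by rewrite divr_gt0.
apply: (@filterS _ (nbhs v) (nbhs_filter v) _ _ _ (rV_nbhs v d0)) => w hw.
apply: le_trans (clamp_dist _ _) _.
apply: le_trans (hC _ _ (e / (`|C| + 1)) (ltW d0) _) _.
  by move=> i; rewrite ltW.
rewrite mulrCA ler_piMr ?ltW// ltr_pdivrMr// mul1r.
by rewrite (le_lt_trans (ler_norm C))// ltrDl.
Qed.

Definition lip_connective k (h : ('I_k -> R) -> R) C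
  (hC : forall v w e, 0 <= e -> (forall i, `|v i - w i| <= e) ->
    `|h v - h w| <= C * e) : connective R k :=
  Connective (lip_connective_cont hC) (fun v _ => clamp_range (h (v ord0))).

(** Compactness of the cube: counterexamples at distance 1/(n+1) would give two sequences with the
    same limit [l] along a free ultrafilter, against the continuity of [u] at [l] within the
    cube. *)
Lemma connective_unif k (u : connective R k) eps : 0 < eps ->
  exists2 d, 0 < d & forall v w, @unit_cube R k v -> @unit_cube R k w ->
    (forall i, `|v ord0 i - w ord0 i| <= d) -> `|u v - u w| <= eps.
Proof.
move=> eps0; apply: contrapT => nd.
have /choice[vw hvw] : forall n : nat, exists vw : 'rV[R]_k * 'rV[R]_k,
    [/\ @unit_cube R k vw.1, @unit_cube R k vw.2,
      forall i, `|vw.1 ord0 i - vw.2 ord0 i| <= n.+1%:R^-1 &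
      eps < `|u vw.1 - u vw.2|].
  move=> n; apply: contrapT => nvw; apply: nd; exists n.+1%:R^-1.
    by rewrite invr_gt0.
  move=> v w cv cw h; rewrite leNgt; apply/negP => h'.
  by apply: nvw; exists (v, w).
have [U UU Un] := nat_free_ultra.
pose l : 'rV[R]_k := \row_i ulim U (fun n => (vw n).1 ord0 i).
have uv i : unitf (fun n => (vw n).1 ord0 i) by move=> n; case: (hvw n).
have uw i : unitf (fun n => (vw n).2 ord0 i) by move=> n; case: (hvw n).
have cl : @unit_cube R k l by move=> i; rewrite mxE; exact: ulim_range.
have lE i : l ord0 i = ulim U (fun n => (vw n).2 ord0 i).
  rewrite mxE; apply/eqP; rewrite -subr_eq0 -normr_le0.
  apply/ler_addgt0Pr => e e0; rewrite add0r.
  apply: ulim_dist => //; apply: filterS (Un (Num.truncn e^-1)) => n /= en.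
  have [_ _ /(_ i) h _] := hvw n; apply: le_trans h _.
  rewrite -[leRHS]invrK lef_pV2 ?posrE ?invr_gt0//.
  apply: ltW; apply: (lt_le_trans (truncnS_gt _)).
  by rewrite ler_nat ltnS.
have cu : u @ within (@unit_cube R k) (nbhs l) --> u l.
  by have /subspace_continuousP := @conn_cont R k u; apply.
have e20 : 0 < eps / 2 by lra.
have [P Pl hP] : exists2 P : 'I_1 -> 'I_k -> set R,
    (forall i j, nbhs (l i j) (P i j)) &
    forall v, @unit_cube R k v -> (forall i j, P i j (v i j)) -> `|u l - u v| < eps / 2.
  have /cvgrPdist_lt /(_ _ e20) := cu; rewrite near_withinE.
  by move=> [P hP sP]; exists P => // v cv hv; apply: sP.
have Pv : U [set n | forall i j, P i j ((vw n).1 i j)].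
  apply: filter_forall => i; apply: filter_forall => j.
  have [e /= e0 he] := Pl i j; apply: filterS (ulim_near UU (uv j) e0) => n /= h.
  by apply: he; rewrite /= (ord1 i) [l _ _]mxE distrC.
have Pw : U [set n | forall i j, P i j ((vw n).2 i j)].
  apply: filter_forall => i; apply: filter_forall => j.
  have [e /= e0 he] := Pl i j; apply: filterS (ulim_near UU (uw j) e0) => n /= h.
  by apply: he; rewrite /= (ord1 i) [l _ _]lE distrC.
have [n [/= h1 h2]] := filter_ex (filterI Pv Pw).
have [c1 c2 _] := hvw n; rewrite ltNge; apply/negP; rewrite negbK.
have := ler_distD (u l) (u (vw n).1) (u (vw n).2).
have := hP _ c1 h1; have := hP _ c2 h2; rewrite [`|u l - u (vw n).1|]distrC; lra.
Qed.
End Connectives.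

(** * Suprema and syntactic constructions *)

Section SupOverType.
Variable R : realType.
Implicit Types (A B : Type).

Definition supT A (f : A -> R) : R := sup [set f a | a in [set: A]].

(* For [0,1]-valued functions this is the infimum. *)
Definition infT A (f : A -> R) : R := 1 - supT (fun a => 1 - f a).

Lemma unitfC A (f : A -> R) : unitf f -> unitf (fun a => 1 - f a).
Proof. by move=> uf a; have /= := uf a; lra. Qed.

Lemma supT_ge A (f : A -> R) a : unitf f -> f a <= supT f.
Proof.
move=> uf; apply: ub_le_sup; last by exists a.
by exists 1 => _ [b _ <-]; case/andP: (uf b).
Qed.

Lemma supT_le A (f : A -> R) (a : A) r : (forall a, f a <= r) -> supT f <= r.
Proof. by move=> h; apply: ge_sup; [exists (f a), a|move=> _ [b _ <-]]. Qed.

Lemma supT_near A (f : A -> R) (a : A) e : unitf f -> 0 < e ->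
  exists b, supT f - e < f b.
Proof.
move=> uf e0; have hs : has_sup [set f a | a in [set: A]].
  by split; [exists (f a), a|exists 1 => _ [b _ <-]; case/andP: (uf b)].
by have [_ [b _ <-] h] := sup_adherent e0 hs; exists b.
Qed.

Lemma supT_range A (f : A -> R) (a : A) : unitf f -> 0 <= supT f <= 1.
Proof.
move=> uf; rewrite (le_trans _ (supT_ge a uf)); last by case/andP: (uf a).
by apply: supT_le => // b; case/andP: (uf b).
Qed.

Lemma supT_dist A (f g : A -> R) (a : A) e : unitf f -> unitf g ->
  (forall a, `|f a - g a| <= e) -> `|supT f - supT g| <= e.
Proof.
move=> uf ug h; rewrite ler_distl; apply/andP; split.
  rewrite lerBlDr; apply: supT_le => // b; have := supT_ge b uf.
  by have := h b; rewrite ler_norml; lra.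
apply: supT_le => // b; have := supT_ge b ug.
by have := h b; rewrite ler_norml; lra.
Qed.

Lemma supT_le_supT A B (f : A -> R) (g : B -> R) (a : A) : unitf g ->
  (forall a, exists b, f a <= g b) -> supT f <= supT g.
Proof.
move=> ug h; apply: supT_le => // a'; have [b h'] := h a'.
by apply: le_trans h' _; exact: supT_ge.
Qed.

Lemma supT_eq A B (f : A -> R) (g : B -> R) (a : A) (b : B) :
  unitf f -> unitf g ->
  (forall a, exists b, f a = g b) -> (forall b, exists a, g b = f a) ->
  supT f = supT g.
Proof.
move=> uf ug fg gf; apply/eqP; rewrite eq_le; apply/andP; split.
  by apply: supT_le_supT => // a'; have [b' ->] := fg a'; exists b'.
by apply: supT_le_supT => // b'; have [a' ->] := gf b'; exists a'.
Qed.

Lemma supT_pair A B (f : A -> B -> R) (a : A) (b : B) :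
  (forall a, unitf (f a)) ->
  supT (fun a => supT (f a)) = supT (fun ab : A * B => f ab.1 ab.2).
Proof.
move=> uf; have us : unitf (fun a => supT (f a)) by move=> a'; exact: supT_range.
have up : unitf (fun ab : A * B => f ab.1 ab.2) by move=> [a' b'] /=; exact: uf.
apply/eqP; rewrite eq_le; apply/andP; split.
  by apply: supT_le => // a'; apply: supT_le => // b'; exact: (supT_ge (a', b') up).
apply: supT_le => [|[a' b']] /=; first exact: (a, b).
exact: le_trans (supT_ge b' (uf a')) (supT_ge a' us).
Qed.

Lemma infT_le A (f : A -> R) a : unitf f -> infT f <= f a.
Proof. by move=> uf; rewrite /infT lerBlDr -lerBlDl; exact: (supT_ge a (unitfC uf)). Qed.

Lemma infT_ge A (f : A -> R) (a : A) r : (forall a, r <= f a) -> r <= infT f.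
Proof.
move=> h; rewrite /infT; have : supT (fun a => 1 - f a) <= 1 - r.
  by apply: supT_le => // b; have := h b; lra.
by lra.
Qed.

Lemma infT_near A (f : A -> R) (a : A) e : unitf f -> 0 < e ->
  exists b, f b < infT f + e.
Proof.
move=> uf e0; have [b /= h] := supT_near a (unitfC uf) e0.
by exists b; rewrite /infT; lra.
Qed.

Lemma infTE A (f : A -> R) (a : A) : unitf f ->
  inf [set f a | a in [set: A]] = infT f.
Proof.
move=> uf; have lb0 : lbound [set f a | a in [set: A]] 0.
  by move=> _ [b _ <-]; case/andP: (uf b).
apply/eqP; rewrite eq_le; apply/andP; split.
  by apply: infT_ge => // b; apply: ge_inf; [exists 0|exists b].
by apply: lb_le_inf; [exists (f a), a|move=> _ [b _ <-]; exact: infT_le].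
Qed.

Lemma infT_dist A (f g : A -> R) (a : A) e : unitf f -> unitf g ->
  (forall a, `|f a - g a| <= e) -> `|infT f - infT g| <= e.
Proof.
move=> uf ug h; rewrite /infT opprB addrC addrA subrK distrC.
apply: (supT_dist a (unitfC uf) (unitfC ug)) => b.
by rewrite opprB addrC addrA subrK distrC.
Qed.

End SupOverType.

Section Formulas.
Variables (R : realType) (S : symbols).
Implicit Types (V W U : ctx S) (M : interp R S).

Lemma feval_lip (V : ctx S) k (h : ('I_k -> R) -> R) C hC
    (phis : 'I_k -> formula R V) (M : interp R S) (e : env M V) :
  feval (Conn (@lip_connective R k h C hC) phis) e =
  clamp (h (fun i => feval (phis i) e)).
Proof. by congr (clamp (h _)); apply/funext => i; rewrite mxE. Qed.

Definition lip2 (h : R -> R -> R) (C : R) :=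
  forall s s' t t', `|h s t - h s' t'| <= C * (`|s - s'| + `|t - t'|).

Lemma lip2_lip h C : lip2 h C -> forall (v w : 'I_2 -> R) e, 0 <= e ->
  (forall i, `|v i - w i| <= e) ->
  `|h (v ord0) (v ord_max) - h (w ord0) (w ord_max)| <= `|C| * 2 * e.
Proof.
move=> hC v w e e0 h'; apply: le_trans (hC _ _ _ _) _.
have h0 := h' ord0; have h1 := h' ord_max.
rewrite -mulrA; apply: (@le_trans _ _ (`|C| * (`|v ord0 - w ord0| + `|v ord_max - w ord_max|))).
  by apply: ler_wpM2r; [rewrite addr_ge0|exact: ler_norm].
by apply: ler_wpM2l => //; lra.
Qed.

Definition fop2 h C (hC : lip2 h C) V (phi psi : formula R V) : formula R V :=
  Conn (lip_connective (lip2_lip hC)) (fun i : 'I_2 => if i == ord0 then phi else psi).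

Lemma feval_op2 h C (hC : lip2 h C) V (phi psi : formula R V)
    (M : interp R S) (e : env M V) :
  feval (fop2 hC phi psi) e = clamp (h (feval phi e) (feval psi e)).
Proof. by rewrite feval_lip. Qed.

Lemma fcst_lip (r : R) (v w : 'I_0 -> R) (e : R) : 0 <= e ->
  (forall i, `|v i - w i| <= e) -> `|r - r| <= 0 * e.
Proof. by rewrite subrr normr0 mul0r. Qed.

Definition fcst V (r : R) : formula R V :=
  Conn (@lip_connective R 0 (fun=> r) 0 (@fcst_lip r))
    (fun i : 'I_0 => match notF (ltn_ord i) with end).

Lemma feval_cst V r (M : interp R S) (e : env M V) : 0 <= r <= 1 ->
  feval (fcst V r) e = r.
Proof. by move=> r01; rewrite /fcst feval_lip clamp_id. Qed.

Lemma lip2_absd : lip2 (fun s t => `|s - t|) 1.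
Proof.
move=> s s' t t'; rewrite mul1r; apply: le_trans (ler_dist_dist _ _) _.
have -> : s - t - (s' - t') = (s - s') + (t' - t) by lra.
by apply: le_trans (ler_normD _ _) _; rewrite [`|t' - t|]distrC.
Qed.

Lemma lip2_linear a b c : lip2 (fun s t => a * s + b * t + c) (`|a| + `|b|).
Proof.
move=> s s' t t'; have -> : a * s + b * t + c - (a * s' + b * t' + c) =
  a * (s - s') + b * (t - t') by lra.
apply: le_trans (ler_normD _ _) _; rewrite !normrM mulrDl !mulrDr.
have := mulr_ge0 (normr_ge0 a) (normr_ge0 (t - t')).
have := mulr_ge0 (normr_ge0 b) (normr_ge0 (s - s')); lra.
Qed.

Lemma maxrE (s t : R) : Num.max s t = (s + t + `|s - t|) / 2.
Proof.
have [h|h] := leP s t; first by rewrite ler0_norm; lra.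
by rewrite gtr0_norm; lra.
Qed.

Lemma lip2_max : lip2 (fun s t => Num.max s t) 2.
Proof.
move=> s s' t t'; rewrite !maxrE.
have := lip2_absd s s' t t'; rewrite mul1r => h.
have -> : (s + t + `|s - t|) / 2 - (s' + t' + `|s' - t'|) / 2 =
  2^-1 * ((s - s') + (t - t') + (`|s - t| - `|s' - t'|)) by lra.
rewrite normrM; have -> : `|2^-1 : R| = 2^-1 by rewrite ger0_norm// invr_ge0.
have := ler_normD (s - s' + (t - t')) (`|s - t| - `|s' - t'|).
have := ler_normD (s - s') (t - t').
have := normr_ge0 (s - s'); have := normr_ge0 (t - t'); lra.
Qed.

Definition fabsd := fop2 lip2_absd.
Definition fmax := fop2 lip2_max.
Definition flin a b c := fop2 (lip2_linear a b c).

Lemma clamp_unit_absd (s t : R) : 0 <= s <= 1 -> 0 <= t <= 1 ->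
  clamp `|s - t| = `|s - t|.
Proof.
move=> s01 t01; rewrite clamp_id// normr_ge0 ler_norml.
by move: s01 t01 => /andP[? ?] /andP[? ?]; apply/andP; split; lra.
Qed.

Lemma feval_absd V (phi psi : formula R V) (M : interp R S) (e : env M V) :
  feval (fabsd phi psi) e = `|feval phi e - feval psi e|.
Proof. by rewrite feval_op2 clamp_unit_absd ?feval_range. Qed.

Lemma feval_max V (phi psi : formula R V) (M : interp R S) (e : env M V) :
  feval (fmax phi psi) e = Num.max (feval phi e) (feval psi e).
Proof.
rewrite feval_op2 clamp_id// le_max ge_max; have /andP[-> ->] := feval_range phi e.
by have /andP[_ ->] := feval_range psi e.
Qed.

Lemma feval_lin a b c V (phi psi : formula R V) (M : interp R S) (e : env M V) :
  feval (flin a b c phi psi) e = clamp (a * feval phi e + b * feval psi e + c).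
Proof. exact: feval_op2. Qed.

Definition fneg V (phi : formula R V) := flin (-1) 0 1 phi phi.

Lemma feval_neg V (phi : formula R V) (M : interp R S) (e : env M V) :
  feval (fneg phi) e = 1 - feval phi e.
Proof. by rewrite feval_lin clamp_id; have := feval_range phi e; lra. Qed.

(** * Formulas depend on finitely many variables *)

Section FiniteSupport.
Variable W : ctx S.

(** A finite family of variables of [W], possibly with repetitions, so that unions are disjoint sums
    of index types ([sp_big]). *)
Definition support := {I : finType & {sg : I -> srt S & forall i, W (sg i)}}.
Definition sp_ix (s : support) : finType := tag s.
Definition sp_srt (s : support) : sp_ix s -> srt S := tag (tagged s).
Definition sp_var (s : support) : forall i, W (sp_srt (s := s) i) :=
  tagged (tagged s).
Definition sp_ctx (s : support) : ctx S := vars (@sp_srt s).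
Definition sp_env M (s : support) (w : env M W) : env M (sp_ctx s) :=
  tuple_env (fun i => w _ (@sp_var s i)).

Definition sp0 : support :=
  existT _ (void : finType) (existT (fun sg : void -> srt S => forall i, W (sg i))
    (fun i : void => match i with end) (fun i : void => match i with end)).

Definition sp1 s (v : W s) : support :=
  existT _ (unit : finType) (existT _ (fun=> s) (fun=> v)).

Definition sp_big (J : finType) (F : J -> support) : support :=
  existT _ ({j : J & sp_ix (F j)} : finType)
    (existT _ (fun u => sp_srt (tagged u)) (fun u => sp_var (tagged u))).

Definition sp_inj (J : finType) (F : J -> support) j :
    ctx_map (sp_ctx (F j)) (sp_ctx (sp_big F)) :=
  fun s v => match v with VarOf i => VarOf _ (Tagged (fun j => sp_ix (F j)) i) end.

Lemma sp_env_inj M (J : finType) (F : J -> support) j (w : env M W) s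
    (v : sp_ctx (F j) s) :
  sp_env (s := sp_big F) w (sp_inj v) = sp_env w v.
Proof. by case: v. Qed.

Lemma env_cat_map M V V' X X' (f : ctx_map V V') (g : ctx_map X X')
    (e : env M V') (x : env M X') :
  (fun s v => env_cat e x (cat_map f g v)) =
  env_cat (fun s v => e s (f s v)) (fun s v => x s (g s v)).
Proof.
by apply: functional_extensionality_dep => s;
   apply: functional_extensionality_dep; case.
Qed.

Lemma sp_cat_inj M V (J : finType) (F : J -> support) j (e : env M V)
    (w : env M W) :
  (fun s v => env_cat e (sp_env (s := sp_big F) w)
     (cat_map (fun s => id) (@sp_inj J F j) v)) =
  env_cat e (sp_env w).
Proof.
rewrite env_cat_map; congr env_cat.
apply: functional_extensionality_dep => s.
by apply: functional_extensionality_dep => v; exact: sp_env_inj.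
Qed.

Lemma term_support U V (p : ctx_map U (ctx_cat V W)) s (t : term U s) :
  exists (F : support) (t' : term (ctx_cat V (sp_ctx F)) s),
    forall (M : interp R S) (e : env M V) (w : env M W),
      teval (fun s u => env_cat e w (p s u)) t = teval (env_cat e (sp_env w)) t'.
Proof.
elim: t => [{}s u|f ts IH].
  case E : (p s u) => [v|x]; first by exists sp0, (Var (inl v)) => M e w /=; rewrite E.
  exists (sp1 x), (Var (inr (VarOf (fun=> s) (tt : sp_ix (sp1 x))))) => M e w /=.
  by rewrite E.
have hc : forall i, {Ft : {F : support & term (ctx_cat V (sp_ctx F)) (fdom f i)} |
    forall (M : interp R S) (e : env M V) (w : env M W),
      teval (fun s u => env_cat e w (p s u)) (ts i) =
      teval (env_cat e (sp_env w)) (tagged Ft)}.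
  by move=> i; apply: cid; have [F [t' h]] := IH i; exists (existT _ F t').
pose Ft i := projT1 (hc i); have hFt i := projT2 (hc i).
exists (sp_big (fun i => tag (Ft i))), (App f (fun i =>
  tren (cat_map (fun s => id) (@sp_inj _ (fun i => tag (Ft i)) i)) (tagged (Ft i)))).
move=> M e w /=; congr (fint M f _).
by apply: functional_extensionality_dep => i; rewrite teval_ren sp_cat_inj hFt.
Qed.

Definition lift_cat V s : ctx_map (ctx_cat (ctx_ext V s) W) (ctx_ext (ctx_cat V W) s) :=
  fun s' v => match v with
    | inl v => match v in ctx_ext _ _ s' return ctx_ext (ctx_cat V W) s s' with
               | Old s1 v1 => Old s (inl v1) | New => New end
    | inr x => Old s (inr x) end.
End FiniteSupport.

Definition ext_cat V W s : ctx_map (ctx_ext (ctx_cat V W) s) (ctx_cat (ctx_ext V s) W) :=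
  fun s' v => match v in ctx_ext _ _ s' return ctx_cat (ctx_ext V s) W s' with
    | Old s1 (inl v1) => inl (Old s v1)
    | Old s1 (inr x) => inr x
    | New => inl New end.

(** The context [U], with its map [p], is kept general for the sake of the induction: under a
    quantifier [U] becomes [ctx_ext U s], and the bound variable has to join [V], whose variables
    are not counted. *)
Lemma formula_support W U V (p : ctx_map U (ctx_cat V W)) (psi : formula R U) :
  exists (F : support W) (psi' : formula R (ctx_cat V (sp_ctx F))),
    forall (M : interp R S) (e : env M V) (w : env M W),
      feval psi (fun s u => env_cat e w (p s u)) =
      feval psi' (env_cat e (sp_env w)).
Proof.
elim: psi V p => {U} [U s t u|U r ts|U k c phis IH|U s psi IH|U s psi IH] V p.
- have [F1 [t1 h1]] := term_support p t; have [F2 [t2 h2]] := term_support p u.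
  pose T := {F : support W & term (ctx_cat V (sp_ctx F)) s}.
  pose G (b : bool) : T := if b then existT _ F1 t1 else existT _ F2 t2.
  exists (sp_big (fun b => tag (G b))), (Dist
    (tren (cat_map (fun s => id) (@sp_inj _ _ (fun b => tag (G b)) true)) (tagged (G true)))
    (tren (cat_map (fun s => id) (@sp_inj _ _ (fun b => tag (G b)) false)) (tagged (G false)))).
  move=> M e w.
  have E b : teval (env_cat e (sp_env w)) (tren (cat_map (fun s => id)
      (@sp_inj _ _ (fun b => tag (G b)) b)) (tagged (G b))) =
      teval (env_cat e (sp_env w)) (tagged (G b)).
    by rewrite teval_ren sp_cat_inj.
  by congr (mdist _ _); [rewrite h1; exact/esym/(E true)|
                         rewrite h2; exact/esym/(E false)].
- have hc : forall i,
      {Ft : {F : support W & term (ctx_cat V (sp_ctx F)) (rdom r i)} |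
      forall (M : interp R S) (e : env M V) (w : env M W),
      teval (fun s u => env_cat e w (p s u)) (ts i) =
      teval (env_cat e (sp_env w)) (tagged Ft)}.
    move=> i; apply: cid; have [F [t' h]] := term_support p (ts i).
    by exists (existT _ F t').
  pose Ft i := projT1 (hc i); have hFt i := projT2 (hc i).
  exists (sp_big (fun i => tag (Ft i))), (Rel r (fun i =>
    tren (cat_map (fun s => id) (@sp_inj _ _ (fun i => tag (Ft i)) i)) (tagged (Ft i)))).
  move=> M e w /=; congr (rint M r _).
  by apply: functional_extensionality_dep => i; rewrite teval_ren sp_cat_inj hFt.
- have hc : forall i,
      {Ft : {F : support W & formula R (ctx_cat V (sp_ctx F))} |
      forall (M : interp R S) (e : env M V) (w : env M W),
      feval (phis i) (fun s u => env_cat e w (p s u)) =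
      feval (tagged Ft) (env_cat e (sp_env w))}.
    by move=> i; apply: cid; have [F [t' h]] := IH i V p; exists (existT _ F t').
  pose Ft i := projT1 (hc i); have hFt i := projT2 (hc i).
  exists (sp_big (fun i => tag (Ft i))), (Conn c (fun i =>
    fren (cat_map (fun s => id) (@sp_inj _ _ (fun i => tag (Ft i)) i)) (tagged (Ft i)))).
  move=> M e w /=; congr (conn_fun c _); apply/rowP => i; rewrite !mxE.
  by rewrite feval_ren sp_cat_inj hFt.
- have [F [psi' h]] := IH _ (fun s' v => ext_cat (@ext_map _ _ _ p s s' v)).
  exists F, (Sup s (fren (@lift_cat (sp_ctx F) V s) psi')) => M e w /=.
  congr sup; congr image; apply/funext => a; rewrite feval_ren.
  transitivity (feval psi' (env_cat (env_ext e a) (sp_env w))).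
    rewrite -h; congr (feval psi _); apply: functional_extensionality_dep => s'.
    apply: functional_extensionality_dep => -[s1 v1|] //=.
    by case: (p s1 v1).
  congr (feval psi' _); apply: functional_extensionality_dep => s'.
  by apply: functional_extensionality_dep => -[[]|].
- have [F [psi' h]] := IH _ (fun s' v => ext_cat (@ext_map _ _ _ p s s' v)).
  exists F, (Inf s (fren (@lift_cat (sp_ctx F) V s) psi')) => M e w /=.
  congr inf; congr image; apply/funext => a; rewrite feval_ren.
  transitivity (feval psi' (env_cat (env_ext e a) (sp_env w))).
    rewrite -h; congr (feval psi _); apply: functional_extensionality_dep => s'.
    apply: functional_extensionality_dep => -[s1 v1|] //=.
    by case: (p s1 v1).
  congr (feval psi' _); apply: functional_extensionality_dep => s'.
  by apply: functional_extensionality_dep => -[[]|].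
Qed.

Definition enum_var (I : finType) (sg : I -> srt S) :
    ctx_map (vars sg) (vars (fun k : 'I_#|I| => sg (enum_val k))) :=
  fun s v => match v with VarOf i =>
    match enum_rankK i in _ = j
      return vars (fun k : 'I_#|I| => sg (enum_val k)) (sg j) with
    | erefl => VarOf _ (enum_rank i) end end.

Lemma tuple_env_enum (M : interp R S) (I : finType) (sg : I -> srt S)
    (t : forall i, M (sg i)) s (v : vars sg s) :
  tuple_env (fun k : 'I_#|I| => t (enum_val k)) (enum_var v) = tuple_env t v.
Proof.
have h (i j : I) (E : enum_val (enum_rank i) = j) :
    tuple_env (fun k : 'I_#|I| => t (enum_val k))
      (match E in _ = j return vars (fun k : 'I_#|I| => sg (enum_val k)) (sg j) with
       | erefl => VarOf _ (enum_rank i) end) = t j by case: _ / E.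
by case: v => i; exact: h.
Qed.

Lemma formula_finite W V (psi : formula R (ctx_cat V W)) :
  exists k (sg : 'I_k -> srt S) (f : forall i, W (sg i))
      (psi' : formula R (ctx_cat V (vars sg))),
    forall (M : interp R S) (e : env M V) (w : env M W),
      feval psi (env_cat e w) = feval psi' (env_cat e (tuple_env (fun i => w _ (f i)))).
Proof.
have [F [psi' h]] := formula_support (fun s (u : ctx_cat V W s) => u) psi.
exists #|sp_ix F|, (fun k => sp_srt (enum_val k)), (fun k => sp_var (enum_val k)),
  (fren (cat_map (fun s => id) (@enum_var _ (@sp_srt _ F))) psi') => M e w.
rewrite h feval_ren env_cat_map; congr (feval psi' (env_cat e _)).
apply: functional_extensionality_dep => s.
apply: functional_extensionality_dep => v.
exact/esym/(tuple_env_enum (fun i => w _ (sp_var i))).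
Qed.
End Formulas.
Arguments fop2 : simpl never.
Arguments fabsd : simpl never.
Arguments fmax : simpl never.
Arguments flin : simpl never.
Arguments fneg : simpl never.
Arguments fcst : simpl never.

(** * Definable predicates *)

Section QuantifierClosure.
Variables (R : realType) (S : symbols).
Implicit Types (V W : ctx S) (M : interp R S).

Definition env_elt M V : env M V := fun s _ => elt M s.
Arguments env_elt M V s v : clear implicits.

Lemma tup_cons M k (sg : 'I_k.+1 -> srt S) (a : M (sg ord0))
    (t : forall j, M (sg (lift ord0 j))) :
  exists t' : tup M sg, t' ord0 = a /\ forall j, t' (lift ord0 j) = t j.
Proof.
pose t' i : M (sg i) := match unliftP ord0 i with
  | UnliftSome j E => eq_rect_r (fun i => M (sg i)) (t j) E
  | UnliftNone E => eq_rect_r (fun i => M (sg i)) a E end.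
exists t'; split=> [|j]; rewrite /t'; case: (unliftP _ _) => [j' E|E].
- by exfalso; have := neq_lift ord0 j'; rewrite -E eqxx.
- by rewrite (eq_irrelevance E erefl).
- by have E' := lift_inj E; subst j'; rewrite (eq_irrelevance E erefl).
- by exfalso; have := neq_lift ord0 j; rewrite E eqxx.
Qed.

Lemma formula_supn k (sg : 'I_k -> srt S) V (psi : formula R (ctx_cat V (vars sg))) :
  exists theta : formula R V, forall M (e : env M V),
    feval theta e = supT (fun t : tup M sg => feval psi (env_cat e (tuple_env t))).
Proof.
elim: k sg V psi => [|k IH] sg V psi.
  pose g0 : ctx_map (ctx_cat V (vars sg)) V := fun s v => match v with inl v => v
    | inr x => match x in vars _ s return V s with
               | VarOf i => match notF (ltn_ord i) with end end end.
  exists (fren g0 psi) => M e; rewrite feval_ren.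
  have E (t : tup M sg) : (fun s v => e s (g0 s v)) = env_cat e (tuple_env t).
    apply: functional_extensionality_dep => s.
    by apply: functional_extensionality_dep => -[//|[[]]].
  have t0 : tup M sg by case.
  apply/eqP; rewrite eq_le; apply/andP; split.
    rewrite (E t0); apply: (@supT_ge _ _ (fun t => feval psi (env_cat e (tuple_env t)))).
    by move=> t; exact: feval_range.
  by apply: supT_le => // t; rewrite (E t).
pose V' := ctx_ext V (sg ord0); pose sg' j := sg (lift ord0 j).
have g i : {v : ctx_cat V' (vars sg') (sg i) | forall M (e : env M V) (t : tup M sg),
    env_cat (env_ext e (t ord0)) (tuple_env (fun j => t (lift ord0 j))) v = t i}.
  case: (unliftP ord0 i) => [j ->|->].
    by exists (inr (VarOf sg' j)).
  by exists (inl New).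
pose h : ctx_map (ctx_cat V (vars sg)) (ctx_cat V' (vars sg')) := fun s v =>
  match v with inl v => inl (Old _ v) | inr x =>
    match x with VarOf i => projT1 (g i) end end.
have [theta htheta] := IH sg' V' (fren h psi).
have hE M (e : env M V) (t : tup M sg) :
    feval (fren h psi) (env_cat (env_ext e (t ord0))
      (tuple_env (fun j => t (lift ord0 j)))) = feval psi (env_cat e (tuple_env t)).
  rewrite feval_ren; congr (feval psi _).
  apply: functional_extensionality_dep => s.
  by apply: functional_extensionality_dep => -[//|[i]]; rewrite /= (projT2 (g i)).
exists (Sup (sg ord0) theta) => M e /=.
rewrite -/(supT (fun a => feval theta (env_ext e a))).
have -> : (fun a => feval theta (env_ext e a)) = (fun a => supT (fun t : tup M sg' =>
    feval (fren h psi) (env_cat (env_ext e a) (tuple_env t)))).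
  by apply/funext => a; rewrite htheta.
have a0 := elt M (sg ord0); have t0 : tup M sg' by move=> j; exact: elt.
rewrite supT_pair//; last by move=> a t; exact: feval_range.
have t1 : tup M sg by move=> i; exact: elt.
apply: (@supT_eq _ _ _ _ _ (a0, t0) t1);
  [by move=> at'; exact: feval_range|by move=> at'; exact: feval_range| |].
  move=> [a t] /=; have [t' [<- ht']] := tup_cons a t; exists t'.
  have -> : t = fun j => t' (lift ord0 j).
    by apply: functional_extensionality_dep => j; rewrite ht'.
  exact: hE.
by move=> t; exists (t ord0, fun j => t (lift ord0 j)); rewrite hE.
Qed.

Definition cast A (P : A -> Type) x y (E : x = y) : P x -> P y :=
  match E with erefl => id end.

(** Only finitely many variables of [W] matter, but [f] may list one of them at several places, to
    which a tuple could give different values. Each place is therefore read through the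
    representative that [pk] chooses for its variable; then tuples and environments have the same
    supremum. *)
Lemma formula_sup W V (psi : formula R (ctx_cat V W)) :
  exists theta : formula R V, forall M (e : env M V),
    feval theta e = supT (fun w : env M W => feval psi (env_cat e w)).
Proof.
have [k [sg [f [psi' hpsi]]]] := formula_finite psi.
pose tg i : {s : srt S & W s} := Tagged W (f i).
pose pk u := [pick j : 'I_k | `[< tg j = u >]].
have hc i : {j : 'I_k & {E : tg j = tg i & pk (tg i) = Some j}}.
  rewrite /pk; case: pickP => [j /asboolP E|/(_ i)]; last by rewrite asboolT.
  by exists j; exists E.
pose g0 i : vars sg (sg i) :=
  cast (P := fun u => vars sg (tag u)) (projT1 (projT2 (hc i)))
    (VarOf sg (projT1 (hc i))).
pose g : ctx_map (vars sg) (vars sg) := fun s v => match v with VarOf i => g0 i end.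
have gE M (t : tup M sg) i : tuple_env t (g0 i) =
    cast (P := fun u => M (tag u)) (projT1 (projT2 (hc i))) (t (projT1 (hc i))).
  have h j u (E : tg j = u) :
    tuple_env t (cast (P := fun u => vars sg (tag u)) E (VarOf sg j)) =
    cast (P := fun u => M (tag u)) E (t j) by case: _ / E.
  exact: (h _ (tg i)).
have [theta htheta] := formula_supn (fren (cat_map (fun s => id) g) psi').
exists theta => M e; rewrite htheta.
have evg (t : tup M sg) (w : env M W) : (forall i, tuple_env t (g0 i) = w _ (f i)) ->
    feval (fren (cat_map (fun s => id) g) psi') (env_cat e (tuple_env t)) =
    feval psi (env_cat e w).
  move=> tw; rewrite feval_ren env_cat_map hpsi; congr (feval psi' (env_cat e _)).
  apply: functional_extensionality_dep => s.
  by apply: functional_extensionality_dep => -[i] /=.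
have t0 : tup M sg by move=> i; exact: elt.
refine (@supT_eq _ _ _ _ _ t0 (env_elt M W) _ _ _ _);
  [by move=> ?; exact: feval_range|by move=> ?; exact: feval_range| |].
- move=> t.
  have hw (u : {s : srt S & W s}) : {y : M (tag u) | forall j (E : tg j = u),
      pk u = Some j -> y = cast (P := fun u => M (tag u)) E (t j)}.
    apply: cid; rewrite /pk; case: pickP => [j0 /asboolP E0|_]; last by exists (elt M _).
    exists (cast (P := fun u => M (tag u)) E0 (t j0)) => j E [jj].
    by move: E; rewrite -jj => E; rewrite (Prop_irrelevance E E0).
  exists (fun s x => projT1 (hw (Tagged W x))); apply: evg => i.
  rewrite gE; apply/esym; apply: (projT2 (hw (tg i))).
  exact: projT2 (projT2 (hc i)).
- move=> w; exists (fun i => w _ (f i)); apply/esym/evg => i; rewrite gE.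
  have h u j (E : tg j = u) : cast (P := fun u => M (tag u)) E (w _ (f j)) =
      w _ (tagged u) by case: _ / E.
  exact: (h (tg i)).
Qed.

Lemma formula_inf W V (psi : formula R (ctx_cat V W)) :
  exists theta : formula R V, forall M (e : env M V),
    feval theta e = infT (fun w : env M W => feval psi (env_cat e w)).
Proof.
have [theta htheta] := formula_sup (fneg psi).
exists (fneg theta) => M e; rewrite feval_neg htheta /infT.
by congr (1 - supT _); apply/funext => w; rewrite feval_neg.
Qed.
End QuantifierClosure.
Arguments env_elt {R S} M V s v.

Section Definable.
Variables (R : realType) (S : symbols) (M : interp R S) (G : ctx S) (c : env M G).
Implicit Types V W : ctx S.

Definition Def V (P : env M V -> R) := forall eps : R, 0 < eps ->
  exists phi : formula R (ctx_cat V G),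
    forall e, `|P e - feval phi (env_cat e c)| <= eps.

(** The maps of environments that come from a renaming of variables. The [subst_] lemmas allow
    definability to be checked on functions of environments, without writing down renamed
    formulas. *)
Definition is_subst V V' (r : env M V -> env M V') :=
  exists f : ctx_map V' V, forall e, r e = fun s v => e s (f s v).

Definition efst V W (e : env M (ctx_cat V W)) : env M V := fun s v => e s (inl v).
Definition esnd V W (e : env M (ctx_cat V W)) : env M W := fun s v => e s (inr v).

Definition Def2 V W (P : env M V -> env M W -> R) :=
  Def (fun e : env M (ctx_cat V W) => P (efst e) (esnd e)).

Lemma env_catK V W (e : env M (ctx_cat V W)) : env_cat (efst e) (esnd e) = e.
Proof.
apply: functional_extensionality_dep => s.
by apply: functional_extensionality_dep => -[].
Qed.

Lemma Def_unit V (P : env M V -> R) : Def P -> unitf P.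
Proof.
move=> dP e; apply/andP; split; apply/ler_addgt0Pr => d d0;
  have [phi h] := dP d d0; have := h e; have := feval_range phi (env_cat e c);
  by rewrite ler_norml; lra.
Qed.

Lemma Def2_unit V W (P : env M V -> env M W -> R) e : Def2 P -> unitf (P e).
Proof. by move=> /Def_unit h w; exact: (h (env_cat e w)). Qed.

Lemma Def2_unitl V W (P : env M V -> env M W -> R) w : Def2 P -> unitf (P^~ w).
Proof. by move=> /Def_unit h e; exact: (h (env_cat e w)). Qed.

Lemma Def_ext V (P Q : env M V -> R) : P =1 Q -> Def P -> Def Q.
Proof. by move=> /funext ->. Qed.

Lemma Def_lim V (P : env M V -> R) :
  (forall eps, 0 < eps -> exists2 Q, Def Q & forall e, `|P e - Q e| <= eps) -> Def P.
Proof.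
move=> h eps eps0; have e20 : 0 < eps / 2 by lra.
have [Q dQ hQ] := h _ e20; have [phi hphi] := dQ _ e20; exists phi => e.
have := ler_distD (Q e) (P e) (feval phi (env_cat e c)).
have := hQ e; have := hphi e; lra.
Qed.

Lemma Def_formula V (phi : formula R (ctx_cat V G)) :
  Def (fun e => feval phi (env_cat e c)).
Proof. by move=> eps eps0; exists phi => e; rewrite subrr normr0 ltW. Qed.

Lemma Def_feval V (phi : formula R V) : Def (feval (M := M) phi).
Proof.
apply: Def_ext (Def_formula (fren (fun s v => inl v) phi)) => e.
by rewrite feval_ren.
Qed.

Lemma Def_subst V V' (r : env M V -> env M V') (P : env M V' -> R) :
  is_subst r -> Def P -> Def (fun e => P (r e)).
Proof.
move=> [f fE] dP eps eps0; have [phi h] := dP eps eps0.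
exists (fren (cat_map f (fun s => id)) phi) => e.
by rewrite feval_ren env_cat_map -fE; exact: h.
Qed.

Lemma subst_id V : is_subst (fun e : env M V => e).
Proof. by exists (fun s => id). Qed.

Lemma subst_comp V V' V'' (r : env M V -> env M V') (r' : env M V' -> env M V'') :
  is_subst r' -> is_subst r -> is_subst (fun e => r' (r e)).
Proof.
by move=> [f' E'] [f E]; exists (fun s v => f s (f' s v)) => e; rewrite E' E.
Qed.

Lemma subst_fst V W V0 (r : env M V0 -> env M (ctx_cat V W)) :
  is_subst r -> is_subst (fun e => efst (r e)).
Proof. by move=> [f E]; exists (fun s v => f s (inl v)) => e; rewrite E. Qed.

Lemma subst_snd V W V0 (r : env M V0 -> env M (ctx_cat V W)) :
  is_subst r -> is_subst (fun e => esnd (r e)).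
Proof. by move=> [f E]; exists (fun s v => f s (inr v)) => e; rewrite E. Qed.

Lemma subst_ren V W V0 (f : ctx_map W V) (r : env M V0 -> env M V) :
  is_subst r -> is_subst (fun e => (fun s v => r e s (f s v)) : env M W).
Proof. by move=> [g E]; exists (fun s v => g s (f s v)) => e; rewrite E. Qed.

Lemma subst_cat V W V0 (r : env M V0 -> env M V) (r' : env M V0 -> env M W) :
  is_subst r -> is_subst r' -> is_subst (fun e => env_cat (r e) (r' e)).
Proof.
move=> [f E] [f' E']; exists (fun s v => match v with inl v => f s v | inr v => f' s v end).
move=> e; rewrite E E'; apply: functional_extensionality_dep => s.
by apply: functional_extensionality_dep => -[].
Qed.

Lemma Def2_subst V W V0 (P : env M V -> env M W -> R)
    (r : env M V0 -> env M V) (r' : env M V0 -> env M W) :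
  Def2 P -> is_subst r -> is_subst r' -> Def (fun e => P (r e) (r' e)).
Proof. by move=> dP hr hr'; exact: (Def_subst (subst_cat hr hr') dP). Qed.

Lemma Def_conn V k (u : connective R k) (f : 'I_k -> env M V -> R) :
  (forall i, Def (f i)) -> Def (fun e => u (\row_i f i e)).
Proof.
move=> df eps eps0; have [d d0 hd] := connective_unif u eps0.
have /choice[phi hphi] : forall i, exists phi : formula R (ctx_cat V G),
  forall e, `|f i e - feval phi (env_cat e c)| <= d by move=> i; exact: df.
exists (Conn u phi) => e /=; apply: hd => i; rewrite !mxE ?feval_range//.
exact: (Def_unit (df i)).
Qed.

Lemma Def_lip V k (h : ('I_k -> R) -> R) C (f : 'I_k -> env M V -> R) :
  (forall v w e, 0 <= e -> (forall i, `|v i - w i| <= e) -> `|h v - h w| <= C * e) ->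
  (forall i, Def (f i)) -> Def (fun e => clamp (h (fun i => f i e))).
Proof.
move=> hC df; apply: Def_ext (Def_conn (lip_connective hC) df) => e.
by congr (clamp (h _)); apply/funext => i; rewrite mxE.
Qed.

Lemma Def_op2 V h C (f g : env M V -> R) : lip2 h C -> Def f -> Def g ->
  Def (fun e => clamp (h (f e) (g e))).
Proof.
move=> hC df dg.
apply: Def_ext (@Def_lip V 2 _ _ (fun i => if i == ord0 then f else g) (lip2_lip hC) _).
  by [].
by move=> i; case: ifP.
Qed.

Lemma Def_cst V r : 0 <= r <= 1 -> Def (fun _ : env M V => r).
Proof.
move=> r01; apply: Def_ext (Def_formula (fcst (ctx_cat V G) r)) => e.
by rewrite feval_cst.
Qed.

Lemma Def_lin V a b d (f g : env M V -> R) : Def f -> Def g ->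
  Def (fun e => clamp (a * f e + b * g e + d)).
Proof. by move=> df dg; exact: (Def_op2 (lip2_linear a b d) df dg). Qed.

Lemma Def_aff V a d (f : env M V -> R) : Def f -> Def (fun e => clamp (a * f e + d)).
Proof.
move=> df; apply: Def_ext (Def_lin a 0 d df df) => e.
by rewrite mul0r addr0.
Qed.

Lemma Def_neg V (f : env M V -> R) : Def f -> Def (fun e => 1 - f e).
Proof.
move=> df; apply: Def_ext (Def_aff (-1) 1 df) => e.
by rewrite clamp_id; have := Def_unit df e; lra.
Qed.

Lemma Def_absd V (f g : env M V -> R) : Def f -> Def g -> Def (fun e => `|f e - g e|).
Proof.
move=> df dg; apply: Def_ext (Def_op2 (@lip2_absd R) df dg) => e.
by rewrite clamp_unit_absd//; [exact: Def_unit df e|exact: Def_unit dg e].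
Qed.

Lemma Def_max V (f g : env M V -> R) : Def f -> Def g -> Def (fun e => Num.max (f e) (g e)).
Proof.
move=> df dg; apply: Def_ext (Def_op2 (@lip2_max R) df dg) => e.
have /andP[f0 f1] := Def_unit df e; have /andP[g0 g1] := Def_unit dg e.
by rewrite clamp_id// le_max f0 ge_max f1 g1.
Qed.

Lemma Def_min V (f g : env M V -> R) : Def f -> Def g -> Def (fun e => Num.min (f e) (g e)).
Proof.
move=> df dg; apply: Def_ext (Def_neg (Def_max (Def_neg df) (Def_neg dg))) => e.
have [h|h] := leP (f e) (g e); have [h'|h'] := leP (1 - f e) (1 - g e); lra.
Qed.

Lemma Def_bigmax V I (r : seq I) (F : I -> env M V -> R) : (forall i, Def (F i)) ->
  Def (fun e => \big[Num.max/0]_(i <- r) F i e).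
Proof.
move=> dF; elim: r => [|i r IH].
  apply: (@Def_ext _ (fun=> 0)); first by move=> e; rewrite big_nil.
  by apply: Def_cst; rewrite lexx ler01.
by apply: Def_ext (Def_max (dF i) IH) => e; rewrite big_cons.
Qed.

Lemma Def_bigmin V I (r : seq I) (F : I -> env M V -> R) : (forall i, Def (F i)) ->
  Def (fun e => \big[Num.min/1]_(i <- r) F i e).
Proof.
move=> dF; elim: r => [|i r IH].
  apply: (@Def_ext _ (fun=> 1)); first by move=> e; rewrite big_nil.
  by apply: Def_cst; rewrite lexx ler01.
by apply: Def_ext (Def_min (dF i) IH) => e; rewrite big_cons.
Qed.

Lemma Def_sup V W (P : env M V -> env M W -> R) : Def2 P -> Def (fun e => supT (P e)).
Proof.
move=> dP eps eps0; have [phi h] := dP eps eps0.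
have [theta ht] := formula_sup
  (fren (fun s v => match v with inl (inl x) => inl (inl x) | inl (inr w) => inr w
                    | inr g => inl (inr g) end : ctx_cat (ctx_cat V G) W s) phi).
exists theta => e; rewrite ht; apply: supT_dist; first exact: env_elt.
- exact: Def2_unit.
- by move=> w; exact: feval_range.
- move=> w; rewrite feval_ren.
  have := h (env_cat e w); rewrite /efst /esnd /=; congr (`| _ - feval phi _| <= _).
  apply: functional_extensionality_dep => s.
  by apply: functional_extensionality_dep => -[[]|].
Qed.

Lemma Def_inf V W (P : env M V -> env M W -> R) : Def2 P -> Def (fun e => infT (P e)).
Proof. by move=> dP; apply: Def_neg; apply: Def_sup; exact: Def_neg. Qed.

(* V may have no variables of the sorts of w to be substituted for w. *)
Lemma Def_drop V W (P : env M V -> R) :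
  Def2 (fun e (w : env M W) => P e) -> Def P.
Proof.
move=> dP; apply: Def_ext (Def_sup dP) => e.
have uP : unitf (fun w : env M W => P e) by exact: (Def2_unit e dP).
apply/eqP; rewrite eq_le; apply/andP; split; first by apply: supT_le => //; exact: env_elt.
exact: (@supT_ge _ _ (fun=> P e) (env_elt M W) uP).
Qed.
End Definable.

(** * Uniform continuity and completions *)

Section UniformContinuity.
Variables (R : realType) (S : symbols).

Lemma fin_pos_lb (I : finType) (d : I -> R) : (forall i, 0 < d i) ->
  exists2 e, 0 < e & forall i, e <= d i.
Proof.
move=> d0; exists (\big[Num.min/1]_i d i).
  by elim/big_rec: _ => [|i x _ x0]; rewrite ?ltr01// lt_min d0.
by move=> i; rewrite (bigD1 i)//= ge_min lexx.
Qed.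

(** Stated for interpretations, because it is also needed for [eq_struct], which is not given with
    moduli of continuity. *)
Definition unif_cont (M : interp R S) :=
  (forall (f : Defs.fsym S) eps, 0 < eps -> exists2 d : R, 0 < d &
    forall a b : forall i, M (fdom f i), (forall i, mdist (a i) (b i) < d) ->
    mdist (fint M f a) (fint M f b) <= eps) /\
  (forall (r : rsym S) eps, 0 < eps -> exists2 d : R, 0 < d &
    forall a b : forall i, M (rdom r i), (forall i, mdist (a i) (b i) < d) ->
    `|rint M r a - rint M r b| <= eps).

Variables (M : interp R S) (ucM : unif_cont M).

Implicit Types eps : R.
Lemma teval_uc (V : ctx S) s (t : term V s) eps : 0 < eps ->
  exists2 d : R, 0 < d & forall e e' : env M V,
    (forall s v, mdist (e s v) (e' s v) < d) -> mdist (teval e t) (teval e' t) <= eps.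
Proof.
elim: t eps => [{}s v|f ts IH] eps eps0 /=.
  by exists eps => // e e' h; exact: ltW.
have [d d0 hd] := ucM.1 f _ eps0; have d20 : 0 < d / 2 by lra.
have /choice[dt hdt] : forall i, exists dt, 0 < dt /\ forall e e' : env M V,
    (forall s v, mdist (e s v) (e' s v) < dt) ->
    mdist (teval e (ts i)) (teval e' (ts i)) <= d / 2.
  by move=> i; have [dt ? ?] := IH i _ d20; exists dt.
have [m m0 hm] := fin_pos_lb (fun i => (hdt i).1).
exists m => // e e' h; apply: hd => i; apply: le_lt_trans ((hdt i).2 _ _ _) _.
  by move=> s' v; exact: lt_le_trans (h s' v) (hm i).
lra.
Qed.

Lemma terms_uc (V : ctx S) (I : finType) (sg : I -> srt S)
    (ts : forall i, term V (sg i)) eps : 0 < eps ->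
  exists2 d : R, 0 < d & forall e e' : env M V,
    (forall s v, mdist (e s v) (e' s v) < d) ->
    forall i, mdist (teval e (ts i)) (teval e' (ts i)) <= eps.
Proof.
move=> eps0; have /choice[dt hdt] : forall i, exists dt, 0 < dt /\ forall e e' : env M V,
    (forall s v, mdist (e s v) (e' s v) < dt) ->
    mdist (teval e (ts i)) (teval e' (ts i)) <= eps.
  by move=> i; have [dt ? ?] := teval_uc (ts i) eps0; exists dt.
have [m m0 hm] := fin_pos_lb (fun i => (hdt i).1).
exists m => // e e' h i; apply: (hdt i).2 => s v.
exact: lt_le_trans (h s v) (hm i).
Qed.

Lemma mdist_dist (X : metricType R) (x y x' y' : X) :
  `|mdist x y - mdist x' y'| <= mdist x x' + mdist y y'.
Proof.
have h1 := metric_triangle x x' y; have h2 := metric_triangle x' y' y.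
have h3 := metric_triangle x' x y'; have h4 := metric_triangle x y y'.
rewrite (metric_sym x' x) in h3; rewrite (metric_sym y' y) in h2.
rewrite ler_norml; lra.
Qed.

Lemma env_ext_near (V : ctx S) (e e' : env M V) s (a a' : M s) d :
  mdist a a' < d ->
  (forall s v, mdist (e s v) (e' s v) < d) ->
  forall s' v, mdist (env_ext e a v) (env_ext e' a' (v : ctx_ext V s s')) < d.
Proof. by move=> ha h s' [s1 v|] /=. Qed.

Lemma feval_uc (V : ctx S) (phi : formula R V) eps : 0 < eps ->
  exists2 d : R, 0 < d & forall e e' : env M V,
    (forall s v, mdist (e s v) (e' s v) < d) -> `|feval phi e - feval phi e'| <= eps.
Proof.
elim: phi eps => {V} [V s t u|V r ts|V k c phis IH|V s psi IH|V s psi IH] eps eps0 /=.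
- have e20 : 0 < eps / 2 by lra.
  have [d1 d10 h1] := teval_uc t e20; have [d2 d20 h2] := teval_uc u e20.
  exists (Num.min d1 d2); first by rewrite lt_min d10.
  move=> e e' h; apply: le_trans (mdist_dist _ _ _ _) _.
  have -> : eps = eps / 2 + eps / 2 by lra.
  by apply: lerD; [apply: h1|apply: h2] => s' v; have := h s' v; rewrite lt_min => /andP[].
- have [d d0 hd] := ucM.2 r _ eps0; have d20 : 0 < d / 2 by lra.
  have [m m0 hm] := terms_uc ts d20; exists m => // e e' h.
  by apply: hd => i; apply: le_lt_trans (hm _ _ h i) _; lra.
- have [d d0 hd] := connective_unif c eps0.
  have /choice[dt hdt] : forall i, exists dt, 0 < dt /\ forall e e' : env M V,
      (forall s v, mdist (e s v) (e' s v) < dt) ->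
      `|feval (phis i) e - feval (phis i) e'| <= d.
    by move=> i; have [dt ? ?] := IH i _ d0; exists dt.
  have [m m0 hm] := fin_pos_lb (fun i => (hdt i).1).
  exists m => // e e' h; apply: hd => i; rewrite !mxE ?feval_range//.
  by apply: (hdt i).2 => s v; exact: lt_le_trans (h s v) (hm i).
- have [d d0 hd] := IH _ eps0; exists d => // e e' h.
  apply: (@supT_dist _ _ _ _ (elt M s)); try by move=> a; exact: feval_range.
  by move=> a; apply: hd; apply: env_ext_near => //; rewrite mdistxx.
- have [d d0 hd] := IH _ eps0; exists d => // e e' h.
  rewrite -/(env _ _) !infTE; try by [exact: (elt M s)|move=> a; exact: feval_range].
  apply: (infT_dist (elt M s)); try by move=> a; exact: feval_range.
  by move=> a; apply: hd; apply: env_ext_near => //; rewrite mdistxx.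
Qed.
End UniformContinuity.

(* A bounded pseudo-metric space is completed through its Kuratowski embedding
   x |-> d(-, x) into the bounded functions. *)
Record pmetric (R : realType) := PMetric {
  pcar :> Type;
  pdist : pcar -> pcar -> R;
  pelt : pcar;
  pdist_range : forall x y, 0 <= pdist x y <= 1;
  pdistxx : forall x, pdist x x = 0;
  pdistC : forall x y, pdist x y = pdist y x;
  pdist_tri : forall x y z, pdist x z <= pdist x y + pdist y z }.
Arguments pelt {R} p.

Definition kcompl (R : realType) (P : pmetric R) : Type :=
  {z : P -> R | forall eps : R, 0 < eps -> exists p, forall x, `|z x - pdist x p| <= eps}.

HB.instance Definition _ R P := gen_eqMixin (@kcompl R P).
HB.instance Definition _ R P := gen_choiceMixin (@kcompl R P).

Section KuratowskiCompletion.
Variables (R : realType) (P : pmetric R).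
Implicit Types z w : kcompl P.

Definition kdist z w : R := supT (fun x => `|sval z x - sval w x|).

Lemma kcompl_range z x : 0 <= sval z x <= 1.
Proof.
apply/andP; split; apply/ler_addgt0Pr => e e0; have [p /(_ x)] := svalP z e e0;
  have := pdist_range x p; rewrite ler_norml; lra.
Qed.

Lemma kdist_unitf z w : unitf (fun x => `|sval z x - sval w x|).
Proof.
move=> x; have := kcompl_range z x; have := kcompl_range w x.
by rewrite normr_ge0 ler_norml => /andP[? ?] /andP[? ?]; apply/andP; split; lra.
Qed.

Lemma kdist_ge z w x : `|sval z x - sval w x| <= kdist z w.
Proof. exact: (@supT_ge _ _ (fun x => `|sval z x - sval w x|) x (kdist_unitf z w)). Qed.

Lemma kdist_le z w r : (forall x, `|sval z x - sval w x| <= r) -> kdist z w <= r.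
Proof. by move=> h; apply: supT_le => //; exact: (pelt P). Qed.

Lemma kdistxx z : kdist z z = 0.
Proof.
apply/eqP; rewrite eq_le; apply/andP; split.
  by apply: kdist_le => x; rewrite subrr normr0.
exact: le_trans (normr_ge0 _) (kdist_ge z z (pelt P)).
Qed.

Lemma kdist_eq0 z w : kdist z w = 0 -> z = w.
Proof.
move=> h; have zw : sval z = sval w.
  apply/funext => a; apply/eqP; rewrite -subr_eq0 -normr_le0.
  by apply: le_trans (kdist_ge z w a) _; rewrite h.
case: z w zw {h} => [z hz] [w hw] /= zw; case: _ / zw hw => hw.
by congr exist; exact: Prop_irrelevance.
Qed.

Lemma kdistC z w : kdist z w = kdist w z.
Proof. by rewrite /kdist; congr supT; apply/funext => a; rewrite distrC. Qed.

Lemma kdist_tri w z v : kdist z v <= kdist z w + kdist w v.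
Proof.
apply: kdist_le => a; apply: le_trans (ler_distD (sval w a) _ _) _.
by apply: lerD; exact: kdist_ge.
Qed.

HB.instance Definition _ := isMetric.Build R (kcompl P) kdistxx kdist_eq0 kdistC kdist_tri.

Lemma kmdistE z w : mdist z w = kdist z w. Proof. by []. Qed.

Lemma kdist_le1 z w : mdist z w <= 1.
Proof. by apply: kdist_le => x; case/andP: (kdist_unitf z w x). Qed.

Definition kin (p : P) : kcompl P :=
  exist _ (fun x => pdist x p) (fun eps eps0 => ex_intro _ p (fun x =>
    eq_ind_r (fun r => r <= eps) (ltW eps0) (eq_trans (f_equal _ (subrr _)) (normr0 _)))).

Lemma kin_dist p q : mdist (kin p) (kin q) = pdist p q.
Proof.
apply/eqP; rewrite eq_le; apply/andP; split.
  apply: kdist_le => x /=; have := pdist_tri x p q; have := pdist_tri x q p.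
  by rewrite (pdistC q p) ler_norml; lra.
have := kdist_ge (kin p) (kin q) p; rewrite /= pdistxx sub0r normrN ger0_norm//.
by case/andP: (pdist_range p q).
Qed.

Lemma kin_dense z eps : 0 < eps -> exists p, mdist z (kin p) < eps.
Proof.
move=> eps0; have e20 : 0 < eps / 2 by lra.
have [p hp] := svalP z _ e20; exists p; apply: (@le_lt_trans _ _ (eps / 2)); last lra.
exact: kdist_le.
Qed.

(** The limit is the pointwise limit along an ultrafilter finer than [F]; the Cauchy property makes
    the convergence uniform. *)
Lemma kcomplete (F : set_system (kcompl P)) : ProperFilter F -> cauchy F ->
  exists z : kcompl P, F --> z.
Proof.
move=> PF /cauchyP cF; have [U [UU sU]] := ultraFilterLemma PF.
pose l x := ulim U (fun z : kcompl P => sval z x).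
have ul x : unitf (fun z : kcompl P => sval z x) by move=> z; exact: kcompl_range.
have near_l (w : kcompl P) e : F (ball w e) -> forall x, `|l x - sval w x| <= e.
  move=> Fw x; rewrite -(@ulim_cst _ _ U (sval w x)) ?kcompl_range//.
  apply: ulim_dist => //; first by move=> z; exact: kcompl_range.
  apply: filterS (sU _ Fw) => z; rewrite ballEmdist /= => h.
  by rewrite distrC; apply: le_trans (kdist_ge _ _ _) (ltW h).
have hl eps : 0 < eps -> exists p, forall x, `|l x - pdist x p| <= eps.
  move=> eps0; have e20 : 0 < eps / 2 by lra.
  have [w /near_l hw] := cF _ e20; have [p hp] := svalP w _ e20; exists p => x.
  by have := ler_distD (sval w x) (l x) (pdist x p); have := hw x; have := hp x; lra.
exists (exist _ l hl : kcompl P); apply/metricType_numDomainType.fcvgrPdist_lt => e e0.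
have e40 : 0 < e / 4 by lra.
have [w Fw] := cF _ e40; apply: filterS (Fw) => z; rewrite ballEmdist /= => h.
apply: (@le_lt_trans _ _ (e / 2)); last lra.
apply: kdist_le => x /=; have := near_l _ _ Fw x; have := kdist_ge w z x.
have := ler_distD (sval w x) (l x) (sval z x); move: h; rewrite kmdistE; lra.
Qed.
End KuratowskiCompletion.

(** Extension by uniform continuity at one point: [nr d] stands for its approximations within [d],
    and [h] for the map to be extended from them. *)
Lemma cauchy_extension (R : realType) (X : metricType R) (Q : Type) (nr : R -> set Q)
    (h : Q -> X) :
  (forall F : set_system X, ProperFilter F -> cauchy F -> exists x : X, F --> x) ->
  (forall d, 0 < d -> nr d !=set0) -> (forall d d', d <= d' -> nr d `<=` nr d') ->
  (forall eps, 0 < eps -> exists2 d : R, 0 < d &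
    forall p q, nr d p -> nr d q -> mdist (h p) (h q) <= eps) ->
  exists w : X, forall eps, 0 < eps -> exists2 d : R, 0 < d & forall p, nr d p -> mdist w (h p) <= eps.
Proof.
move=> cX n0 nS hC; pose B d := [set h p | p in nr d].
have FF : Filter (filter_from [set d : R | 0 < d] B).
  apply: filter_from_filter; first by exists 1 => /=.
  move=> d d' /= d0 d'0; exists (Num.min d d'); first by rewrite /= lt_min d0.
  by move=> _ [p np <-]; split; exists p => //; apply: nS np; rewrite ge_min lexx ?orbT.
have PF : ProperFilter (filter_from [set d : R | 0 < d] B).
  by apply: filter_from_proper => d /n0 [p np]; exists (h p), p.
have [w Fw] : exists w : X, filter_from [set d : R | 0 < d] B --> w.
  apply: cX; apply/cauchyP => eps eps0; have e20 : 0 < eps / 2 by lra.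
  have [d d0 hd] := hC _ e20; have [p np] := n0 _ d0; exists (h p), d => //.
  by move=> _ [q nq <-]; rewrite ballEmdist /=; have := hd _ _ np nq; lra.
exists w => eps eps0; have e20 : 0 < eps / 2 by lra.
have [d d0 hd] := hC _ e20; exists d => // p np.
have /metricType_numDomainType.fcvgrPdist_lt /(_ _ e20) [d' /= d'0 hd'] := Fw.
have m0 : 0 < Num.min d d' by rewrite lt_min d0.
have [q nq] := n0 _ m0.
have h1 : mdist w (h q) < eps / 2.
  by apply: hd'; exists q => //; apply: nS nq; rewrite ge_min lexx orbT.
have h2 : mdist (h q) (h p) <= eps / 2.
  by apply: hd => //; apply: nS nq; rewrite ge_min lexx.
have := metric_triangle w (h q) (h p); lra.
Qed.

(** * Ultrapowers *)

Lemma structure_uc (R : realType) (L : signature R) (N : structure L) : unif_cont N.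
Proof.
split=> [f|r] eps eps0.
  exists (fmod f eps); first exact: fmod_gt0.
  by move=> a b; exact: fint_mod.
exists (rmod r eps); first exact: rmod_gt0.
by move=> a b; exact: rint_mod.
Qed.

Section Ultrapower.
Variables (R : realType) (L : signature R) (N : structure L).
Variables (I : Type) (U : set_system I) (UU : UltraFilter U).

Section Carrier.
Variable s : srt L.
Implicit Types x y z : I -> N s.

Definition up_dist x y : R := ulim U (fun i => mdist (x i) (y i)).

Lemma mdist_unitf x y : unitf (fun i => mdist (x i) (y i)).
Proof. by move=> i; rewrite mdist_ge0 mdist_le1. Qed.

Lemma up_dist_range x y : 0 <= up_dist x y <= 1.
Proof. exact: ulim_range (mdist_unitf x y). Qed.

Lemma up_distxx x : up_dist x x = 0.
Proof.
apply: ulim_eq; first exact: mdist_unitf.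
by move=> e e0; apply: filterE => i /=; rewrite mdistxx subrr normr0 ltW.
Qed.

Lemma up_distC x y : up_dist x y = up_dist y x.
Proof. by apply: eq_ulim => i; rewrite metric_sym. Qed.

Lemma up_dist_tri x y z : up_dist x z <= up_dist x y + up_dist y z.
Proof.
apply/ler_addgt0Pr => e e0; have e30 : 0 < e / 3 by lra.
have [i [/= h1 [h2 h3]]] := filter_ex (filterI (ulim_near UU (mdist_unitf x z) e30)
  (filterI (ulim_near UU (mdist_unitf x y) e30) (ulim_near UU (mdist_unitf y z) e30))).
move: h1 h2 h3; rewrite -!/(up_dist _ _) !ltr_norml.
have := metric_triangle (x i) (y i) (z i); lra.
Qed.

Definition up_pmetric : pmetric R :=
  @PMetric R (I -> N s) up_dist (fun=> elt N s) up_dist_range up_distxx up_distC up_dist_tri.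
End Carrier.

(** With the completion built in, the carrier is complete for every [U]. In return, symbols must be
    extended from sequences to limits, and an element is only approximated by sequences. *)
Definition up_car s : metricType R := kcompl (up_pmetric s).

Definition up_in s (x : I -> N s) : up_car s := @kin R (up_pmetric s) x.

Lemma up_in_dist s (x y : I -> N s) :
  mdist (up_in x) (up_in y) = ulim U (fun i => mdist (x i) (y i)).
Proof. exact: (@kin_dist R (up_pmetric s) x y). Qed.

Lemma up_in_dense s (z : up_car s) eps : 0 < eps -> exists x : I -> N s, mdist z (up_in x) < eps.
Proof. exact: (@kin_dense R (up_pmetric s)). Qed.

Section Symbols.
Variables (J : finType) (sg : J -> srt L).
Implicit Types (z : forall j, up_car (sg j)) (x y : forall j, I -> N (sg j)).

Definition up_near z (d : R) : set (forall j, I -> N (sg j)) :=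
  [set x | forall j, mdist (z j) (up_in (x j)) < d].

Lemma up_near_ex z d : 0 < d -> up_near z d !=set0.
Proof.
move=> d0; exists (fun j => projT1 (cid (up_in_dense (z j) d0))) => j.
exact: (projT2 (cid (up_in_dense (z j) d0))).
Qed.

Lemma up_near_le z d d' : d <= d' -> up_near z d `<=` up_near z d'.
Proof. by move=> dd' x h j; exact: lt_le_trans (h j) dd'. Qed.

Lemma up_near_dist z d x y : up_near z (d / 2) x -> up_near z (d / 2) y ->
  U [set i | forall j, mdist (x j i) (y j i) < d].
Proof.
move=> hx hy; apply: filter_forall => j; apply: ulim_lt; first exact: mdist_unitf.
rewrite -up_in_dist; have := metric_triangle (up_in (x j)) (z j) (up_in (y j)).
by have := hx j; have := hy j; rewrite (metric_sym (up_in (x j)) (z j)); lra.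
Qed.

(** The slack [m - mdist (z j) (z' j)] is divided between the two approximations, so that the bound
    [m] survives exactly. Hence the ultrapower obeys the moduli of the signature themselves. *)
Lemma up_near_pair z z' m d : 0 < d -> (forall j, mdist (z j) (z' j) < m) ->
  exists x y, [/\ up_near z d x, up_near z' d y &
    U [set i | forall j, mdist (x j i) (y j i) < m]].
Proof.
move=> d0 h; pose gap j := (m - mdist (z j) (z' j)) / 2.
have g0 j : 0 < Num.min d (gap j) by rewrite lt_min d0 /gap; have := h j; lra.
pose x j := projT1 (cid (up_in_dense (z j) (g0 j))).
pose y j := projT1 (cid (up_in_dense (z' j) (g0 j))).
have hx j : mdist (z j) (up_in (x j)) < Num.min d (gap j).
  exact: (projT2 (cid (up_in_dense (z j) (g0 j)))).
have hy j : mdist (z' j) (up_in (y j)) < Num.min d (gap j).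
  exact: (projT2 (cid (up_in_dense (z' j) (g0 j)))).
exists x, y; split=> [j|j|].
- by have := hx j; rewrite lt_min => /andP[].
- by have := hy j; rewrite lt_min => /andP[].
apply: filter_forall => j; apply: ulim_lt; first exact: mdist_unitf.
have lt_gap (D a b e f : R) :
  D <= a + b -> b <= e + f -> a < (m - e) / 2 -> f < (m - e) / 2 -> D < m by lra.
rewrite -up_in_dist; have t1 := metric_triangle (up_in (x j)) (z j) (up_in (y j)).
have t2 := metric_triangle (z j) (z' j) (up_in (y j)).
have gx : mdist (z j) (up_in (x j)) < gap j by have := hx j; rewrite lt_min => /andP[].
have gy : mdist (z' j) (up_in (y j)) < gap j by have := hy j; rewrite lt_min => /andP[].
by rewrite (metric_sym (up_in (x j)) (z j)) in t1; exact: lt_gap t1 t2 gx gy.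
Qed.
End Symbols.

Definition up_fun (f : Defs.fsym L) (x : forall j, I -> N (fdom f j)) : I -> N (fcod f) :=
  fun i => fint N f (fun j => x j i).

Lemma up_fint_ex (f : Defs.fsym L) (z : forall j, up_car (fdom f j)) :
  exists w : up_car (fcod f), forall eps, 0 < eps -> exists2 d, 0 < d &
    forall x, up_near z d x -> mdist w (up_in (up_fun x)) <= eps.
Proof.
apply: (@cauchy_extension R (up_car (fcod f)) _ (up_near z) (fun x => up_in (up_fun x))).
- exact: kcomplete.
- exact: up_near_ex.
- exact: up_near_le.
move=> eps eps0; exists (fmod f eps / 2).
  by rewrite divr_gt0// fmod_gt0.
move=> x y hx hy; rewrite up_in_dist; apply: ulim_le_cst; first exact: mdist_unitf.
by apply: filterS (up_near_dist hx hy) => i; exact: fint_mod.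
Qed.

Definition up_fint f z := projT1 (cid (@up_fint_ex f z)).

Lemma up_rint_ex (r : rsym L) (z : forall j, up_car (rdom r j)) :
  exists w : R, 0 <= w <= 1 /\ forall eps, 0 < eps -> exists2 d, 0 < d &
    forall x, up_near z d x -> `|w - ulim U (fun i => rint N r (fun j => x j i))| <= eps.
Proof.
have ur (x : forall j, I -> N (rdom r j)) : unitf (fun i => rint N r (fun j => x j i)).
  by move=> i; exact: rint_range.
pose B (Q : set (forall j, I -> N (rdom r j))) := exists2 d : R, 0 < d & Q = up_near z d.
have B0 : exists Q, B Q by exists (up_near z 1), 1.
have BI P Q : B P -> B Q -> exists2 S, B S & S `<=` P `&` Q.
  move=> [d d0 ->] [d' d'0 ->]; exists (up_near z (Num.min d d')).
    by exists (Num.min d d'); rewrite ?lt_min ?d0.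
  by move=> x h; split; apply: up_near_le h; rewrite ge_min lexx ?orbT.
have Bne P : B P -> P !=set0 by move=> [d d0 ->]; exact: up_near_ex.
(* A limit along an ultrafilter of approximations replaces [cauchy_extension] here, since it also
   lies in [0,1]. *)
have [V UV VB] := ultra_of_base B0 BI Bne.
pose h x := ulim U (fun i => rint N r (fun j => x j i)).
have uh : unitf h by move=> x; exact: ulim_range.
exists (ulim V h); split=> [|eps eps0]; first exact: ulim_range.
exists (rmod r eps / 2); first by rewrite divr_gt0// rmod_gt0.
move=> x hx; rewrite -(@ulim_cst _ _ V (ulim U _) UV (uh x)); apply: ulim_dist => //.
  by move=> y; exact: uh.
have /VB : B (up_near z (rmod r eps / 2)).
  by exists (rmod r eps / 2); rewrite ?divr_gt0 ?rmod_gt0.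
apply: filterS => y hy; apply: ulim_dist => //.
by apply: filterS (up_near_dist hy hx) => i; exact: rint_mod.
Qed.

Definition up_rint r z := projT1 (cid (@up_rint_ex r z)).

Lemma up_rint_range r z : 0 <= @up_rint r z <= 1.
Proof. by have [] := projT2 (cid (@up_rint_ex r z)). Qed.

Definition up_interp : interp R L :=
  @Interp R L up_car (fun s => up_in (fun=> elt N s)) (fun s => @kdist_le1 R (up_pmetric s))
    up_fint up_rint up_rint_range.

Lemma up_fint_mod (f : Defs.fsym L) eps (a b : forall i, up_interp (fdom f i)) : 0 < eps ->
  (forall i, mdist (a i) (b i) < fmod f eps) ->
  mdist (fint up_interp f a) (fint up_interp f b) <= eps.
Proof.
move=> eps0 h; apply/ler_addgt0Pr => e e0; have e20 : 0 < e / 2 by lra.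
have [d1 d10 h1] := projT2 (cid (@up_fint_ex f a)) _ e20.
have [d2 d20 h2] := projT2 (cid (@up_fint_ex f b)) _ e20.
have d0 : 0 < Num.min d1 d2 by rewrite lt_min d10.
have [x [y [hx hy hxy]]] := up_near_pair d0 h.
have h3 : mdist (up_in (up_fun x)) (up_in (up_fun y)) <= eps.
  rewrite up_in_dist; apply: ulim_le_cst; first exact: mdist_unitf.
  by apply: filterS hxy => i; exact: fint_mod.
have {}hx : up_near a d1 x by apply: up_near_le hx; rewrite ge_min lexx.
have {}hy : up_near b d2 y by apply: up_near_le hy; rewrite ge_min lexx orbT.
have := h1 _ hx; have := h2 _ hy; rewrite -!/(up_fint _) => h4 h5.
have := metric_triangle (up_fint a) (up_in (up_fun x)) (up_fint b).
have := metric_triangle (up_in (up_fun x)) (up_in (up_fun y)) (up_fint b).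
rewrite (metric_sym (up_in (up_fun y)) (up_fint b)) /=; lra.
Qed.

Lemma up_rint_mod (r : rsym L) eps (a b : forall i, up_interp (rdom r i)) : 0 < eps ->
  (forall i, mdist (a i) (b i) < rmod r eps) ->
  `|rint up_interp r a - rint up_interp r b| <= eps.
Proof.
move=> eps0 h; apply/ler_addgt0Pr => e e0; have e20 : 0 < e / 2 by lra.
have [d1 d10 h1] := (projT2 (cid (@up_rint_ex r a))).2 _ e20.
have [d2 d20 h2] := (projT2 (cid (@up_rint_ex r b))).2 _ e20.
have d0 : 0 < Num.min d1 d2 by rewrite lt_min d10.
have [x [y [hx hy hxy]]] := up_near_pair d0 h.
have h3 : `|ulim U (fun i => rint N r (fun j => x j i)) -
            ulim U (fun i => rint N r (fun j => y j i))| <= eps.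
  apply: ulim_dist; try by move=> i; exact: rint_range.
  by apply: filterS hxy => i; exact: rint_mod.
have {}hx : up_near a d1 x by apply: up_near_le hx; rewrite ge_min lexx.
have {}hy : up_near b d2 y by apply: up_near_le hy; rewrite ge_min lexx orbT.
have := h1 _ hx; have := h2 _ hy; rewrite -!/(up_rint _) => h4 h5.
move: h3 h4 h5; rewrite /= !ler_norml; lra.
Qed.

Definition ultrapower : structure L :=
  @Structure R L up_interp (fun s => @kcomplete R (up_pmetric s)) up_fint_mod up_rint_mod.

Lemma up_fint_in (f : Defs.fsym L) (x : forall j, I -> N (fdom f j)) :
  fint ultrapower f (fun j => up_in (x j)) = up_in (up_fun x).
Proof.
apply: mdist_positivity; apply/eqP; rewrite eq_le mdist_ge0 andbT.
apply/ler_addgt0Pr => e e0; rewrite add0r.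
have [d d0 hd] := projT2 (cid (@up_fint_ex f (fun j => up_in (x j)))) _ e0.
by apply: hd => j; rewrite mdistxx.
Qed.

Lemma up_rint_in (r : rsym L) (x : forall j, I -> N (rdom r j)) :
  rint ultrapower r (fun j => up_in (x j)) = ulim U (fun i => rint N r (fun j => x j i)).
Proof.
apply/eqP; rewrite -subr_eq0 -normr_le0; apply/ler_addgt0Pr => e e0; rewrite add0r.
have [d d0 hd] := (projT2 (cid (@up_rint_ex r (fun j => up_in (x j))))).2 _ e0.
by apply: hd => j; rewrite mdistxx.
Qed.

Definition up_env V (e : forall s, V s -> I -> N s) : env ultrapower V :=
  fun s v => up_in (e s v).
Definition at_env V (e : forall s, V s -> I -> N s) (i : I) : env N V := fun s v => e s v i.

Lemma up_teval V (e : forall s, V s -> I -> N s) s (t : term V s) :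
  teval (up_env e) t = up_in (fun i => teval (at_env e i) t).
Proof.
elim: t => //= f ts IH; rewrite -[RHS]up_fint_in; congr (fint ultrapower f _).
by apply: functional_extensionality_dep => j; exact: IH.
Qed.

Lemma up_env_ext V (e : forall s, V s -> I -> N s) s (x : I -> N s) :
  exists e' : forall s', ctx_ext V s s' -> I -> N s',
    (env_ext (up_env e) (up_in x) = up_env e') /\
    forall i, at_env e' i = env_ext (at_env e i) (x i).
Proof.
exists (fun s' v => match v in ctx_ext _ _ s' return (I -> N s) -> I -> N s' with
  | Old s1 v1 => fun=> e s1 v1 | New => id end x).
split=> [|i]; apply: functional_extensionality_dep => s';
  by apply: functional_extensionality_dep; case.
Qed.

Theorem Los V (psi : formula R V) (e : forall s, V s -> I -> N s) :
  feval psi (up_env e) = ulim U (fun i => feval psi (at_env e i)).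
Proof.
have uf V' (chi : formula R V') e' : unitf (fun i => feval chi (at_env e' i)).
  by move=> i; exact: feval_range.
have le1 (a b d r : R) : `|a - b| <= r -> b <= d -> a <= d + r.
  by rewrite ler_norml; lra.
have le2 (a b d r : R) : `|a - b| <= r -> d <= b -> d <= a + r.
  by rewrite ler_norml; lra.
elim: psi e => {V} [V s t u|V r ts|V k u phis IH|V s psi IH|V s psi IH] e.
- by rewrite /= !up_teval up_in_dist.
- have E : (fun j => teval (up_env e) (ts j)) =
      (fun j => up_in (fun i => teval (at_env e i) (ts j))).
    by apply: functional_extensionality_dep => j; exact: up_teval.
  exact: etrans (f_equal (fun a => rint ultrapower r a) E) (up_rint_in _).
- apply/esym/ulim_eq; first exact: uf.
  move=> eps eps0; have [d d0 hd] := connective_unif u eps0.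
  have : U [set i | forall j, `|feval (phis j) (at_env e i) - feval (phis j) (up_env e)| <= d].
    apply: filter_forall => j; rewrite IH.
    by apply: filterS (ulim_near UU (uf _ (phis j) e) d0) => i /ltW.
  by apply: filterS => i hi /=; apply: hd => j; rewrite !mxE ?feval_range.
- have us : unitf (feval (Sup s psi) (M := ultrapower)) by move=> e'; exact: feval_range.
  have ufa (M : interp R L) (e' : env M V) : unitf (fun a => feval psi (env_ext e' a)).
    by move=> a; exact: feval_range.
  apply/eqP; rewrite eq_le; apply/andP; split; last first.
    apply/ler_addgt0Pr => eps eps0; have e20 : 0 < eps / 2 by lra.
    have /choice[x hx] : forall i, exists a, feval (Sup s psi) (at_env e i) - eps / 2 <
        feval psi (env_ext (at_env e i) a).
      by move=> i; apply: supT_near => //; exact: elt.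
    have [e' [ee' ae']] := up_env_ext e x.
    have : feval psi (up_env e') <= feval (Sup s psi) (up_env e).
      rewrite -ee'.
      exact: (@supT_ge _ _ (fun a => feval psi (env_ext (up_env e) a)) _ (ufa _ _)).
    rewrite IH => h; apply: le_trans (ulim_le (e := eps / 2) _ (uf _ (Sup s psi) e) (uf _ psi e') _) _.
      by apply: filterE => i; have /= := hx i; rewrite ae'; lra.
    lra.
  (* The element [z] need not come from a sequence; a nearby sequence replaces it, at a cost
     controlled by the uniform continuity of [psi] in the ultrapower. *)
  apply: supT_le; first exact: (elt ultrapower s).
  move=> z; apply/ler_addgt0Pr => eps eps0.
  have [d d0 hd] := feval_uc (structure_uc ultrapower) psi eps0.
  have [x hx] := up_in_dense z d0; have [e' [ee' ae']] := up_env_ext e x.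
  have h1 : `|feval psi (env_ext (up_env e) z) - feval psi (up_env e')| <= eps.
    by rewrite -ee'; apply: hd; apply: env_ext_near => // s' v; rewrite mdistxx.
  have h2 : feval psi (up_env e') <= ulim U (fun i => feval (Sup s psi) (at_env e i)).
    rewrite IH -[leRHS]addr0; apply: ulim_le; [exact: uf|exact: (uf _ (Sup s psi))|].
    apply: filterE => i; rewrite /= addr0 ae'.
    exact: (@supT_ge _ _ (fun a => feval psi (env_ext (at_env e i) a)) _ (ufa _ _)).
  exact: le1 h1 h2.
- have ufa (M : interp R L) (e' : env M V) : unitf (fun a => feval psi (env_ext e' a)).
    by move=> a; exact: feval_range.
  have fI (M : interp R L) (e' : env M V) : feval (Inf s psi) e' =
      infT (fun a => feval psi (env_ext e' a)).
    by rewrite /= infTE//; exact: elt.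
  apply/eqP; rewrite eq_le; apply/andP; split.
    apply/ler_addgt0Pr => eps eps0.
    have /choice[x hx] : forall i, exists a,
        feval psi (env_ext (at_env e i) a) < feval (Inf s psi) (at_env e i) + eps.
      by move=> i; rewrite fI; apply: infT_near => //; exact: elt.
    have [e' [ee' ae']] := up_env_ext e x.
    have : feval (Inf s psi) (up_env e) <= feval psi (up_env e').
      rewrite fI -ee'.
      exact: (@infT_le _ _ (fun a => feval psi (env_ext (up_env e) a)) _ (ufa _ _)).
    move=> /le_trans; apply; rewrite IH; apply: ulim_le; [exact: uf|exact: (uf _ (Inf s psi))|].
    by apply: filterE => i; have /= := hx i; rewrite ae'; lra.
  rewrite fI; apply: infT_ge; first exact: (elt ultrapower s).
  move=> z; apply/ler_addgt0Pr => eps eps0.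
  have [d d0 hd] := feval_uc (structure_uc ultrapower) psi eps0.
  have [x hx] := up_in_dense z d0; have [e' [ee' ae']] := up_env_ext e x.
  have h1 : `|feval psi (env_ext (up_env e) z) - feval psi (up_env e')| <= eps.
    by rewrite -ee'; apply: hd; apply: env_ext_near => // s' v; rewrite mdistxx.
  have h2 : ulim U (fun i => feval (Inf s psi) (at_env e i)) <= feval psi (up_env e').
    rewrite IH -[leRHS]addr0; apply: ulim_le; [exact: (uf _ (Inf s psi))|exact: uf|].
    apply: filterE => i; rewrite /= addr0 -/(feval (Inf s psi) _) fI ae'.
    exact: (@infT_le _ _ (fun a => feval psi (env_ext (at_env e i) a)) _ (ufa _ _)).
  exact: le2 h1 h2.
Qed.

Lemma ultrapower_models T : models T N -> models T ultrapower.
Proof.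
move=> hN sigma Ts; rewrite -(hN sigma Ts).
have := Los sigma (fun s (v : ctx0 s) => match v with end).
have -> : up_env (fun s (v : ctx0 s) => match v with end) = @env0 R L ultrapower.
  by apply: functional_extensionality_dep => s; apply: functional_extensionality_dep; case.
move=> ->; have -> : (fun i => feval sigma (at_env (fun s (v : ctx0 s) => match v with end) i)) =
    fun=> feval sigma (@env0 R L N).
  apply/funext => i; congr (feval sigma _).
  by apply: functional_extensionality_dep => s; apply: functional_extensionality_dep; case.
by apply: ulim_cst; exact: feval_range.
Qed.
End Ultrapower.

(** * Types and ultrafilters *)

Section TypesAndUltrafilters.
Variables (R : realType) (L : signature R).

(** In the ultrapower by [U] itself, whose index set is the set of environments, the identity map
    represents a realization of [U]. *)
Lemma realize_ultra (N : structure L) G (c : env N G) V (U : set_system (env N V)) :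
  UltraFilter U -> exists (N' : structure L) (d : env N' G) (a : env N' V),
    [/\ forall T, models T N -> models T N', elem_equiv c d &
      forall phi : formula R (ctx_cat V G),
        feval phi (env_cat a d) = ulim U (fun v => feval phi (env_cat v c))].
Proof.
move=> UU; pose d := up_env UU (fun s (g : G s) (_ : env N V) => c s g).
pose a := up_env UU (fun s (x : V s) (v : env N V) => v s x).
exists (ultrapower N UU), d, a; split.
- by move=> T; exact: ultrapower_models.
- move=> sigma; rewrite /d Los.
  rewrite -[LHS](@ulim_cst _ _ U _ UU); last exact: feval_range.
  by apply: eq_ulim.
- move=> phi; pose ad := fun s (x : ctx_cat V G s) (v : env N V) => env_cat v c x.
  have -> : env_cat a d = up_env UU ad.
    apply: functional_extensionality_dep => s.
    by apply: functional_extensionality_dep; case.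
  by rewrite Los.
Qed.

Definition swap_map (V W : ctx L) : ctx_map (ctx_cat V W) (ctx_cat W V) :=
  fun s v => match v with inl x => inr x | inr y => inl y end.

Lemma feval_swap (M : interp R L) V W (phi : formula R (ctx_cat V W)) (e : env M V) (w : env M W) :
  feval (fren (@swap_map V W) phi) (env_cat w e) = feval phi (env_cat e w).
Proof.
rewrite feval_ren; congr (feval phi _); apply: functional_extensionality_dep => s.
by apply: functional_extensionality_dep; case.
Qed.

(** The sets where a formula with limit 0 along [F] is below some e > 0 form a base on the side of
    M. They are nonempty because the infimum of the formula over [V] is a formula in the constants
    alone, with the same value in both models. *)
Lemma transfer_ultra (M N : structure L) H (c : env M H) (d : env N H) V
    (F : set_system (env N V)) :
  elem_equiv c d -> UltraFilter F ->
  exists2 U : set_system (env M V), UltraFilter U &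
    forall phi : formula R (ctx_cat V H),
      ulim U (fun x => feval phi (env_cat x c)) = ulim F (fun y => feval phi (env_cat y d)).
Proof.
move=> cd UF.
have uf (K : interp R L) (k : env K H) (phi : formula R (ctx_cat V H)) :
  unitf (fun x => feval phi (env_cat x k)) by move=> x; exact: feval_range.
pose B (P : set (env M V)) := exists (phi : formula R (ctx_cat V H)) (e : R),
  [/\ 0 < e, ulim F (fun y => feval phi (env_cat y d)) = 0 &
      P = [set x | feval phi (env_cat x c) < e]].
have Bne P : B P -> P !=set0.
  move=> [phi [e [e0 phi0 ->]]].
  have [theta htheta] := formula_inf (fren (@swap_map V H) phi).
  have e20 : 0 < e / 2 by lra.
  have : feval theta c <= e / 2.
    have [y /= hy] := filter_ex (ulim_near UF (uf _ d phi) e20).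
    rewrite cd htheta; apply: le_trans (infT_le y _) _.
      by move=> z; exact: feval_range.
    by rewrite feval_swap; move: hy; rewrite phi0 ltr_norml; lra.
  rewrite htheta => h.
  have uw : unitf (fun w => feval (fren (@swap_map V H) phi) (env_cat c w)).
    by move=> z; exact: feval_range.
  have [x hx] := infT_near (env_elt M V) uw e20.
  by exists x => /=; rewrite -feval_swap; lra.
have BI P Q : B P -> B Q -> exists2 S, B S & S `<=` P `&` Q.
  move=> [phi [e [e0 phi0 ->]]] [psi [e' [e'0 psi0 ->]]].
  exists [set x | feval (fmax phi psi) (env_cat x c) < Num.min e e'].
    exists (fmax phi psi), (Num.min e e'); split=> //; first by rewrite lt_min e0.
    apply: ulim_eq => // r r0.
    apply: filterS2 (ulim_near UF (uf _ d phi) r0) (ulim_near UF (uf _ d psi) r0) => y.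
    have /andP[p0 _] := feval_range phi (env_cat y d).
    have /andP[q0 _] := feval_range psi (env_cat y d).
    rewrite /mkset feval_max phi0 psi0 !subr0 (ger0_norm p0) (ger0_norm q0).
    rewrite ger0_norm ?le_max ?p0//.
    by move=> /ltW h1 /ltW h2; rewrite ge_max h1.
  move=> x; rewrite /mkset feval_max gt_max !lt_min.
  by move=> /andP[/andP[? _] /andP[_ ?]].
have B0 : exists P, B P.
  exists [set x | feval (fcst (ctx_cat V H) 0) (env_cat x c) < 1], (fcst _ 0), 1.
  split=> //; apply: ulim_eq => // r r0; apply: filterE => y; rewrite /mkset.
  by rewrite feval_cst ?lexx ?ler01// subrr normr0 ltW.
have [U UU hU] := ultra_of_base B0 BI Bne; exists U => // phi.
set t := ulim F _; have t01 : 0 <= t <= 1 by exact: ulim_range.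
pose chi := fabsd phi (fcst _ t).
have chiE (K : interp R L) (e : env K (ctx_cat V H)) : feval chi e = `|feval phi e - t|.
  by rewrite feval_absd feval_cst.
apply: ulim_eq => // e e0.
have : B [set x | feval chi (env_cat x c) < e].
  exists chi, e; split=> //; apply: ulim_eq => // r r0.
  apply: filterS (ulim_near UF (uf _ d phi) r0) => y /ltW.
  by rewrite /mkset chiE subr0 normr_id.
by move=> /hU; apply: filterS => x; rewrite /mkset chiE => /ltW.
Qed.
End TypesAndUltrafilters.

(** * Ladders in models of a stable theory *)

Section LadderBound.
Variables (R : realType) (L : signature R) (T : theory L) (T_stable : stable T).
Variables (N : structure L) (N_model : models T N) (G : ctx L) (c : env N G).

(** Stability speaks of formulas without constants in two finite tuples. The constants of [phi] join
    the side of [y], and the coordinates that do not belong to a side are filled with arbitrary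
    elements. *)
Lemma split_formula X Y (phi : formula R (ctx_cat (ctx_cat X Y) G)) :
  exists k (sg : 'I_k -> srt L) (theta : formula R (ctx_cat (vars sg) (vars sg)))
    (tx : env N X -> tup N sg) (ty : env N Y -> tup N sg), forall x y,
    feval theta (env_cat (tuple_env (tx x)) (tuple_env (ty y))) =
    feval phi (env_cat (env_cat x y) c).
Proof.
have [k [sg [f [psi hpsi]]]] := formula_finite
  (fren (fun s v => inr v : ctx_cat (@ctx0 L) _ s) phi).
pose g : ctx_map (ctx_cat (@ctx0 L) (vars sg)) (ctx_cat (vars sg) (vars sg)) :=
  fun s v => match v with inl z => match z with end
    | inr w => match w with VarOf i =>
        match f i with inl (inl _) => inl (VarOf sg i) | _ => inr (VarOf sg i) end end end.
pose tx (x : env N X) : tup N sg := fun i =>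
  match f i with inl (inl v) => x _ v | _ => elt N _ end.
pose ty (y : env N Y) : tup N sg := fun i =>
  match f i with inl (inr v) => y _ v | inr v => c v | _ => elt N _ end.
exists k, sg, (fren g psi), tx, ty => x y; rewrite feval_ren.
have := hpsi N (@env0 R L N) (env_cat (env_cat x y) c).
rewrite feval_ren => h; transitivity (feval psi (env_cat (env0 N)
    (tuple_env (fun i => env_cat (env_cat x y) c (f i))))); last first.
  by rewrite -h; congr (feval phi _).
congr (feval psi _); apply: functional_extensionality_dep => s.
apply: functional_extensionality_dep => -[[]|[i]] /=.
by case E : (f i) => [[v|v]|v]; rewrite /= ?/tx ?/ty E.
Qed.

(** Ladders of every finite length give an infinite one in an ultrapower over a free ultrafilter on
    the natural numbers. Half of the gap is spent on replacing [f] by a formula within eps/4, so the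
    order property holds with eps/2. *)
Lemma ladder_bound X Y (f : env N X -> env N Y -> R) (eps : R) : Def2 c f -> 0 < eps ->
  exists n, forall (a : nat -> env N X) (b : nat -> env N Y),
    exists i j, (i < j < n)%N /\ `|f (a i) (b j) - f (a j) (b i)| < eps.
Proof.
move=> df eps0; apply: contrapT => nn.
have /choice[ab hab] : forall n, exists ab : (nat -> env N X) * (nat -> env N Y),
    forall i j, (i < j < n)%N -> eps <= `|f (ab.1 i) (ab.2 j) - f (ab.1 j) (ab.2 i)|.
  move=> n; apply: contrapT => nab; apply: nn; exists n => a b.
  apply: contrapT => nij; apply: nab; exists (a, b) => i j ij /=.
  by rewrite leNgt; apply/negP => h; apply: nij; exists i, j.
have e40 : 0 < eps / 4 by lra.
have [phi hphi] := df _ e40.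
have [k [sg [theta [tx [ty ht]]]]] := split_formula phi.
have [U UU Un] := nat_free_ultra.
have hf x y : `|f x y - feval theta (env_cat (tuple_env (tx x)) (tuple_env (ty y)))| <= eps / 4.
  rewrite ht; have := hphi (env_cat x y); rewrite /efst /esnd /=.
  by congr (`| _ - _ | <= _).
pose K := ultrapower N UU.
pose A i : tup K sg := fun l => up_in UU (fun n => tx ((ab n).1 i) l).
pose B j : tup K sg := fun l => up_in UU (fun n => ty ((ab n).2 j) l).
apply: (@T_stable k k sg sg theta K); first exact: ultrapower_models.
exists (eps / 2); first by lra.
exists A, B => i j ij.
have E i' j' : feval theta (env_cat (tuple_env (A i')) (tuple_env (B j'))) =
    ulim U (fun n => feval theta (env_cat (tuple_env (tx ((ab n).1 i')))
                                          (tuple_env (ty ((ab n).2 j'))))).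
  pose e s (v : ctx_cat (vars sg) (vars sg) s) : nat -> N s := fun n =>
    env_cat (tuple_env (tx ((ab n).1 i'))) (tuple_env (ty ((ab n).2 j'))) v.
  rewrite -[RHS](Los UU theta e); congr (feval theta _).
  apply: functional_extensionality_dep => s.
  by apply: functional_extensionality_dep => -[[l]|[l]].
rewrite !E leNgt; apply/negP; set u1 := ulim U _; set u2 := ulim U _ => h.
pose d := (eps / 2 - `|u1 - u2|) / 2; have d0 : 0 < d by rewrite /d; lra.
have uf i' j' : unitf (fun n => feval theta (env_cat (tuple_env (tx ((ab n).1 i')))
    (tuple_env (ty ((ab n).2 j'))))) by move=> n; exact: feval_range.
have [n [/= jn [h1 h2]]] := filter_ex (filterI (Un j.+1)
  (filterI (ulim_near UU (uf i j) d0) (ulim_near UU (uf j i) d0))).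
have /hab : (i < j < n)%N by rewrite ij.
have := hf ((ab n).1 i) ((ab n).2 j); have := hf ((ab n).1 j) ((ab n).2 i).
move: h1 h2; rewrite -/u1 -/u2; set t1 := feval _ _; set t2 := feval _ _.
set f1 := f ((ab n).1 i) _; set f2 := f ((ab n).1 j) _ => h1 h2 h3 h4.
have := ler_distD t1 f1 f2; have := ler_distD u1 t1 f2; have := ler_distD u2 u1 f2.
have := ler_distD t2 u2 f2; rewrite (distrC u2 t2) (distrC t2 f2).
by move: h1 h2; rewrite /d; lra.
Qed.
End LadderBound.

(** * Good sets of types *)

Section ListLemmas.
Variable R : realType.

Lemma filter_list (I A : Type) (U : set_system I) (l : seq A) (Q : A -> set I) :
  Filter U -> (forall p, List.In p l -> U (Q p)) -> U [set x | forall p, List.In p l -> Q p x].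
Proof.
move=> FU; elim: l => [|a l IH] h; first by apply: filterE => x p [].
have h1 := h a (or_introl erefl).
have h2 := IH (fun p lp => h p (or_intror lp)).
by apply: filterS2 h1 h2 => x /= h1 h2 p [<-//|]; exact: h2.
Qed.

Lemma ultra_list (I A : Type) (U : set_system I) (l : seq A) (Q : A -> set I) :
  UltraFilter U -> U [set x | exists2 p, List.In p l & Q p x] ->
  exists2 p, List.In p l & U (Q p).
Proof.
move=> UU h; apply: contrapT => nh.
have : U [set x | forall p, List.In p l -> ~ Q p x].
  by apply: filter_list => p lp; apply: ultra_not => // UQ; apply: nh; exists p.
by move=> h'; have [x [[p lp Qp] nQ]] := filter_ex (filterI h h'); exact: nQ p lp Qp.
Qed.

Lemma In_nth (A : Type) (a0 a : A) (l : seq A) : List.In a l ->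
  exists2 i, (i < size l)%N & nth a0 l i = a.
Proof.
elim: l => //= b l IH [->|/IH [i il <-]]; first by exists 0%N.
by exists i.+1.
Qed.

Lemma nth_In (A : Type) (a0 : A) (l : seq A) i : (i < size l)%N -> List.In (nth a0 l i) l.
Proof. by elim: l i => //= b l IH [|i] il; [left|right; exact: IH]. Qed.

Lemma bmax_ge (I : eqType) (r : seq I) (F : I -> R) i : i \in r ->
  F i <= \big[Num.max/0]_(j <- r) F j.
Proof.
elim: r => //= a r IH; rewrite inE big_cons le_max => /orP[/eqP->|/IH ->];
by rewrite ?lexx ?orbT.
Qed.

Lemma bmax_lt (I : eqType) (r : seq I) (F : I -> R) b : 0 < b ->
  (forall i, i \in r -> F i < b) -> \big[Num.max/0]_(j <- r) F j < b.
Proof.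
move=> b0; elim: r => [|a r IH] h; rewrite ?big_nil// big_cons gt_max h ?mem_head//=.
by apply: IH => i ir; apply: h; rewrite inE ir orbT.
Qed.

Lemma bmax_le (I : eqType) (r : seq I) (F : I -> R) b : 0 <= b ->
  (forall i, i \in r -> F i <= b) -> \big[Num.max/0]_(j <- r) F j <= b.
Proof.
move=> b0; elim: r => [|a r IH] h; rewrite ?big_nil// big_cons ge_max h ?mem_head//=.
by apply: IH => i ir; apply: h; rewrite inE ir orbT.
Qed.

Lemma bmax_gt_ex (I : eqType) (r : seq I) (F : I -> R) b : 0 < b ->
  b <= \big[Num.max/0]_(j <- r) F j -> exists2 i, i \in r & b <= F i.
Proof.
move=> b0 h; apply: contrapT => nh.
have : \big[Num.max/0]_(j <- r) F j < b.
  by apply: bmax_lt => // i ir; rewrite ltNge; apply/negP => bi; apply: nh; exists i.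
by rewrite ltNge h.
Qed.

Lemma bmin_le (I : eqType) (r : seq I) (F : I -> R) i : i \in r ->
  \big[Num.min/1]_(j <- r) F j <= F i.
Proof.
elim: r => //= a r IH; rewrite inE big_cons ge_min => /orP[/eqP->|/IH ->];
by rewrite ?lexx ?orbT.
Qed.

Lemma bmin_lt_ex (I : eqType) (r : seq I) (F : I -> R) b : b <= 1 ->
  \big[Num.min/1]_(j <- r) F j < b -> exists2 i, i \in r & F i < b.
Proof.
move=> b1; elim: r => [|a r IH]; first by rewrite big_nil ltNge b1.
rewrite big_cons gt_min => /orP[h|/IH [i ir h]]; first by exists a; rewrite ?mem_head.
by exists i => //; rewrite inE ir orbT.
Qed.

(** Total boundedness of the image of [Y] in a finite-dimensional cube. Without a finite net some
    ultrafilter avoids the neighbourhood of every point, although it is concentrated around the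
    limits of the [f i]. *)
Lemma finite_net (Y : Type) (I : finType) (f : I -> Y -> R) d : 0 < d ->
  (forall i, unitf (f i)) ->
  exists l : seq Y, forall y, exists2 z, List.In z l & forall i, `|f i y - f i z| <= d.
Proof.
move=> d0 uf; apply: contrapT => nl.
pose B (P : set Y) := exists l : seq Y,
  P = [set y | forall z, List.In z l -> exists i, d < `|f i y - f i z|].
have B0 : exists P, B P by eexists; exists [::].
have BI P Q : B P -> B Q -> exists2 S, B S & S `<=` P `&` Q.
  move=> [l ->] [l' ->]; eexists; first by exists (l ++ l').
  by move=> y h; split=> z lz; apply: h; apply/List.in_or_app; [left|right].
have Bne P : B P -> P !=set0.
  move=> [l ->]; apply: contrapT => nP; apply: nl; exists l => y.
  apply: contrapT => ny; apply: nP; exists y => z lz; apply: contrapT => nz.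
  apply: ny; exists z => // i; rewrite leNgt; apply/negP => h; apply: nz.
  by exists i.
have [U UU UB] := ultra_of_base B0 BI Bne; have d20 : 0 < d / 2 by lra.
have Ud : U [set y | forall i, `|f i y - ulim U (f i)| < d / 2].
  by apply: filter_forall => i; exact: ulim_near.
have [y0 hy0] := filter_ex Ud.
have /UB Uy0 : B [set y | forall z, List.In z [:: y0] -> exists i, d < `|f i y - f i z|].
  by exists [:: y0].
have [y [/(_ y0 (or_introl erefl)) [i hi] hy]] := filter_ex (filterI Uy0 Ud).
have := ler_distD (ulim U (f i)) (f i y) (f i y0).
by have := hy0 i; have := hy i; rewrite (distrC (f i y0)) /=; lra.
Qed.
End ListLemmas.

Section ParameterCoding.
Variables (R : realType) (S : symbols) (M : interp R S).

(* Every tuple of parameters is coded by countably many variables of each sort,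
   which are split into countably many slices of the same kind. *)
Definition param : ctx S := fun=> nat.

Definition slice (j : nat) (w : env M param) : env M param :=
  fun s v => w s (pickle (j, v)).

Definition unslice (ws : nat -> env M param) : env M param :=
  fun s u => match (unpickle u : option (nat * nat)) with
             | Some jv => ws jv.1 s jv.2 | None => elt M s end.

Lemma sliceK j ws : slice j (unslice ws) = ws j.
Proof.
apply: functional_extensionality_dep => s; apply: functional_extensionality_dep => v.
by rewrite /slice /unslice pickleK.
Qed.

Lemma subst_slice V (r : env M V -> env M param) j :
  is_subst r -> is_subst (fun e => slice j (r e)).
Proof.
by move=> hr; exact: (subst_ren (fun s v => pickle (j, v)) hr).
Qed.

Section Tuples.
Variables (n : nat) (xs : 'I_n -> srt S).

Definition gett (w : env M param) : env M (vars xs) :=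
  fun s v => w s (match v with VarOf i => val i end).

Lemma subst_gett V (r : env M V -> env M param) :
  is_subst r -> is_subst (fun e => gett (r e)).
Proof.
by move=> hr; exact: (subst_ren (fun s v => match v with VarOf i => val i end) hr).
Qed.

(** A renaming that turns a tuple [t], together with dummy parameters, into a code of [t]. It
    converts predicates of codes into predicates of tuples; [Def_drop] then removes the dummies. *)
Lemma gett_override : exists m : ctx_map param (ctx_cat (vars xs) param),
  forall (t : env M (vars xs)) (w : env M param),
    gett (fun s u => env_cat t w (m s u)) = t.
Proof.
have h s (u : param s) : {z : ctx_cat (vars xs) param s |
    forall i (E : xs i = s), u = val i -> z = inl (cast (P := vars xs) E (VarOf xs i))}.
  apply: cid; have [[i [E ui]]|nh] := pselect (exists i, exists E : xs i = s, u = val i).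
    exists (inl (cast (P := vars xs) E (VarOf xs i))) => j Ej uj.
    have ij : i = j by apply: val_inj; rewrite -ui -uj.
    by case: _ / ij Ej uj => Ej _; rewrite (Prop_irrelevance E Ej).
  exists (inr u) => i E ui; exfalso; apply: nh; by exists i, E.
exists (fun s u => projT1 (h s u)) => t w.
apply: functional_extensionality_dep => s; apply: functional_extensionality_dep => -[i].
by rewrite /gett (projT2 (h (xs i) (val i)) i erefl erefl).
Qed.

Lemma gett_surj (t : env M (vars xs)) : exists w, gett w = t.
Proof. by have [m hm] := gett_override; exists (fun s u => env_cat t (env_elt M param) (m s u)). Qed.
End Tuples.
End ParameterCoding.
Arguments param {S}.
Arguments gett {R S M n} xs w.
Arguments subst_gett {R S M n} xs {V r} _.

Section GoodSets.
Variables (R : realType) (S : symbols) (N : interp R S) (G : ctx S) (c : env N G).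

(** The form in which stability is used for good sets; [ladder_bound] supplies it in models of a
    stable theory. *)
Definition no_ladders := forall X Y (f : env N X -> env N Y -> R) (eps : R),
  Def2 c f -> 0 < eps -> exists n, forall (a : nat -> env N X) (b : nat -> env N Y),
    exists i j, (i < j < n)%N /\ `|f (a i) (b j) - f (a j) (b i)| < eps.

Definition supZ X (Z : set (set_system (env N X))) (f : env N X -> R) : R :=
  sup [set ulim U f | U in Z].

Section SupZ.
Variables (X : ctx S) (Z : set (set_system (env N X))).
Hypothesis ZU : forall U, Z U -> UltraFilter U.
Implicit Types f g : env N X -> R.

Lemma supZ_ge f U : Z U -> unitf f -> ulim U f <= supZ Z f.
Proof.
move=> hU uf; apply: ub_le_sup; last by exists U.
by exists 1 => _ [V /ZU UV <-]; case/andP: (ulim_range UV uf).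
Qed.

Lemma supZ_le f r : Z !=set0 -> (forall U, Z U -> ulim U f <= r) -> supZ Z f <= r.
Proof.
by move=> [U hU] h; apply: ge_sup; [exists (ulim U f), U|move=> _ [V hV <-]; exact: h].
Qed.

Lemma supZ_near f e : Z !=set0 -> unitf f -> 0 < e ->
  exists2 U, Z U & supZ Z f - e < ulim U f.
Proof.
move=> [U0 hU0] uf e0; have hs : has_sup [set ulim U f | U in Z].
  split; first by exists (ulim U0 f), U0.
  by exists 1 => _ [V /ZU UV <-]; case/andP: (ulim_range UV uf).
by have [_ [U hU <-] h] := sup_adherent e0 hs; exists U.
Qed.

Lemma supZ_range f : Z !=set0 -> unitf f -> 0 <= supZ Z f <= 1.
Proof.
move=> [U hU] uf; have UU := ZU hU; apply/andP; split.
  by apply: le_trans (supZ_ge hU uf); case/andP: (ulim_range UU uf).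
by apply: supZ_le; [exists U|move=> V /ZU UV; case/andP: (ulim_range UV uf)].
Qed.

Lemma supZ_dist f g e : Z !=set0 -> unitf f -> unitf g ->
  (forall x, `|f x - g x| <= e) -> `|supZ Z f - supZ Z g| <= e.
Proof.
move=> Z0 uf ug h; rewrite ler_distl; apply/andP; split.
  rewrite lerBlDr; apply: supZ_le => // U hU; have UU := ZU hU.
  apply: le_trans (_ : ulim U f + e <= _); last by rewrite lerD2r; exact: supZ_ge.
  by apply: ulim_le => //; apply: filterE => x; have := h x; rewrite /= ler_norml; lra.
apply: supZ_le => // U hU; have UU := ZU hU.
apply: le_trans (_ : ulim U g + e <= _); last by rewrite lerD2r; exact: supZ_ge.
by apply: ulim_le => //; apply: filterE => x; have := h x; rewrite /= ler_norml; lra.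
Qed.
End SupZ.

(* Z is the set of the nonforking extensions of the type of P over the constants
   c to the model N; types over N are represented by ultrafilters. *)
Record good X (P : set_system (env N X)) (Z : set (set_system (env N X))) : Prop := Good {
  good_ne : Z !=set0;
  good_ultra : forall U, Z U -> UltraFilter U;
  good_ext : forall U psi, Z U -> Def c psi -> ulim U psi = ulim P psi;
  good_def : forall V (phi : env N X -> env N V -> R), Def2 c phi ->
    Def c (fun v => supZ Z (phi^~ v));
  good_net : forall V (phi : env N X -> env N V -> R) (eps : R), Def2 c phi -> 0 < eps ->
    exists Us : seq (set_system (env N X)), (forall U, List.In U Us -> Z U) /\
      forall U, Z U -> exists2 U', List.In U' Us &
        forall v, `|ulim U (phi^~ v) - ulim U' (phi^~ v)| <= eps }.

(** Compactness of [Z] in the topology whose basic clopen sets are {U | U P}, stated for directed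
    families of such sets. *)
Definition compactZ X (Z : set (set_system (env N X))) :=
  forall B : set (set (env N X)), (exists P, B P) ->
    (forall P Q, B P -> B Q -> exists2 S, B S & S `<=` P `&` Q) ->
    (forall P, B P -> exists2 U, Z U & U P) ->
    exists2 U, Z U & forall P, B P -> U P.
End GoodSets.

(** * Existence of good sets of types *)

Section MaximalFamily.
Variables (R : realType) (S : symbols) (N : interp R S) (G : ctx S) (c : env N G).
Variables (X : ctx S) (P : set_system (env N X)) (UP : UltraFilter P).
Local Notation EX := (env N X).
Local Notation EW := (env N param).
Local Notation cond := (EX -> EW -> R).
Implicit Types (Gam : set cond) (g : cond) (U : set_system EX).

(** A condition [g] stands for g(x, w) = 0 for all w simultaneously, which makes it a condition over
    [c]. Consistency is finite approximate satisfiability in N. *)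
Definition consistent Gam := forall l : seq (cond * EW),
  (forall p, List.In p l -> Gam p.1) -> forall d : R, 0 < d ->
  exists x, forall p, List.In p l -> p.1 x p.2 < d.

Definition type_conds : set cond :=
  [set g | exists2 psi, Def c psi & g = fun x _ => `|psi x - ulim P psi|].

Definition realizes Gam : set (set_system EX) :=
  [set U | UltraFilter U /\ forall g, Gam g -> forall w, ulim U (g^~ w) = 0].

Lemma type_conds_Def g : type_conds g -> Def2 c g.
Proof.
move=> [psi dpsi ->]; apply: Def_absd; first exact: (Def_subst (subst_fst (@subst_id _ _ N _)) dpsi).
by apply: Def_cst; exact: ulim_range (Def_unit dpsi).
Qed.

Lemma consistent_type_conds : consistent type_conds.
Proof.
move=> l hl d d0.
have : P [set x | forall p, List.In p l -> p.1 x p.2 < d].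
  apply: filter_list => p /hl [psi dpsi ->].
  exact: (ulim_near UP (Def_unit dpsi) d0).
by move=> /filter_ex.
Qed.

Lemma max_consistent : exists Gam, [/\ forall g, Gam g -> Def2 c g,
  type_conds `<=` Gam, consistent Gam &
  forall g, Def2 c g -> consistent (g |` Gam) -> Gam g].
Proof.
(* The union with [type_conds] takes care of the empty chain, whose union must satisfy [Pr] as well,
   and of the requirement that the maximal family contain [type_conds]. *)
pose Pr Gam := (forall g, Gam g -> Def2 c g) /\ consistent (Gam `|` type_conds).
have [|A [[dA cA] maxA]] := @Zorn_bigcup cond Pr.
  move=> F FP Ftot; split; first by move=> g [A FA Ag]; exact: (FP A FA).1.
  move=> l hl; have : (forall p, List.In p l -> type_conds p.1) \/
      exists2 A, F A & forall p, List.In p l -> (A `|` type_conds) p.1.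
    elim: l hl => [|p l IH] hl; first by left.
    have [|h|[A FA hA]] := IH; first by move=> q ql; apply: hl; right.
      have [[A FA Ap]|h'] := hl p (or_introl erefl).
        by right; exists A => // q [<-|/h]; [left|right].
      by left => q [<-//|/h].
    have [[B FB Bp]|h'] := hl p (or_introl erefl); last first.
      by right; exists A => // q [<-|/hA//]; right.
    right; have [AB|BA] := Ftot A B FA FB.
      by exists B => // q [<-|/hA [/AB|]]; [left|left|right].
    by exists A => // q [<-|/hA//]; left; exact: BA.
  move=> [h|[A FA h]]; first exact: consistent_type_conds.
  exact: (FP A FA).2.
have tA : type_conds `<=` A.
  apply: contrapT => nt; apply: (maxA (A `|` type_conds)).
    split; first by move=> g Ag; left.
    by move=> h; apply: nt => g tg; apply: h; right.
  split; first by move=> g [/dA//|/type_conds_Def].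
  by move=> l hl; apply: cA => p /hl [//|]; right.
have cA' : consistent A by move=> l hl; apply: cA => p /hl; left.
exists A; split=> // g dg cg; apply: contrapT => ng; apply: (maxA (g |` A)).
  by split=> [h hA|h]; [right|apply: ng; apply: h; left].
split; first by move=> h [->|/dA].
by move=> l hl; apply: cg => p /hl [//|/tA]; right.
Qed.

Variable Gam : set cond.
Hypotheses (GD : forall g, Gam g -> Def2 c g) (Gcons : consistent Gam)
  (Gmax : forall g, Def2 c g -> consistent (g |` Gam) -> Gam g).
Local Notation Z := (realizes Gam).

Lemma Gam_unit g w : Gam g -> unitf (g^~ w).
Proof. by move=> /GD; exact: Def2_unitl. Qed.

Lemma consistent_realized Gam' U : UltraFilter U ->
  (forall g, Gam' g -> Def2 c g) ->
  (forall g, Gam' g -> forall w, ulim U (g^~ w) = 0) -> consistent Gam'.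
Proof.
move=> UU dG' h l hl d d0.
have : U [set x | forall p, List.In p l -> p.1 x p.2 < d].
  apply: filter_list => p /hl G'p; apply: (ulim_lt UU (Def2_unitl p.2 (dG' _ G'p))).
  by rewrite h.
by move=> /filter_ex.
Qed.

Lemma realizes_ex : exists U, Z U.
Proof.
pose B (Q : set EX) := exists (l : seq (cond * EW)) (d : R),
  [/\ 0 < d, forall p, List.In p l -> Gam p.1 &
      Q = [set x | forall p, List.In p l -> p.1 x p.2 < d]].
have B0 : exists Q, B Q by eexists; exists [::], 1.
have BI Q Q' : B Q -> B Q' -> exists2 O, B O & O `<=` Q `&` Q'.
  move=> [l [d [d0 hl ->]]] [l' [d' [d'0 hl' ->]]].
  eexists; first exists (l ++ l'), (Num.min d d'); first split=> //.
  - by rewrite lt_min d0.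
  - by move=> p lp; case: (List.in_app_or _ _ _ lp) => [/hl|/hl'].
  - move=> x h; split=> p lp.
      have /h : List.In p (l ++ l') by apply/List.in_or_app; left.
      by rewrite lt_min => /andP[].
    have /h : List.In p (l ++ l') by apply/List.in_or_app; right.
    by rewrite lt_min => /andP[].
have Bne Q : B Q -> Q !=set0 by move=> [l [d [d0 hl ->]]]; exact: Gcons.
have [U UU UB] := ultra_of_base B0 BI Bne; exists U; split=> // g Gg w.
apply: ulim_eq => //; first exact: Gam_unit.
move=> e e0; have /UB : B [set x | forall p, List.In p [:: (g, w)] -> p.1 x p.2 < e].
  by exists [:: (g, w)], e; split=> // p [<-|].
apply: filterS => x /(_ _ (or_introl erefl)) /= h.
by have /andP[g0 _] := Gam_unit w Gg x; rewrite subr0 ger0_norm// ltW.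
Qed.

(** Any one realization of [Gam] shows that [g] is consistent with it, so maximality applies: [Gam]
    contains every condition that holds on Z. *)
Lemma Gam_in g : Def2 c g -> (forall U, Z U -> forall w, ulim U (g^~ w) = 0) -> Gam g.
Proof.
move=> dg h; apply: Gmax => //; have [U [UU hU]] := realizes_ex.
apply: (consistent_realized UU).
  by move=> g' [->|/GD].
by move=> g' [-> w|/hU]; [exact: h|].
Qed.

Lemma notin_Gam g : Def2 c g -> ~ Gam g -> exists U w, Z U /\ 0 < ulim U (g^~ w).
Proof.
move=> dg ng; apply: contrapT => nU; apply: ng; apply: Gam_in => // U ZU w.
have /andP[h _] := ulim_range ZU.1 (Def2_unitl w dg).
apply/eqP; rewrite eq_le h andbT leNgt; apply/negP => h'.
by apply: nU; exists U, w.
Qed.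

(** Different slices keep the parameters of the two conditions independent. Thus finitely many
    instances of conditions can be merged into one instance of one condition. *)
Lemma Gam_max g g' : Gam g -> Gam g' ->
  Gam (fun x w => Num.max (g x (slice 0 w)) (g' x (slice 1 w))).
Proof.
move=> Gg Gg'; have sub j := subst_slice j (subst_snd (@subst_id _ _ N (ctx_cat X param))).
have sf := subst_fst (@subst_id _ _ N (ctx_cat X param)).
apply: Gam_in.
  by apply: Def_max; [exact: Def2_subst (GD Gg) sf (sub 0%N)|
                      exact: Def2_subst (GD Gg') sf (sub 1%N)].
move=> U [UU hU] w; apply: ulim_eq => //.
  move=> x; rewrite le_max ge_max; have /andP[-> ->] := Gam_unit (slice 0 w) Gg x.
  by have /andP[_ ->] := Gam_unit (slice 1 w) Gg' x.
move=> e e0.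
have h1 : U [set x | g x (slice 0 w) < e] by apply: ulim_lt; [exact: Gam_unit|rewrite hU].
have h2 : U [set x | g' x (slice 1 w) < e] by apply: ulim_lt; [exact: Gam_unit|rewrite hU].
apply: filterS2 h1 h2 => x /= h1 h2.
rewrite subr0 ger0_norm ?ge_max ?(ltW h1) ?(ltW h2)//.
by rewrite le_max; case/andP: (Gam_unit (slice 0 w) Gg x) => ->.
Qed.

Lemma Gam0 : Gam (fun _ _ => 0).
Proof.
apply: Gam_in; first by apply: Def_cst; rewrite lexx ler01.
by move=> U [UU _] w; apply: ulim_cst; rewrite lexx ler01.
Qed.

Definition pair_param (w w' : EW) : EW := unslice (fun j => if j == 0%N then w else w').

Lemma realizes_compact : compactZ Z.
Proof.
move=> B0 B0ne B0I B0Z.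
pose B (Q : set EX) := exists Q0 g w (d : R),
  [/\ B0 Q0, Gam g, 0 < d & Q = Q0 `&` [set x | g x w < d]].
have Bne0 : exists Q, B Q.
  by have [Q0 h] := B0ne; eexists; exists Q0, (fun _ _ => 0), (env_elt N param), 1;
    split=> //; exact: Gam0.
have BI Q Q' : B Q -> B Q' -> exists2 O, B O & O `<=` Q `&` Q'.
  move=> [Q0 [g [w [d [hQ0 Gg d0 ->]]]]] [Q0' [g' [w' [d' [hQ0' Gg' d'0 ->]]]]].
  have [O0 hO0 sO0] := B0I _ _ hQ0 hQ0'.
  eexists; first exists O0, (fun x w => Num.max (g x (slice 0 w)) (g' x (slice 1 w))),
    (pair_param w w'), (Num.min d d'); first split=> //; first exact: Gam_max.
    by rewrite lt_min d0.
  move=> x [/sO0 [Qx Q'x]] /=; rewrite !sliceK /= gt_max !lt_min.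
  by move=> /andP[/andP[? _] /andP[_ ?]].
have Bne Q : B Q -> Q !=set0.
  move=> [Q0 [g [w [d [hQ0 Gg d0 ->]]]]]; have [U [UU hU] UQ0] := B0Z _ hQ0.
  have h1 : U [set x | g x w < d] by apply: ulim_lt; [exact: Gam_unit|rewrite hU].
  exact: filter_ex (filterI UQ0 h1).
have [U UU UB] := ultra_of_base Bne0 BI Bne; exists U; last first.
  move=> Q0 hQ0; have /UB : B (Q0 `&` [set x | (fun (_ : EX) (_ : EW) => 0 : R) x (env_elt N param) < 1]).
    by exists Q0, (fun _ _ => 0), (env_elt N param), 1; split=> //; exact: Gam0.
  by apply: filterS => x [].
split=> // g Gg w; apply: ulim_eq => //; first exact: Gam_unit.
move=> e e0; have [Q0 hQ0] := B0ne; have /UB : B (Q0 `&` [set x | g x w < e]).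
  by exists Q0, g, w, e.
apply: filterS => x [_ /= h].
by have /andP[g0 _] := Gam_unit w Gg x; rewrite subr0 ger0_norm// ltW.
Qed.

(** Compactness of Z, with the conditions involved merged by [Gam_max]. A single instance as a
    witness is what allows the cover to be expressed by a predicate over [c], in [cover_quality]. *)
Lemma positive_cover (f : EX -> R) : unitf f -> (forall U, Z U -> 0 < ulim U f) ->
  exists g w (d : R), [/\ Gam g, 0 < d & forall x, g x w < d -> d <= f x].
Proof.
move=> uf hf; apply: contrapT => ng.
pose B (Q : set EX) := exists g w (d : R),
  [/\ Gam g, 0 < d & Q = [set x | g x w < d /\ f x < d]].
have Bne0 : exists Q, B Q.
  by eexists; exists (fun _ _ => 0), (env_elt N param), 1; split=> //; exact: Gam0.
have BI Q Q' : B Q -> B Q' -> exists2 O, B O & O `<=` Q `&` Q'.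
  move=> [g [w [d [Gg d0 ->]]]] [g' [w' [d' [Gg' d'0 ->]]]].
  eexists; first exists (fun x w => Num.max (g x (slice 0 w)) (g' x (slice 1 w))),
    (pair_param w w'), (Num.min d d'); first split=> //; first exact: Gam_max.
    by rewrite lt_min d0.
  move=> x /=; rewrite !sliceK /= gt_max !lt_min.
  by move=> [/andP[/andP[? _] /andP[_ ?]] /andP[? ?]].
have Bne Q : B Q -> Q !=set0.
  move=> [g [w [d [Gg d0 ->]]]]; apply: contrapT => nQ; apply: ng.
  exists g, w, d; split=> // x gx; rewrite leNgt; apply/negP => fx.
  by apply: nQ; exists x.
have [U UU UB] := ultra_of_base Bne0 BI Bne.
have ZU : Z U.
  split=> // g Gg w; apply: ulim_eq => //; first exact: Gam_unit.
  move=> e e0; have /UB : B [set x | g x w < e /\ f x < e] by exists g, w, e.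
  apply: filterS => x [/= h _].
  by have /andP[g0 _] := Gam_unit w Gg x; rewrite subr0 ger0_norm// ltW.
have h0 := hf U ZU.
have /UB : B [set x | (fun (_ : EX) (_ : EW) => 0 : R) x (env_elt N param) < ulim U f / 2 /\ f x < ulim U f / 2].
  exists (fun _ _ => 0), (env_elt N param), (ulim U f / 2).
  by split=> //; [exact: Gam0|lra].
move=> h; have : ulim U f <= ulim U f / 2.
  by apply: ulim_le_cst => //; apply: filterS h => x [_ /ltW].
lra.
Qed.

(** Here maximality is used: since [eta] is inconsistent with [Gam], there are finitely many
    instances of [eta] and of conditions in [Gam] that are nowhere all below [d]. Along a member of
    Z the latter have limit 0, so one of the former must be large. *)
Lemma translates_cover (eta : cond) : Def2 c eta -> ~ Gam eta ->
  exists (l : seq EW) (d : R), 0 < d /\ forall U, Z U ->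
    exists2 w, List.In w l & d <= ulim U (eta^~ w).
Proof.
move=> deta neta.
have : ~ consistent (eta |` Gam) by move=> /(Gmax deta).
move=> /existsNP [l /not_implyP [hl /existsNP [d /not_implyP [d0 nx]]]].
exists (map snd l), d; split=> // U [UU hU].
have : U [set x | exists2 p, List.In p l & d <= p.1 x p.2].
  apply: filterE => x; apply: contrapT => np; apply: nx; exists x => p lp.
  by rewrite ltNge; apply/negP => h; apply: np; exists p.
move=> /(@ultra_list _ _ U l (fun p => [set x | d <= p.1 x p.2])) [p lp Up].
exists p.2; first exact: List.in_map.
have [E|Gp] := hl p lp.
  by apply: (ulim_ge_cst UU (Def2_unitl p.2 deta)); rewrite -E.
have := ulim_ge_cst UU (Gam_unit p.2 Gp) Up; rewrite hU// => h.
by exfalso; lra.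
Qed.
End MaximalFamily.

(** * Pieces on which a predicate oscillates little *)

Section SmallPieces.
Variables (R : realType) (S : symbols) (N : interp R S) (G : ctx S) (c : env N G).
Variables (n : nat) (xs : 'I_n -> srt S) (P : set_system (env N (vars xs))).
Hypothesis ladders : no_ladders c.
Local Notation EX := (env N (vars xs)).
Local Notation EW := (env N param).
Variable Gam : set (EX -> EW -> R).
Hypotheses (GD : forall g, Gam g -> Def2 c g) (Gcons : consistent Gam)
  (Gmax : forall g, Def2 c g -> consistent (g |` Gam) -> Gam g).
Local Notation Z := (realizes Gam).

Lemma Def_subr V (f : env N V -> R) r : Def c f -> Def c (fun e => clamp (f e - r)).
Proof.
move=> df; apply: Def_ext (Def_aff 1 (- r) df) => e.
by rewrite mul1r.
Qed.

Lemma Def_rsub V (f : env N V -> R) r : Def c f -> Def c (fun e => clamp (r - f e)).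
Proof.
move=> df; apply: Def_ext (Def_aff (-1) r df) => e.
by congr clamp; lra.
Qed.

Lemma not_Gam_pos eta U w : Def2 c eta -> Z U -> 0 < ulim U (eta^~ w) -> ~ Gam eta.
Proof. by move=> deta [UU hU] h /hU hw; rewrite hw ltxx in h. Qed.

(* On the piece {eta(-, w) > 0}, each value phi(-, y) oscillates by at most eps,
   as witnessed by a single instance of a condition of Gam. *)
Definition small_pieces (phi : EX -> EW -> R) eps (eta g : EX -> EW -> R) (d : R) :=
  [/\ Def2 c eta, ~ Gam eta, Gam g, 0 < d &
    forall w y, exists e, forall x x', 0 < eta x w -> 0 < eta x' w ->
      g x e < d -> g x' e < d -> `|phi x y - phi x' y| <= eps].

(** The pair ([be j], [be' j]) is almost identified by [al i] for i <= j and separated by it for j <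
    i. Since [x] separates all k pairs, it can become the next rung [al k]. *)
Definition ladder_conds (phi : EX -> EW -> R) eps dl k x (al : nat -> EX) (be be' : nat -> EW) :=
  [/\ forall j, (j < k)%N -> eps < `|phi x (be j) - phi x (be' j)|,
      forall i j, (i <= j < k)%N -> `|phi (al i) (be j) - phi (al i) (be' j)| < dl &
      forall i j, (j < i < k)%N -> eps < `|phi (al i) (be j) - phi (al i) (be' j)|].

(** That [eta] lies outside [Gam] is the induction hypothesis proper: some instance of [eta] is
    positive along a member of Z, so there are realizations from which the ladder can be
    continued. *)
Definition ladder_family (phi : EX -> EW -> R) eps dl k := exists eta (al : nat -> EW -> EX)
    (be be' : nat -> EW -> EW),
  [/\ Def2 c eta, ~ Gam eta, forall i, is_subst (al i),
      (forall j, is_subst (be j)) /\ (forall j, is_subst (be' j)) &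
      forall x w, 0 < eta x w ->
        ladder_conds phi eps dl k x (al^~ w) (be^~ w) (be'^~ w)].

Lemma ladder_family0 phi eps dl : ladder_family phi eps dl 0.
Proof.
exists (fun _ _ => 1), (fun _ => fun w => gett xs w), (fun _ => id), (fun _ => id); split.
- by apply: Def_cst; rewrite ler01 lexx.
- move=> G1; have [U [UU hU]] := realizes_ex GD Gcons.
  have := hU _ G1 (env_elt N param).
  by rewrite ulim_cst ?ler01 ?lexx// => /eqP; rewrite oner_eq0.
- by move=> i; exact: (subst_gett xs (@subst_id _ _ N _)).
- by split=> j; exact: subst_id.
- by move=> x w _; split=> // i j; rewrite ?ltn0 ?andbF.
Qed.

Section Step.
Variables (phi : EX -> EW -> R) (dphi : Def2 c phi).
Variables (eps : R) (eps0 : 0 < eps) (eps1 : eps <= 1).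
Variables (k : nat) (eta : EX -> EW -> R) (al : nat -> EW -> EX) (be be' : nat -> EW -> EW).
Hypotheses (deta : Def2 c eta) (neta : ~ Gam eta) (sal : forall i, is_subst (al i))
  (sbe : forall j, is_subst (be j)) (sbe' : forall j, is_subst (be' j)).
Hypothesis heta : forall x w, 0 < eta x w ->
  ladder_conds phi (eps / 5) (eps / 20) k x (al^~ w) (be^~ w) (be'^~ w).

Definition al1 i (w : EW) : EX := if (i < k)%N then al i (slice 0 w) else gett xs (slice 3 w).

(** Slice 0 codes the old ladder, slice 3 the new rung, slices 1 and 2 the new pair. Positivity says
    that the pair separates [x] by more than eps/5 but every rung, the new one included, by less
    than eps/20. *)
Definition eta1 (x : EX) (w : EW) : R :=
  Num.min (eta x (slice 0 w)) (Num.min (eta (gett xs (slice 3 w)) (slice 0 w))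
    (Num.min (clamp (`|phi x (slice 1 w) - phi x (slice 2 w)| - eps / 5))
      (clamp (eps / 20 - \big[Num.max/0]_(i <- iota 0 k.+1)
         `|phi (al1 i w) (slice 1 w) - phi (al1 i w) (slice 2 w)|)))).

Lemma subst_al1 V (r : env N V -> EW) i : is_subst r -> is_subst (fun e => al1 i (r e)).
Proof.
move=> hr; rewrite /al1; case: (i < k)%N; last by apply: (subst_gett xs); exact: subst_slice.
exact: subst_comp (sal i) (subst_slice 0 hr).
Qed.

Lemma Def_eta1 : Def2 c eta1.
Proof.
have sf := subst_fst (@subst_id _ _ N (ctx_cat (vars xs) param)).
have ss j := subst_slice j (subst_snd (@subst_id _ _ N (ctx_cat (vars xs) param))).
have sa i := subst_al1 i (subst_snd (@subst_id _ _ N (ctx_cat (vars xs) param))).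
apply: Def_min; first exact: Def2_subst deta sf (ss 0%N).
apply: Def_min; first exact: Def2_subst deta (subst_gett xs (ss 3%N)) (ss 0%N).
apply: Def_min.
  by apply: Def_subr; apply: Def_absd; [exact: Def2_subst dphi sf (ss 1%N)|
                                        exact: Def2_subst dphi sf (ss 2%N)].
apply: Def_rsub; apply: Def_bigmax => i; apply: Def_absd.
  exact: Def2_subst dphi (sa i) (ss 1%N).
exact: Def2_subst dphi (sa i) (ss 2%N).
Qed.

Lemma ladder_extend : ~ Gam eta1 -> ladder_family phi (eps / 5) (eps / 20) k.+1.
Proof.
move=> neta1.
exists eta1, al1, (fun j w => if (j < k)%N then be j (slice 0 w) else slice 1 w),
  (fun j w => if (j < k)%N then be' j (slice 0 w) else slice 2 w); split=> //.
- exact: Def_eta1.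
- by move=> i; exact: (subst_al1 i (@subst_id _ _ N _)).
- split=> j; case: (j < k)%N; try exact: subst_slice _ (@subst_id _ _ N _).
    exact: subst_comp (sbe j) (subst_slice 0 (@subst_id _ _ N _)).
  exact: subst_comp (sbe' j) (subst_slice 0 (@subst_id _ _ N _)).
move=> x w; rewrite /eta1 !lt_min !clamp_gt0 !subr_gt0.
move=> /and4P[/heta [h1 h2 h3] /heta [h4 _ _] h5 h6].
have hmax i : (i < k.+1)%N -> `|phi (al1 i w) (slice 1 w) - phi (al1 i w) (slice 2 w)| < eps / 20.
  move=> ik; apply: le_lt_trans h6.
  by apply: (bmax_ge (fun i => `|phi (al1 i w) (slice 1 w) - phi (al1 i w) (slice 2 w)|));
    rewrite mem_iota.
split=> [j|i j|i j].
- by rewrite ltnS; case: ltnP => [jk _|kj jk //]; exact: h1.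
- move=> /andP[ij jk]; case: (ltnP j k) => [jk'|kj].
    by rewrite /al1 (leq_ltn_trans ij jk'); apply: h2; rewrite ij jk'.
  exact: hmax (leq_ltn_trans ij jk).
- move=> /andP[ji ik]; have jk : (j < k)%N by rewrite -ltnS (leq_ltn_trans ji ik).
  rewrite jk /al1; case: (ltnP i k) => [ik'|ki]; first by apply: h3; rewrite ji ik'.
  exact: h4.
Qed.

Section Otherwise.
Variables (l : nat) (h : R).

Definition al2 i (w : EW) : EX := if (i < k)%N then al i (slice 0 w) else gett xs (slice 1 w).

Definition net_gap (w y : EW) : R :=
  \big[Num.min/1]_(m <- iota 0 l) \big[Num.max/0]_(i <- iota 0 k.+1)
     `|phi (al2 i w) y - phi (al2 i w) (slice m.+3 w)|.

(** Slice 1 is again the new rung. The slices from 3 on code a finite set of values of y that is an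
    eps/20-net as seen by the rungs; slice 2 codes a reference point, with which [x] agrees up to
    eps/10 on this net. *)
Definition eta2 (x : EX) (w : EW) : R :=
  Num.min (eta x (slice 0 w)) (Num.min (eta (gett xs (slice 1 w)) (slice 0 w))
    (Num.min (clamp (eps / 20 - supT (net_gap w)))
      (clamp (eps / 10 - \big[Num.max/0]_(m <- iota 0 l)
         `|phi x (slice m.+3 w) - phi (gett xs (slice 2 w)) (slice m.+3 w)|)))).

Lemma subst_al2 V (r : env N V -> EW) i : is_subst r -> is_subst (fun e => al2 i (r e)).
Proof.
move=> hr; rewrite /al2; case: (i < k)%N; last by apply: (subst_gett xs); exact: subst_slice.
exact: subst_comp (sal i) (subst_slice 0 hr).
Qed.

Lemma Def_net_gap : Def2 c net_gap.
Proof.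
have sf := subst_fst (@subst_id _ _ N (ctx_cat param param)).
have ss := subst_snd (@subst_id _ _ N (ctx_cat param param)).
apply: Def_bigmin => m; apply: Def_bigmax => i; apply: Def_absd.
  exact: Def2_subst dphi (subst_al2 i sf) ss.
exact: Def2_subst dphi (subst_al2 i sf) (subst_slice _ sf).
Qed.

Lemma Def_eta2 : Def2 c (fun x w => clamp (eta2 x w - h)).
Proof.
have sf := subst_fst (@subst_id _ _ N (ctx_cat (vars xs) param)).
have ss j := subst_slice j (subst_snd (@subst_id _ _ N (ctx_cat (vars xs) param))).
apply: Def_subr; apply: Def_min; first exact: Def2_subst deta sf (ss 0%N).
apply: Def_min; first exact: Def2_subst deta (subst_gett xs (ss 1%N)) (ss 0%N).
apply: Def_min.
  apply: Def_rsub; exact: Def_subst (subst_snd (@subst_id _ _ N _)) (Def_sup Def_net_gap).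
apply: Def_rsub; apply: Def_bigmax => m; apply: Def_absd.
  exact: Def2_subst dphi sf (ss _).
exact: Def2_subst dphi (subst_gett xs (ss 2%N)) (ss _).
Qed.

Hypotheses (h0 : 0 < h) (h1 : h <= eps / 80).

(* The condition eta1 itself bounds the oscillation of phi between an arbitrary
   y and the point of the net that is closest to y on the ladder. *)
Lemma eta2_small w y : exists e, forall x x',
  0 < clamp (eta2 x w - h) -> 0 < clamp (eta2 x' w - h) ->
  eta1 x e < h -> eta1 x' e < h -> `|phi x y - phi x' y| <= eps.
Proof.
have [ep0 ep1 hh0 hh1] : [/\ 0 < eps, eps <= 1, 0 < h & h <= eps / 80] by [].
have [[x1 hx1]|nx] := pselect (exists x, 0 < clamp (eta2 x w - h)); last first.
  by exists w => x x' hx; exfalso; apply: nx; exists x.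
move: hx1; rewrite clamp_gt0 subr_gt0 /eta2 !lt_min => /and4P[_ ha hs _].
have hs' : supT (net_gap w) < eps / 20 - h.
  by move: hs; case: (clampP (eps / 20 - supT (net_gap w))) => [[? ->]|[[? ->]|[? ->]]]; lra.
have ungap : unitf (net_gap w) by exact: Def2_unit Def_net_gap.
have /bmin_lt_ex [|m] : net_gap w y < eps / 20 - h.
  by apply: le_lt_trans hs'; exact: supT_ge.
  by lra.
rewrite mem_iota => /andP[_ ml] /= hm; rewrite add0n in ml.
pose e := unslice (fun j => if j == 0%N then slice 0 w else if j == 1%N then y
  else if j == 2%N then slice m.+3 w else slice 1 w).
have e0E : slice 0 e = slice 0 w by rewrite /e sliceK.
have e1E : slice 1 e = y by rewrite /e sliceK.
have e2E : slice 2 e = slice m.+3 w by rewrite /e sliceK.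
have e3E : slice 3 e = slice 1 w by rewrite /e sliceK.
have alE i : al1 i e = al2 i w by rewrite /al1 /al2 e0E e3E.
exists e.
have key x : 0 < clamp (eta2 x w - h) -> eta1 x e < h ->
    `|phi x y - phi x (slice m.+3 w)| < eps / 5 + h /\
    `|phi x (slice m.+3 w) - phi (gett xs (slice 2 w)) (slice m.+3 w)| < eps / 10.
  rewrite clamp_gt0 subr_gt0 /eta2 !lt_min => /and4P[hx _ _ hn] hg; split; last first.
    have hn' : 0 < eps / 10 - \big[Num.max/0]_(m <- iota 0 l)
        `|phi x (slice m.+3 w) - phi (gett xs (slice 2 w)) (slice m.+3 w)|.
      by rewrite -clamp_gt0; apply: lt_trans hn.
    move: hn'; rewrite subr_gt0; apply: le_lt_trans.
    by apply: (bmax_ge (fun m => `|phi x (slice m.+3 w) -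
      phi (gett xs (slice 2 w)) (slice m.+3 w)|)); rewrite mem_iota.
  move: hg; rewrite /eta1 e0E e1E e2E e3E !gt_min.
  have -> : \big[Num.max/0]_(i <- iota 0 k.+1) `|phi (al1 i e) y - phi (al1 i e) (slice m.+3 w)| =
      \big[Num.max/0]_(i <- iota 0 k.+1) `|phi (al2 i w) y - phi (al2 i w) (slice m.+3 w)|.
    by apply: eq_bigr => i _; rewrite alE.
  (* One of the four terms of [eta1] is below h. The first two are not, because [eta2] exceeds h at
     x, and the last is not, by the choice of the net point; so the third bounds the variation of
     phi(x, -) from y to the net point. *)
  case/or4P => [h2|h2|h2|h2].
  - by have := lt_trans h2 hx; rewrite ltxx.
  - by have := lt_trans h2 ha; rewrite ltxx.
  - by move: h2; case: (clampP (`|phi x y - phi x (slice m.+3 w)| - eps / 5)) =>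
      [[? ->]|[[? ->]|[? ->]]]; lra.
  - have : h <= clamp (eps / 20 - \big[Num.max/0]_(i <- iota 0 k.+1)
        `|phi (al2 i w) y - phi (al2 i w) (slice m.+3 w)|).
      by apply: clamp_ge; [lra|move: hm; rewrite /net_gap; lra].
    by rewrite leNgt h2.
move=> x x' hx hx' gx gx'; have [a1 a2] := key x hx gx; have [b1 b2] := key x' hx' gx'.
set z := slice m.+3 w in a1 a2 b1 b2; set x0 := gett xs (slice 2 w) in a2 b2.
have := ler_distD (phi x z) (phi x y) (phi x' y).
have := ler_distD (phi x0 z) (phi x z) (phi x' y).
have := ler_distD (phi x' z) (phi x0 z) (phi x' y).
rewrite (distrC (phi x0 z) (phi x' z)) (distrC (phi x' z) (phi x' y)); lra.
Qed.
End Otherwise.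

(** If [eta1] is outside [Gam], the ladder grows. Otherwise members of Z separate only pairs that
    some rung separates too, so that values on a net for the rungs determine phi(x, -) up to eps.
    The new rung and the reference point are typical points for a member of Z along which [eta] is
    positive. *)
Lemma ladder_or_small : ladder_family phi (eps / 5) (eps / 20) k.+1 \/
  exists eta' g d, small_pieces phi eps eta' g d.
Proof.
have [e0 e1] : 0 < eps /\ eps <= 1 by [].
have [Geta1|neta1] := pselect (Gam eta1); last by left; exact: ladder_extend.
right; have [U [w0 [ZU Uw0]]] := notin_Gam GD Gcons Gmax deta neta.
have UU := ZU.1; set t := ulim U _ in Uw0.
have ueta : unitf (eta^~ w0) by exact: (Def2_unitl w0 deta).
have t20 : t / 2 < t by lra.
have Ut : U [set x | t / 2 < eta x w0] by exact: ulim_gt.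
have [a ha] := filter_ex Ut; have [ca hca] := gett_surj a.
pose al0 i := if (i < k)%N then al i w0 else a.
have eps40 : 0 < eps / 40 by lra.
have [ds hds] := @finite_net R EW 'I_k.+1 (fun i y => phi (al0 i) y) _ eps40
  (fun i => @Def2_unit _ _ _ _ c _ _ phi (al0 i) dphi).
have uphi y : unitf (phi^~ y) by exact: (Def2_unitl y dphi).
have Ud : U [set x | forall y, List.In y ds -> `|phi x y - ulim U (phi^~ y)| < eps / 40].
  by apply: filter_list => y _; exact: ulim_near.
have [x0 hx0] := filter_ex Ud; have [cx hcx] := gett_surj x0.
pose y0 := env_elt N param.
pose w1 := unslice (fun j => match j with 0 => w0 | 1 => ca | 2 => cx | j.+3 => nth y0 ds j end).
(* Net and reference point are accurate to eps/40, so every term of [eta2] is at least [cc] almost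
   everywhere along U. Cutting at [cc / 2] leaves a positive part and respects the bound eps/80 of
   [eta2_small]. *)
pose cc := Num.min (t / 2) (eps / 40).
have cc0 : 0 < cc by rewrite lt_min; apply/andP; split; lra.
have cc1 : cc <= eps / 40 by rewrite ge_min lexx orbT.
have ds' m : (m < size ds)%N -> List.In (nth y0 ds m) ds by exact: nth_In.
have al2E i : al2 i w1 = al0 i by rewrite /al2 /al0 /w1 !sliceK hca.
have hsup : supT (net_gap (size ds) w1) <= eps / 40.
  apply: supT_le => // y; have [z /(In_nth y0) [m ml <-] hz] := hds y.
  apply: le_trans (bmin_le _ (_ : m \in iota 0 (size ds))) _; first by rewrite mem_iota.
  apply: bmax_le; first lra.
  move=> i; rewrite mem_iota => /andP[_ ik]; rewrite al2E /w1 sliceK /=.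
  exact: (hz (Ordinal ik)).
have hU : U [set x | cc <= eta2 (size ds) x w1].
  apply: filterS2 Ut Ud => x hx hd; rewrite /mkset /eta2.
  rewrite {1 2 3}/w1 !sliceK hca !le_min; apply/and4P; split.
  - by rewrite /cc ge_min (ltW hx).
  - by rewrite /cc ge_min (ltW ha).
  - by apply: clamp_ge; lra.
  - apply: clamp_ge; first lra.
    set b := \big[Num.max/0]_(m <- _) _; suff : b <= eps / 20 by lra.
    apply: bmax_le; first lra.
    move=> m; rewrite mem_iota => /andP[_ ml]; rewrite /w1 !sliceK hcx /=.
    have := hd _ (ds' _ ml); have := hx0 _ (ds' _ ml).
    set u := ulim U _; have := ler_distD u (phi x (nth y0 ds m)) (phi x0 (nth y0 ds m)).
    by rewrite (distrC u (phi x0 _)); lra.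
have d2 := Def_eta2 (size ds) (cc / 2).
exists (fun x w => clamp (eta2 (size ds) x w - cc / 2)), eta1, (cc / 2); split=> //.
- apply: (not_Gam_pos (U := U) (w := w1)) => //.
  apply: (@lt_le_trans _ _ (cc / 2)); first lra.
  apply: ulim_ge_cst => //; first exact: (Def2_unitl w1 d2).
  by apply: filterS hU => x hx; apply: clamp_ge; move: hx; rewrite /mkset; lra.
- by lra.
- by move=> w y; apply: eta2_small; lra.
Qed.
End Step.

(** Otherwise the ladders grow forever, and |phi(x, y) - phi(x, y')| has ladders of every length,
    with values above eps/5 on one side and below eps/20 on the other. *)
Lemma small_pieces_ex (phi : EX -> EW -> R) eps : Def2 c phi -> 0 < eps ->
  exists eta g d, small_pieces phi eps eta g d /\ d <= 1.
Proof.
move=> dphi eps0; wlog eps1 : eps eps0 / eps <= 1.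
  move=> H; have e10 : 0 < Num.min eps 1 by rewrite lt_min eps0 ltr01.
  have [|eta [g [d [[deta neta Gg d0 hd] d1]]]] := H _ e10; first by rewrite ge_min lexx orbT.
  exists eta, g, d; split=> //; split=> // w y; have [e he] := hd w y.
  exists e => x x' h1 h2 h3 h4; apply: le_trans (he x x' h1 h2 h3 h4) _.
  by rewrite ge_min lexx.
suff [eta [g [d [deta neta Gg d0 hd]]]] : exists eta g d, small_pieces phi eps eta g d.
  exists eta, g, (Num.min d 1); split; last by rewrite ge_min lexx orbT.
  split=> //; first by rewrite lt_min d0 ltr01.
  move=> w y; have [e he] := hd w y; exists e => x x' h1 h2.
  by rewrite !lt_min => /andP[h3 _] /andP[h4 _]; exact: he.
apply: contrapT => nsmall.
have fam k : ladder_family phi (eps / 5) (eps / 20) k.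
  elim: k => [|k [eta [al [be [be' [deta neta sal [sbe sbe'] heta]]]]]].
    exact: ladder_family0.
  by have [//|] := ladder_or_small dphi eps0 eps1 deta neta sal sbe sbe' heta.
pose psi (x : EX) (w : EW) := `|phi x (slice 0 w) - phi x (slice 1 w)|.
have dpsi : Def2 c psi.
  have sf := subst_fst (@subst_id _ _ N (ctx_cat (vars xs) param)).
  have ss j := subst_slice j (subst_snd (@subst_id _ _ N (ctx_cat (vars xs) param))).
  by apply: Def_absd; [exact: Def2_subst dphi sf (ss 0%N)|exact: Def2_subst dphi sf (ss 1%N)].
have e0 : 0 < eps / 10 by lra.
have [k hk] := ladders dpsi e0.
have [eta [al [be [be' [deta neta sal [sbe sbe'] heta]]]]] := fam k.
have [U [w [[UU _] Uw]]] := notin_Gam GD Gcons Gmax deta neta.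
have [x /heta [_ hle hgt]] := filter_ex (ulim_gt UU (Def2_unitl w deta) Uw).
have [i [j [/andP[ij jk]]]] := hk (al^~ w) (fun j => pair_param (be j w) (be' j w)).
rewrite /psi !sliceK /= ltNge => /negP; apply.
have h1 : `|phi (al i w) (be j w) - phi (al i w) (be' j w)| < eps / 20.
  by apply: hle; rewrite (ltnW ij) jk.
have h2 : eps / 5 < `|phi (al j w) (be i w) - phi (al j w) (be' i w)|.
  by apply: hgt; rewrite ij jk.
rewrite distrC; apply: le_trans (ler_norm _); lra.
Qed.
End SmallPieces.

(** * Finite nets and definable suprema on the set of realizations *)

Section RealizationsAreGood.
Variables (R : realType) (S : symbols) (N : interp R S) (G : ctx S) (c : env N G).
Variables (n : nat) (xs : 'I_n -> srt S) (P : set_system (env N (vars xs))).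
Hypothesis ladders : no_ladders c.
Local Notation EX := (env N (vars xs)).
Local Notation EW := (env N param).
Variable Gam : set (EX -> EW -> R).
Hypotheses (GD : forall g, Gam g -> Def2 c g) (Gcons : consistent Gam)
  (Gmax : forall g, Def2 c g -> consistent (g |` Gam) -> Gam g)
  (UP : UltraFilter P) (PGam : type_conds c P `<=` Gam).
Local Notation Z := (realizes Gam).
Implicit Types eps r d : R.

Lemma realizes_ne : Z !=set0. Proof. exact: realizes_ex GD Gcons. Qed.

Lemma realizes_ultra U : Z U -> UltraFilter U. Proof. by case. Qed.

Section Pieces.
Variables (phi eta g : EX -> EW -> R) (eps d : R).
Hypotheses (dphi : Def2 c phi) (small : small_pieces c Gam phi eps eta g d).

Let deta : Def2 c eta. Proof. by case: small. Qed.
Let dg : Def2 c g. Proof. by case: small => _ _ /GD. Qed.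
Let d0 : 0 < d. Proof. by case: small. Qed.

Lemma piece_large U w e : Z U -> 0 < ulim U (eta^~ w) ->
  U [set x | 0 < eta x w /\ g x e < d].
Proof.
move=> [UU hU] Uw; have [_ _ Gg dp _] := small.
have h1 := ulim_gt UU (Def2_unitl w deta) Uw.
have h2 : U [set x | g x e < d].
  by apply: ulim_lt; [exact: Def2_unitl dg|rewrite (hU _ Gg)].
exact: filterS2 h1 h2.
Qed.

Lemma piece_dist U U' w y : Z U -> Z U' -> 0 < ulim U (eta^~ w) -> 0 < ulim U' (eta^~ w) ->
  `|ulim U (phi^~ y) - ulim U' (phi^~ y)| <= eps.
Proof.
move=> ZU ZU' Uw Uw'; have [_ _ _ _ /(_ w y) [e he]] := small.
have [UU UU'] := (realizes_ultra ZU, realizes_ultra ZU').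
have up : unitf (phi^~ y) := Def2_unitl y dphi.
apply/ler_addgt0Pr => r r0; have r20 : 0 < r / 2 by lra.
have [x [[x1 x2] hx]] := filter_ex (filterI (piece_large e ZU Uw) (ulim_near UU up r20)).
have [x' [[x'1 x'2] hx']] := filter_ex (filterI (piece_large e ZU' Uw') (ulim_near UU' up r20)).
have := he x x' x1 x'1 x2 x'2; rewrite /mkset in hx hx'.
have := ler_distD (phi x y) (ulim U (phi^~ y)) (ulim U' (phi^~ y)).
have := ler_distD (phi x' y) (phi x y) (ulim U' (phi^~ y)).
rewrite (distrC (ulim U (phi^~ y)) (phi x y)); lra.
Qed.
End Pieces.

(** The net has one member of Z for each of the finitely many covering translates of a small piece
    that is large along some member of Z. *)
Lemma realizes_net (phi : EX -> EW -> R) eps : Def2 c phi -> 0 < eps ->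
  exists Us : seq (set_system EX), (forall U, List.In U Us -> Z U) /\
    forall U, Z U -> exists2 U', List.In U' Us &
      forall v, `|ulim U (phi^~ v) - ulim U' (phi^~ v)| <= eps.
Proof.
move=> dphi eps0.
have [eta [g [d [small _]]]] := small_pieces_ex ladders GD Gcons Gmax dphi eps0.
have [deta neta _ _ _] := small.
have [l [d' [d'0 hl]]] := translates_cover GD Gmax deta neta.
suff [Us [hUs hZ]] : exists Us : seq (set_system EX), (forall U, List.In U Us -> Z U) /\
    forall U, Z U -> (exists2 w, List.In w l & d' <= ulim U (eta^~ w)) ->
      exists2 U', List.In U' Us & forall v, `|ulim U (phi^~ v) - ulim U' (phi^~ v)| <= eps.
  by exists Us; split=> // U ZU; exact: hZ (hl U ZU).
elim: (l) => [|w l' [Us [hUs IH]]]; first by exists [::]; split=> // U _ [].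
have [[V ZV Vw]|nV] := pselect (exists2 V, Z V & d' <= ulim V (eta^~ w)).
  exists (V :: Us); split=> [U [<-//|/hUs//]|U ZU [w' [<-|w'l] Uw']].
    exists V; first by left.
    by move=> v; apply: (piece_dist (w := w) dphi small) => //; exact: lt_le_trans Uw' || exact: lt_le_trans Vw.
  by have [|U' U'l hU'] := IH U ZU; [exists w'|exists U' => //; right].
exists Us; split=> // U ZU [w' [ww'|w'l] Uw'].
  by exfalso; apply: nV; exists U => //; rewrite ww'.
by apply: IH => //; exists w'.
Qed.

Section DefinableSup.
Variables (phi eta g : EX -> EW -> R) (eps d : R).
Hypotheses (dphi : Def2 c phi) (small : small_pieces c Gam phi eps eta g d).
Hypotheses (eps0 : 0 < eps) (d1 : d <= 1).

Let deta : Def2 c eta. Proof. by case: small. Qed.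
Let dg : Def2 c g. Proof. by case: small => _ _ /GD. Qed.

Definition covers k (w : 'I_k -> EW) := forall U, Z U -> exists j, 0 < ulim U (eta^~ (w j)).

(* The value of phi(-, y) on the piece {eta(-, w) > 0}, up to eps. *)
Definition piece_value (r : R) (w y : EW) : R := infT (fun e : EW => supT (fun x : EX =>
  Num.min (phi x y) (clamp (r^-1 * Num.min (eta x w) (clamp (d - g x e)))))).

Lemma Def_piece_value r : Def2 c (piece_value r).
Proof.
apply: Def_inf; apply: Def_sup.
have id := @subst_id _ _ N (ctx_cat (ctx_cat (ctx_cat param param) param) (vars xs)).
have sx := subst_snd id; have se := subst_snd (subst_fst id).
have sw := subst_fst (subst_fst (subst_fst id)).
have sy := subst_snd (subst_fst (subst_fst id)).
apply: Def_min; first exact: Def2_subst dphi sx sy.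
apply: (@Def_ext _ _ _ _ _ _ (fun e => clamp (r^-1 * Num.min (eta (esnd e) (efst (efst (efst e))))
    (clamp (d - g (esnd e) (esnd (efst e)))) + 0))).
  by move=> e; rewrite addr0.
apply: Def_aff; apply: Def_min; first exact: Def2_subst deta sx sw.
by apply: Def_rsub; exact: Def2_subst dg sx se.
Qed.

Lemma piece_value_unitf r w y e : unitf (fun x : EX =>
  Num.min (phi x y) (clamp (r^-1 * Num.min (eta x w) (clamp (d - g x e))))).
Proof.
move=> x; have /andP[p0 p1] := Def2_unitl y dphi x.
by have /andP[q0 q1] := clamp_range (r^-1 * Num.min (eta x w) (clamp (d - g x e)));
  rewrite le_min p0 q0 ge_min p1.
Qed.

Lemma piece_value_le r w y U : 0 < r -> Z U -> 0 < ulim U (eta^~ w) ->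
  piece_value r w y <= ulim U (phi^~ y) + eps.
Proof.
move=> r0 ZU Uw; have UU := realizes_ultra ZU; have ep := eps0.
have [_ _ _ _ /(_ w y) [e he]] := small.
apply: (le_trans (infT_le e _)).
  by move=> e'; apply: (supT_range (env_elt N _)); exact: piece_value_unitf.
have up : unitf (phi^~ y) := Def2_unitl y dphi.
have /andP[u0 _] := ulim_range UU up.
apply: supT_le; first exact: env_elt.
move=> x; have [hx|hx] := ltP 0 (Num.min (eta x w) (clamp (d - g x e))); last first.
  rewrite ge_min; apply/orP; right; apply: clamp_le; first lra.
  by apply: (@le_trans _ _ 0); [rewrite mulr_ge0_le0// invr_ge0 ltW|lra].
rewrite ge_min; apply/orP; left; rewrite -lerBlDr; apply: ulim_ge_cst => //.
move: hx; rewrite lt_min clamp_gt0 subr_gt0 => /andP[hx1 hx2].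
apply: filterS (piece_large small e ZU Uw) => x' [hx'1 hx'2] /=.
by have := he x x' hx1 hx'1 hx2 hx'2; rewrite ler_norml; lra.
Qed.

(** Where eta(x, w) > r and g(x, e) < d/2, the truncated factor equals 1 because r <= d/2, and the
    minimum is phi(x, y). This happens almost everywhere along U, for each e. *)
Lemma piece_value_ge r w y U : 0 < r -> r <= d / 2 -> Z U -> r < ulim U (eta^~ w) ->
  ulim U (phi^~ y) <= piece_value r w y.
Proof.
move=> r0 rd ZU Uw; have UU := realizes_ultra ZU; have [_ _ _ d0 _] := small.
apply: infT_ge; first exact: env_elt.
have hd1 := d1; move=> e; have up : unitf (phi^~ y) := Def2_unitl y dphi.
apply: ulim_le_cst => //.
have h1 := ulim_gt UU (Def2_unitl w deta) Uw.
have h2 : U [set x | g x e < d / 2].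
  have [_ _ Gg _ _] := small.
  by apply: ulim_lt; [exact: Def2_unitl dg|rewrite (ZU.2 _ Gg); lra].
apply: filterS2 h1 h2 => x hx1 hx2; rewrite /mkset in hx1 hx2 *.
apply: le_trans (supT_ge x (@piece_value_unitf r w y e)); rewrite le_min lexx /=.
have /andP[_ p1] := up x; apply: le_trans p1 _; apply: clamp_ge => //.
rewrite mulrC ler_pdivlMr// mul1r le_min (ltW hx1) /=; apply: clamp_ge; lra.
Qed.

Section Cover.
Variables (k : nat) (g1 : EX -> EW -> R) (r : R).
Hypotheses (G1 : Gam g1) (r0 : 0 < r) (rd : r <= d / 2) (r1 : r <= 1 / 2).
Hypothesis kmin : forall k' (w : 'I_k' -> EW), covers w -> (k <= k')%N.

(** A certificate, definable over [c], that the k pieces coded by [u] cover Z: wherever the instance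
    of [g1] is below the quality, one of the pieces attains it. *)
Definition cover_quality (u : EW) : R := infT (fun x : EX =>
  Num.max (g1 x (slice 0 u)) (\big[Num.max/0]_(j <- enum 'I_k) eta x (slice j.+1 u))).

Lemma Def_cover_quality : Def c cover_quality.
Proof.
apply: (@Def_inf _ _ _ _ _ param (vars xs)).
have id := @subst_id _ _ N (ctx_cat param (vars xs)).
have sx := subst_snd id; have su j := subst_slice j (subst_fst id).
apply: Def_max; first exact: Def2_subst (GD G1) sx (su 0%N).
by apply: Def_bigmax => j; exact: Def2_subst deta sx (su _).
Qed.

Lemma cover_quality_unitf u : unitf (fun x : EX =>
  Num.max (g1 x (slice 0 u)) (\big[Num.max/0]_(j <- enum 'I_k) eta x (slice j.+1 u))).
Proof.
move=> x; have /andP[p0 p1] := Def2_unitl (slice 0 u) (GD G1) x.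
rewrite le_max p0 ge_max p1 /=; apply: bmax_le => // j _.
by case/andP: (Def2_unitl (slice j.+1 u) deta x).
Qed.

Lemma good_cover u U : r < cover_quality u -> Z U ->
  exists j : 'I_k, r <= ulim U (eta^~ (slice j.+1 u)).
Proof.
move=> hu ZU; have UU := realizes_ultra ZU; have rr := r0.
have h1 : U [set x | g1 x (slice 0 u) < r].
  by apply: ulim_lt; [exact: Def2_unitl (GD G1)|rewrite (ZU.2 _ G1)].
have h2 : U [set x | exists j : 'I_k, r <= eta x (slice j.+1 u)].
  apply: filterS h1 => x; rewrite /mkset => hx.
  have := lt_le_trans hu (infT_le x (@cover_quality_unitf u)).
  rewrite lt_max => /orP[h|/ltW /(bmax_gt_ex r0) [j _ hj]]; last by exists j.
  by have := lt_trans h hx; rewrite ltxx.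
have [j hj] := ultra_exists UU h2; exists j.
by apply: ulim_ge_cst => //; exact: Def2_unitl deta.
Qed.

(** Since k is the least size of a cover, a piece that misses Z could be omitted, leaving a cover by
    k - 1 pieces. *)
Lemma good_cover_hits u (j : 'I_k) : r < cover_quality u ->
  exists2 U, Z U & 0 < ulim U (eta^~ (slice j.+1 u)).
Proof.
move=> hu; apply: contrapT => nU.
have k0 : (0 < k)%N := leq_ltn_trans (leq0n j) (ltn_ord j).
have km : covers (fun i : 'I_k.-1 => slice (lift j i).+1 u).
  move=> U ZU; have [i hi] := good_cover hu ZU.
  have rr := r0; have hi0 : 0 < ulim U (eta^~ (slice i.+1 u)) by lra.
  case: (unliftP j i) => [i' E|E]; first by exists i'; rewrite -E.
  by exfalso; apply: nU; exists U => //; rewrite -E.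
by have := kmin km; rewrite leqNgt prednK// leqnn.
Qed.

(** The pieces of any good cover yield the supremum up to eps. An infimum over all [u] therefore
    removes the cover, with a penalty equal to 1 for quality at most r and to 0 for quality at least
    2r. *)
Lemma supZ_cover u0 : r + r <= cover_quality u0 -> exists2 h : EW -> R, Def c h &
  forall y, `|supZ Z (phi^~ y) - h y| <= eps.
Proof.
move=> hu0; have [rr ep] : 0 < r /\ 0 < eps by split; [exact: r0|exact: eps0].
have r20 : 0 < r / 2 by lra.
have r2d : r / 2 <= d / 2 by have := rd; lra.
(* The threshold is [r / 2] because [good_cover] provides [eta] at least r in the limit, whereas
   [piece_value_ge] wants its threshold strictly exceeded. *)
pose F y u : R := Num.max (\big[Num.max/0]_(j <- enum 'I_k) piece_value (r / 2) (slice j.+1 u) y)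
  (clamp (- r^-1 * cover_quality u + 2)).
have dF : Def2 c F.
  have id := @subst_id _ _ N (ctx_cat param param).
  have sy := subst_fst id; have su j := subst_slice j (subst_snd id).
  apply: Def_max; first by apply: Def_bigmax => j; exact: Def2_subst (Def_piece_value _) (su _) sy.
  by apply: Def_aff; exact: Def_subst (subst_snd id) Def_cover_quality.
exists (fun y => infT (F y)); first exact: Def_inf.
move=> y; have up : unitf (phi^~ y) := Def2_unitl y dphi.
have /andP[s0 s1] := supZ_range realizes_ultra realizes_ne up.
have h1 : supZ Z (phi^~ y) <= infT (F y).
  apply: infT_ge; first exact: env_elt.
  move=> u; rewrite /F le_max; case: (ltP r (cover_quality u)) => hu; last first.
    apply/orP; right; apply: clamp_ge => //; apply: le_trans s1 _.
    have : r^-1 * cover_quality u <= 1 by rewrite mulrC ler_pdivrMr// mul1r.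
    by rewrite mulNr; lra.
  apply/orP; left; apply: supZ_le realizes_ne _ => U ZU.
  have [j hj] := good_cover hu ZU.
  apply: le_trans (bmax_ge (fun j : 'I_k => piece_value (r / 2) (slice j.+1 u) y) (mem_enum 'I_k j)).
  by apply: piece_value_ge => //; lra.
have h2 : infT (F y) <= supZ Z (phi^~ y) + eps.
  apply: le_trans (infT_le u0 (Def2_unit y dF)) _; rewrite /F ge_max; apply/andP; split.
    apply: bmax_le; first lra.
    move=> j _; have [|U ZU hU] := @good_cover_hits u0 j; first lra.
    apply: le_trans (piece_value_le y r20 ZU hU) _; rewrite lerD2r.
    exact: supZ_ge realizes_ultra _ _ ZU up.
  apply: clamp_le; first lra.
  have : 2 <= r^-1 * cover_quality u0.
    by rewrite mulrC ler_pdivlMr//; lra.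
  by rewrite mulNr; lra.
by rewrite ler_norml; apply/andP; split; lra.
Qed.
End Cover.

Lemma supZ_approx : exists2 h : EW -> R, Def c h & forall y, `|supZ Z (phi^~ y) - h y| <= eps.
Proof.
have [_ neta _ d0 _] := small.
have excov : exists k, `[< exists w : 'I_k -> EW, covers w >].
  have [l [d' [d'0 hl]]] := translates_cover GD Gmax deta neta.
  exists (size l); apply/asboolP; exists (fun j => nth (env_elt N param) l j) => U ZU.
  have [w /(In_nth (env_elt N param)) [j jl <-] hj] := hl U ZU.
  by exists (Ordinal jl); exact: lt_le_trans hj.
have [k /asboolP [w hw] kmin] := ex_minnP excov.
have ue : unitf (fun x => \big[Num.max/0]_(j <- enum 'I_k) eta x (w j)).
  move=> x; apply/andP; split; last by apply: bmax_le => // j _; case/andP: (Def2_unitl (w j) deta x).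
  by elim/big_ind: _ => // [a b a0 b0|j _]; [rewrite le_max a0|case/andP: (Def2_unitl (w j) deta x)].
have [U ZU|g1 [w1 [d' [G1 d'0 hd']]]] := positive_cover GD Gcons Gmax ue.
  have UU := realizes_ultra ZU; have [j hj] := hw U ZU.
  apply: (lt_le_trans hj); rewrite -[leRHS]addr0; apply: ulim_le => //; first exact: Def2_unitl deta.
  apply: filterE => x; rewrite /= addr0.
  exact: (bmax_ge (fun j : 'I_k => eta x (w j)) (mem_enum 'I_k j)).
(* The cover [u0] below has quality at least d', which is at least r + r. *)
pose r := Num.min (d' / 2) (d / 2).
have r0 : 0 < r by rewrite lt_min; apply/andP; split; lra.
have rd : r <= d / 2 by rewrite ge_min lexx orbT.
have rd' : r <= d' / 2 by rewrite ge_min lexx.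
have r1 : r <= 1 / 2 by have := d1; lra.
pose u0 : EW := unslice (fun j => if j is j'.+1 then
  (if insub j' is Some i then w i else env_elt N param) else w1).
apply: (@supZ_cover k g1 r G1 r0 rd) (u0) _.
  by move=> k' w' hw'; apply: kmin; apply/asboolP; exists w'.
apply: infT_ge; first exact: env_elt.
move=> x; have [hx|hx] := ltP (g1 x w1) d'; last first.
  by rewrite le_max /u0 sliceK /=; apply/orP; left; lra.
rewrite le_max; apply/orP; right.
have := hd' x hx; rewrite /u0.
have -> : \big[Num.max/0]_(j <- enum 'I_k) eta x (slice j.+1 u0) =
    \big[Num.max/0]_(j <- enum 'I_k) eta x (w j).
  by apply: eq_bigr => j _; rewrite /u0 sliceK /= valK.
lra.
Qed.
End DefinableSup.

Lemma realizes_def (phi : EX -> EW -> R) : Def2 c phi -> Def c (fun w => supZ Z (phi^~ w)).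
Proof.
move=> dphi; apply: Def_lim => eps eps0.
have [eta [g [d [small d1]]]] := small_pieces_ex ladders GD Gcons Gmax dphi eps0.
exact: (supZ_approx dphi small eps0 d1).
Qed.

(** [phi] may depend on infinitely many variables of [V]; up to eps it depends on a finite tuple,
    which can be coded by [param]. *)
Lemma Def2_param V (phi : EX -> env N V -> R) eps : Def2 c phi -> 0 < eps ->
  exists k (sg : 'I_k -> srt S) (f : forall i, V (sg i)) (psi : EX -> env N (vars sg) -> R),
    Def2 c psi /\ forall x v, `|phi x v - psi x (tuple_env (fun i => v _ (f i)))| <= eps.
Proof.
move=> dphi eps0; have [chi hchi] := dphi _ eps0.
pose m : ctx_map (ctx_cat (ctx_cat (vars xs) V) G) (ctx_cat (ctx_cat (vars xs) G) V) :=
  fun s z => match z with inl (inl x) => inl (inl x) | inl (inr v) => inr v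
                        | inr g => inl (inr g) end.
have [k [sg [f [psi' hpsi]]]] := formula_finite (fren m chi).
exists k, sg, f, (fun x t => feval psi' (env_cat (env_cat x c) t)); split.
  pose m' : ctx_map (ctx_cat (ctx_cat (vars xs) G) (vars sg)) (ctx_cat (ctx_cat (vars xs) (vars sg)) G) :=
    fun s z => match z with inl (inl x) => inl (inl x) | inl (inr v) => inr v
                          | inr t => inl (inr t) end.
  apply: Def_ext (Def_formula c (fren m' psi')) => e; rewrite feval_ren; congr (feval psi' _).
  apply: functional_extensionality_dep => s.
  by apply: functional_extensionality_dep => -[[]|].
move=> x v; rewrite -hpsi feval_ren; have := hchi (env_cat x v).
congr (`|_ - feval chi _| <= _); apply: functional_extensionality_dep => s.
by apply: functional_extensionality_dep => -[[]|].
Qed.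

Theorem realizes_good : good c P Z.
Proof.
split; [exact: realizes_ne|exact: realizes_ultra| | |].
- move=> U psi [UU hU] dpsi.
  have : Gam (fun x _ => `|psi x - ulim P psi|) by apply: PGam; exists psi.
  move=> /hU /(_ (env_elt N param)) h; have up := Def_unit dpsi.
  apply: ulim_eq => // e e0.
  have ua : unitf (fun x => `|psi x - ulim P psi|).
    move=> x; have := up x; have := ulim_range UP up; rewrite normr_ge0 ler_norml.
    by move=> /andP[? ?] /andP[? ?]; apply/andP; split; lra.
  have h' : ulim U (fun x => `|psi x - ulim P psi|) < e by rewrite h.
  by apply: filterS (ulim_lt UU ua h') => x /ltW.
- move=> V phi dphi; apply: Def_lim => eps eps0.
  have [k [sg [f [psi [dpsi hpsi]]]]] := Def2_param dphi eps0.
  have d1 : Def2 c (fun x (w : EW) => psi x (gett sg w)).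
    have id := @subst_id _ _ N (ctx_cat (vars xs) param).
    exact: Def2_subst dpsi (subst_fst id) (subst_gett sg (subst_snd id)).
  have [m hm] := gett_override N sg.
  have dt : Def c (fun t : env N (vars sg) => supZ Z (psi^~ t)).
    apply: (@Def_drop _ _ _ _ _ _ param).
    have sm := subst_ren m (@subst_id _ _ N (ctx_cat (vars sg) param)).
    apply: Def_ext (Def_subst sm (realizes_def d1)) => e.
    by rewrite -{1}(env_catK e) hm.
  have sf : is_subst (fun v : env N V => tuple_env (fun i => v _ (f i)) : env N (vars sg)).
    exists (fun s z => match z with VarOf i => f i end) => e.
    apply: functional_extensionality_dep => s.
    by apply: functional_extensionality_dep; case.
  exists (fun v : env N V => supZ Z (psi^~ (tuple_env (fun i => v _ (f i))))).
    exact: Def_subst sf dt.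
  move=> v; apply: (supZ_dist realizes_ultra realizes_ne) => //.
  - exact: Def2_unitl dphi.
  - exact: Def2_unitl dpsi.
- move=> V phi eps dphi eps0; have e30 : 0 < eps / 3 by lra.
  have [k [sg [f [psi [dpsi hpsi]]]]] := Def2_param dphi e30.
  have d1 : Def2 c (fun x (w : EW) => psi x (gett sg w)).
    have id := @subst_id _ _ N (ctx_cat (vars xs) param).
    exact: Def2_subst dpsi (subst_fst id) (subst_gett sg (subst_snd id)).
  have [Us [hUs hZ]] := realizes_net d1 e30; exists Us; split=> // U ZU.
  have [U' U'l hU'] := hZ U ZU; exists U' => // v.
  have [w hw] := gett_surj (tuple_env (fun i => v _ (f i)) : env N (vars sg)).
  have := hU' w; rewrite hw; set a := ulim U _; set b := ulim U' _ => hab.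
  have [UU UU'] := (realizes_ultra ZU, realizes_ultra (hUs _ U'l)).
  have ha : `|ulim U (phi^~ v) - a| <= eps / 3.
    apply: ulim_dist; [exact: Def2_unitl dphi|exact: Def2_unitl dpsi|by apply: filterE => x; exact: hpsi].
  have hb : `|ulim U' (phi^~ v) - b| <= eps / 3.
    apply: ulim_dist; [exact: Def2_unitl dphi|exact: Def2_unitl dpsi|by apply: filterE => x; exact: hpsi].
  have := ler_distD a (ulim U (phi^~ v)) (ulim U' (phi^~ v)).
  have := ler_distD b a (ulim U' (phi^~ v)).
  by rewrite (distrC b (ulim U' (phi^~ v))); lra.
Qed.
End RealizationsAreGood.

Theorem good_exists (R : realType) (S : symbols) (N : interp R S) (G : ctx S) (c : env N G)
    n (xs : 'I_n -> srt S) (P : set_system (env N (vars xs))) :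
  no_ladders c -> UltraFilter P -> exists2 Z, good c P Z & compactZ Z.
Proof.
move=> ladders UP; have [Gam [GD PGam Gcons Gmax]] := max_consistent c UP.
exists (realizes Gam); first by apply: realizes_good.
exact: (realizes_compact GD Gcons Gmax).
Qed.

(** * Symmetry and uniform definability *)

Section Symmetry.
Variables (R : realType) (S : symbols) (N : interp R S) (G : ctx S) (c : env N G).
Hypothesis ladders : no_ladders c.

Lemma Def2_flip X Y (f : env N X -> env N Y -> R) : Def2 c f -> Def2 c (fun y x => f x y).
Proof.
move=> df; have id := @subst_id _ _ N (ctx_cat Y X).
exact: Def2_subst df (subst_snd id) (subst_fst id).
Qed.

(** Grothendieck's double limit criterion. If the limits differed, choosing points typical for U and
    for V in turn would build ladders of every length, with values near r2 for i <= j and near r1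
    for j < i. *)
Lemma ulim_exchange X Y (f : env N X -> env N Y -> R) U V : Def2 c f ->
  UltraFilter U -> UltraFilter V ->
  ulim V (fun y => ulim U (f^~ y)) = ulim U (fun x => ulim V (f x)).
Proof.
move=> df UU UV; set r1 := ulim V _; set r2 := ulim U _.
apply/eqP; rewrite -subr_eq0 -normr_le0 leNgt; apply/negP => r12.
pose e := `|r1 - r2| / 8; have e0 : 0 < e by rewrite /e; lra.
have ux x : unitf (f x) := Def2_unit x df.
have uy y : unitf (f^~ y) := Def2_unitl y df.
have uU : unitf (fun y => ulim U (f^~ y)) by move=> y; exact: ulim_range.
have uV : unitf (fun x => ulim V (f x)) by move=> x; exact: ulim_range.
have lad k : exists (a : nat -> env N X) (b : nat -> env N Y),
    [/\ forall i, (i < k)%N -> `|ulim V (f (a i)) - r2| < e,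
        forall j, (j < k)%N -> `|ulim U (f^~ (b j)) - r1| < e,
        forall i j, (i <= j < k)%N -> `|f (a i) (b j) - ulim V (f (a i))| < e &
        forall i j, (j < i < k)%N -> `|f (a i) (b j) - ulim U (f^~ (b j))| < e].
  elim: k => [|k [a [b [ha hb hab hba]]]].
    exists (fun=> env_elt N X), (fun=> env_elt N Y).
    by split=> // i j; rewrite ltn0 andbF.
  have hx : U [set x | forall j : 'I_k, `|f x (b j) - ulim U (f^~ (b j))| < e].
    by apply: filter_forall => j; exact: ulim_near.
  have [x [hx1 hx2]] := filter_ex (filterI hx (ulim_near UU uV e0)).
  pose a' i := if (i < k)%N then a i else x.
  have hy : V [set y | forall i : 'I_k.+1, `|f (a' i) y - ulim V (f (a' i))| < e].
    by apply: filter_forall => i; exact: ulim_near.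
  have [y [hy1 hy2]] := filter_ex (filterI hy (ulim_near UV uU e0)).
  exists a', (fun j => if (j < k)%N then b j else y); split=> [i|j|i j|i j].
  - by rewrite ltnS /a'; case: ltnP => [ik _|//]; exact: ha.
  - by rewrite ltnS; case: ltnP => [jk _|//]; exact: hb.
  - move=> /andP[ij jk]; case: ltnP => [jk'|kj].
      by rewrite /a' (leq_ltn_trans ij jk'); apply: hab; rewrite ij jk'.
    exact: (hy1 (Ordinal (leq_ltn_trans ij jk))).
  - move=> /andP[ji ik]; have jk : (j < k)%N by rewrite -ltnS (leq_ltn_trans ji ik).
    rewrite jk /a'; case: ltnP => [ik'|ki]; first by apply: hba; rewrite ji ik'.
    exact: (hx1 (Ordinal jk)).
have [k hk] := ladders df e0; have [a [b [ha hb hab hba]]] := lad k.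
have [i [j [/andP[ij jk]]]] := hk a b; rewrite ltNge => /negP; apply.
have ik := ltn_trans ij jk.
have h1 : `|f (a i) (b j) - ulim V (f (a i))| < e by apply: hab; rewrite (ltnW ij) jk.
have h2 : `|f (a j) (b i) - ulim U (f^~ (b i))| < e by apply: hba; rewrite ij jk.
have h3 := ha i ik; have h4 := hb i ik.
have := ler_distD (f (a i) (b j)) (ulim V (f (a i))) (f (a j) (b i)).
have := ler_distD (ulim V (f (a i))) r2 (f (a j) (b i)).
have := ler_distD r2 r1 (f (a j) (b i)).
have := ler_distD r1 (ulim U (f^~ (b i))) (f (a j) (b i)).
have := ler_distD (ulim U (f^~ (b i))) r1 (f (a j) (b i)).
have := ler_distD (f (a j) (b i)) r1 r2; have := ler_distD (f (a i) (b j)) (f (a j) (b i)) r2.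
have := ler_distD (ulim V (f (a i))) (f (a i) (b j)) r2.
rewrite (distrC (ulim U _) (f (a j) (b i))) (distrC r1 (ulim U _)) (distrC r1 (f (a j) _)).
rewrite (distrC (f (a j) _) (f (a i) _)) => g1 g2 g3 g4 g5 g6 g7 g8.
have E : e * 8 = `|r1 - r2| by rewrite /e; lra.
lra.
Qed.

(* Symmetry of nonforking, for the sets of nonforking extensions as a whole. *)
Lemma good_symmetry_le X Y (P : set_system (env N X)) (Q : set_system (env N Y)) ZX ZY f :
  good c P ZX -> good c Q ZY -> UltraFilter P -> UltraFilter Q -> Def2 c f ->
  ulim Q (fun y => supZ ZX (f^~ y)) <= ulim P (fun x => supZ ZY (f x)).
Proof.
move=> gX gY UP UQ df.
have dG : Def c (fun x => supZ ZY (f x)) := good_def gY (Def2_flip df).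
have dF : Def c (fun y => supZ ZX (f^~ y)) := good_def gX df.
apply/ler_addgt0Pr => eps eps0; have e20 : 0 < eps / 2 by lra.
have [V ZV] := good_ne gY; have UV := good_ultra gY ZV.
rewrite -(good_ext gY ZV dF).
have [Us [hUs hnet]] := good_net gX df e20.
have uy y : unitf (f^~ y) := Def2_unitl y df.
have : V [set y | exists2 U, List.In U Us & supZ ZX (f^~ y) <= ulim U (f^~ y) + eps].
  apply: filterE => y; have [U ZU hU] := supZ_near (good_ultra gX) (good_ne gX) (uy y) e20.
  have [U' U'l hU'] := hnet U ZU; exists U' => //.
  by have := hU' y; rewrite ler_norml; lra.
(* The net is finite, so one of its members nearly attains the supremum for almost all y along V;
   the limits are then exchanged for this single ultrafilter. *)
move=> /(@ultra_list _ _ V Us (fun U => [set y | supZ ZX (f^~ y) <= ulim U (f^~ y) + eps])).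
move=> [U Ul hU]; have ZU := hUs U Ul; have UU := good_ultra gX ZU.
have uU : unitf (fun y => ulim U (f^~ y)) by move=> y; exact: ulim_range.
apply: le_trans (ulim_le UV (Def_unit dF) uU hU) _; rewrite lerD2r (ulim_exchange df UU UV).
rewrite -(good_ext gX ZU dG) -[leRHS]addr0; apply: ulim_le; last first.
- apply: filterE => x; rewrite /= addr0.
  exact: (supZ_ge (good_ultra gY) ZV (Def2_unit x df)).
- exact: Def_unit dG.
- by move=> x; exact: ulim_range (Def2_unit x df).
Qed.

Lemma good_symmetry X Y (P : set_system (env N X)) (Q : set_system (env N Y)) ZX ZY f :
  good c P ZX -> good c Q ZY -> UltraFilter P -> UltraFilter Q -> Def2 c f ->
  ulim Q (fun y => supZ ZX (f^~ y)) = ulim P (fun x => supZ ZY (f x)).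
Proof.
move=> gX gY UP UQ df; apply/eqP; rewrite eq_le good_symmetry_le//=.
exact: (good_symmetry_le gY gX UQ UP (Def2_flip df)).
Qed.

(** * Definitions of limits by finitely many instances *)

Section UniformDefinability.
Variables (X Y : ctx S) (f : env N X -> env N Y -> R) (df : Def2 c f).

(** The number k bounds the ladders of |f(x, y) - f(x, y')|, hence serves for all U. If every choice
    of points failed, the pairs witnessing this, each followed by a point typical for U, would form
    a ladder of length k. *)
Lemma determined_by_instances (eps : R) : 0 < eps -> exists k, forall U, UltraFilter U ->
  exists a : nat -> env N X, forall y y',
    (forall i, (i < k)%N -> `|f (a i) y - f (a i) y'| < eps / 4) ->
    `|ulim U (f^~ y) - ulim U (f^~ y')| <= eps.
Proof.
move=> eps0.
pose psi (x : env N X) (w : env N (ctx_cat Y Y)) := `|f x (efst w) - f x (esnd w)|.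
have dpsi : Def2 c psi.
  have id := @subst_id _ _ N (ctx_cat X (ctx_cat Y Y)).
  by apply: Def_absd; [exact: Def2_subst df (subst_fst id) (subst_fst (subst_snd id))|
                       exact: Def2_subst df (subst_fst id) (subst_snd (subst_snd id))].
have e40 : 0 < eps / 4 by lra.
have e80 : 0 < eps / 8 by lra.
have [k hk] := ladders dpsi e40; exists k => U UU; apply: contrapT => na.
have uy y : unitf (f^~ y) := Def2_unitl y df.
have lad m : (m <= k)%N -> exists (a : nat -> env N X) (b : nat -> env N (ctx_cat Y Y)),
    [/\ forall j, (j < m)%N -> eps < `|ulim U (f^~ (efst (b j))) - ulim U (f^~ (esnd (b j)))|,
        forall i j, (i <= j < m)%N -> psi (a i) (b j) < eps / 4 &
        forall i j, (j < i < m)%N -> eps / 4 * 3 < psi (a i) (b j)].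
  elim: m => [_|m IH mk].
    exists (fun=> env_elt N X), (fun=> env_elt N (ctx_cat Y Y)).
    by split=> // i j; rewrite ltn0 andbF.
  have [a [b [hb hab hba]]] := IH (ltnW mk).
  have hx : U [set x | forall j : 'I_m, `|f x (efst (b j)) - ulim U (f^~ (efst (b j)))| < eps / 8 /\
                                        `|f x (esnd (b j)) - ulim U (f^~ (esnd (b j)))| < eps / 8].
    by apply: filter_forall => j; apply: filterI; exact: ulim_near.
  have [x {}hx] := filter_ex hx.
  pose a' i := if (i < m)%N then a i else x.
  have /existsNP [y /existsNP [y' /not_implyP [hyy' /negP]]] :
      ~ forall y y', (forall i, (i < k)%N -> `|f (a' i) y - f (a' i) y'| < eps / 4) ->
      `|ulim U (f^~ y) - ulim U (f^~ y')| <= eps by move=> h; apply: na; exists a'.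
  rewrite -ltNge => hgt.
  exists a', (fun j => if (j < m)%N then b j else env_cat y y'); split=> [j|i j|i j].
  - by rewrite ltnS; case: ltnP => [jm _|//]; exact: hb.
  - move=> /andP[ij jm]; case: ltnP => [jm'|mj].
      by rewrite /a' (leq_ltn_trans ij jm'); apply: hab; rewrite ij jm'.
    by apply: hyy'; apply: leq_trans mk; exact: leq_ltn_trans ij jm.
  - move=> /andP[ji im]; have jm : (j < m)%N by rewrite -ltnS (leq_ltn_trans ji im).
    rewrite jm /a'; case: ltnP => [im'|mi]; first by apply: hba; rewrite ji im'.
    have [h1 h2] := hx (Ordinal jm); have := hb j jm; rewrite /psi /= in h1 h2 *.
    set u1 := ulim U _ in h1 *; set u2 := ulim U _ in h2 *.
    have := ler_distD (f x (efst (b j))) u1 u2.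
    have := ler_distD (f x (esnd (b j))) (f x (efst (b j))) u2.
    by rewrite (distrC u1 (f x _)); lra.
have [a [b [_ hab hba]]] := lad k (leqnn k).
have [i [j [/andP[ij jk]]]] := hk a b; rewrite ltNge => /negP; apply.
have h1 : psi (a i) (b j) < eps / 4 by apply: hab; rewrite (ltnW ij) jk.
have h2 : eps / 4 * 3 < psi (a j) (b i) by apply: hba; rewrite ij jk.
by rewrite distrC; apply: le_trans (ler_norm _); lra.
Qed.

(** McShane's Lipschitz extension, with constant [C], of a function known at the finitely many
    [y_ i], with respect to the coordinates f(a j, y) for j < k. The values at the [y_ i] are taken
    at the extra point [a k]. *)
Definition instance_value k (F : finType) (C : R) (a : nat -> env N X) (y_ : F -> env N Y) y : R :=
  \big[Num.max/0]_(i <- enum F) clamp (f (a k) (y_ i) -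
    C * \big[Num.max/0]_(j <- iota 0 k) `|f (a j) y - f (a j) (y_ i)|).

Lemma uniform_definition (eps : R) : 0 < eps -> exists k (F : finType) C, 0 <= C /\
  forall U, UltraFilter U -> exists (a : nat -> env N X) (y_ : F -> env N Y), forall y,
    `|ulim U (f^~ y) - instance_value k C a y_ y| <= eps.
Proof.
move=> eps0; have e30 : 0 < eps / 3 by lra.
have [k hk] := determined_by_instances e30.
(* [dl] is the tolerance of [determined_by_instances] at eps/3. With C = 1/dl the penalty is at
   least 1 from distance dl on, and [m] makes it at most eps/3 within one cell. *)
pose dl := eps / 3 / 4; have dl0 : 0 < dl by rewrite /dl; lra.
have dli0 : 0 < dl^-1 by rewrite invr_gt0.
have ei0 : 0 < (eps / 3)^-1 by rewrite invr_gt0.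
pose m := (Num.truncn (dl^-1 + dl^-1 * (eps / 3)^-1)).+1.
have m0 : 0 < m%:R :> R by rewrite ltr0n.
have mgt : dl^-1 + dl^-1 * (eps / 3)^-1 < m%:R by exact: truncnS_gt.
have dei : 0 < dl^-1 * (eps / 3)^-1 by rewrite mulr_gt0.
have mdl : m%:R^-1 < dl by rewrite -[ltRHS]invrK ltf_pV2 ?posrE//; lra.
have mdl' : dl^-1 * m%:R^-1 <= eps / 3.
  rewrite ler_pdivrMr// mulrC -ler_pdivrMr//; lra.
exists k, ({ffun 'I_k -> 'I_m.+1} : finType), dl^-1; split; first by rewrite invr_ge0 ltW.
move=> U UU; have [a ha] := hk U UU.
have uy y : unitf (f^~ y) := Def2_unitl y df.
pose key y : {ffun 'I_k -> 'I_m.+1} := [ffun i => inord (Num.truncn (f (a (val i)) y * m%:R))].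
have keyP y y' i : key y = key y' -> (i < k)%N -> `|f (a i) y - f (a i) y'| <= m%:R^-1.
  move=> yy' ik; have := congr1 (fun h : {ffun 'I_k -> 'I_m.+1} => val (h (Ordinal ik))) yy'.
  have fm z : 0 <= f (a i) z * m%:R by rewrite mulr_ge0 ?ler0n//; case/andP: (uy z (a i)).
  have lt z : (Num.truncn (f (a i) z * m%:R) < m.+1)%N.
    rewrite ltnS -(ler_nat R); apply: (@le_trans _ _ (f (a i) z * m%:R)); first by rewrite truncn_le.
    by rewrite ler_piMl ?ler0n//; case/andP: (uy z (a i)).
  rewrite /= !ffunE !inordK// => E.
  have h1 : (Num.truncn (f (a i) y * m%:R))%:R <= f (a i) y * m%:R by rewrite truncn_le.
  have h2 := truncnS_gt (f (a i) y * m%:R).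
  have h3 : (Num.truncn (f (a i) y' * m%:R))%:R <= f (a i) y' * m%:R by rewrite truncn_le.
  have h4 := truncnS_gt (f (a i) y' * m%:R).
  rewrite E in h1 h2; rewrite -[leRHS]mul1r ler_pdivlMr//.
  rewrite -[X in _ * X]ger0_norm ?ler0n// -normrM mulrBl ler_norml.
  move: h1 h2 h3 h4; set t := Num.truncn _; rewrite -[in t.+1](addn1 t) natrD; lra.
have [y_ hy_] : {y_ : {ffun 'I_k -> 'I_m.+1} -> env N Y & forall y, key (y_ (key y)) = key y}.
  pose y_ z := if pselect (exists y, key y = z) is left h then projT1 (cid h) else env_elt N Y.
  exists y_ => y; rewrite /y_; case: pselect => [h|h]; first exact: projT2 (cid h).
  by exfalso; apply: h; exists y.
have : U [set x | forall z, `|f x (y_ z) - ulim U (f^~ (y_ z))| < eps / 3].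
  by apply: filter_forall => z; exact: ulim_near.
move=> /filter_ex [x hx].
exists (fun i => if (i < k)%N then a i else x), y_ => y.
have -> : instance_value k dl^-1 (fun i => if (i < k)%N then a i else x) y_ y =
    \big[Num.max/0]_(z <- enum {ffun 'I_k -> 'I_m.+1}) clamp (f x (y_ z) -
      dl^-1 * \big[Num.max/0]_(j <- iota 0 k) `|f (a j) y - f (a j) (y_ z)|).
  rewrite /instance_value ltnn; apply: eq_bigr => z _; congr (clamp (_ - _ * _)).
  by apply: eq_big_seq => j; rewrite mem_iota => /andP[_ ->].
have /andP[q0 q1] := ulim_range UU (uy y); set q := ulim U _ in q0 q1 *.
have gap0 z : 0 <= \big[Num.max/0]_(j <- iota 0 k) `|f (a j) y - f (a j) (y_ z)|.
  by elim/big_ind: _ => // b b' b0 b'0; rewrite le_max b0.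
rewrite distrC ler_norml; apply/andP; split; last first.
  rewrite lerBlDl; apply: bmax_le; first lra.
  move=> z _; apply: clamp_le; first lra.
  set gap := \big[Num.max/0]_(j <- _) _; have g0 : 0 <= gap := gap0 z.
  have fx1 : f x (y_ z) <= 1 by case/andP: (Def2_unit x df (y_ z)).
  case: (ltP gap dl) => hg.
    have h1 : `|ulim U (f^~ y) - ulim U (f^~ (y_ z))| <= eps / 3.
      apply: ha => i ik; apply: le_lt_trans hg.
      by apply: (bmax_ge (fun j => `|f (a j) y - f (a j) (y_ z)|)); rewrite mem_iota.
    have := hx z; move: h1; rewrite -/q ltr_norml ler_norml.
    have : 0 <= dl^-1 * gap by rewrite mulr_ge0// invr_ge0 ltW.
    lra.
  have : 1 <= dl^-1 * gap by rewrite mulrC ler_pdivlMr// mul1r.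
  lra.
rewrite lerBrDl; set z := key y.
apply: le_trans (bmax_ge (fun z => clamp (f x (y_ z) - dl^-1 * \big[Num.max/0]_(j <- iota 0 k)
   `|f (a j) y - f (a j) (y_ z)|)) (mem_enum predT z)).
have hgap : \big[Num.max/0]_(j <- iota 0 k) `|f (a j) y - f (a j) (y_ z)| <= m%:R^-1.
  apply: bmax_le; first by rewrite invr_ge0 ler0n.
  by move=> j; rewrite mem_iota => /andP[_ jk]; apply: keyP => //; rewrite hy_.
have h1 : `|ulim U (f^~ y) - ulim U (f^~ (y_ z))| <= eps / 3.
  apply: ha => i ik; apply: (@le_lt_trans _ _ m%:R^-1); first by apply: keyP => //; rewrite hy_.
  exact: mdl.
have := hx z; move: h1; rewrite -/q ltr_norml ler_norml => h1 h2.
set gap := \big[Num.max/0]_(j <- _) _ in hgap *.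
have h3 : dl^-1 * gap <= eps / 3 by apply: le_trans mdl'; rewrite ler_pM2l.
have fx1 : f x (y_ z) <= 1 by case/andP: (Def2_unit x df (y_ z)).
have : f x (y_ z) - dl^-1 * gap <= clamp (f x (y_ z) - dl^-1 * gap).
  apply: clamp_ge => //; have : 0 <= dl^-1 * gap by rewrite mulr_ge0 ?gap0// ltW.
  lra.
lra.

Qed.
End UniformDefinability.
End Symmetry.

(** * One definable predicate for all definitions of a formula *)

Section ParameterSlots.
Variables (S : symbols) (n m : nat) (xs : 'I_n -> srt S) (ys : 'I_m -> srt S) (s0 : srt S).

(** The parameters of a [defpred] form one sequence, into which the points for all levels of
    precision are packed by [pickle]. The sort [s0] is a default for numbers that code nothing. *)
Definition slot_srt (o : option (nat * ('I_n + 'I_m))) : srt S :=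
  match o with Some (_, inl q) => xs q | Some (_, inr q) => ys q | None => s0 end.

Definition slots (t : nat) : srt S := slot_srt (unpickle t).

Definition slot z : vars slots (slot_srt (Some z)) :=
  cast (P := vars slots) (congr1 slot_srt (pickleK z)) (VarOf slots (pickle z)).

Definition slot_x i : ctx_map (vars xs) (vars slots) :=
  fun s v => match v with VarOf q => slot (i, inl q) end.

Definition slot_y i : ctx_map (vars ys) (vars slots) :=
  fun s v => match v with VarOf q => slot (i, inr q) end.

Lemma slots_fill (R : realType) (N : interp R S) (a : nat -> env N (vars xs))
    (y_ : nat -> env N (vars ys)) : exists b : tup N slots,
  (forall i, (fun s v => tuple_env b (slot_x i v)) = a i) /\
  (forall i, (fun s v => tuple_env b (slot_y i v)) = y_ i).
Proof.
pose value o : N (slot_srt o) := match o return N (slot_srt o) with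
  | Some (i, inl q) => a i _ (VarOf xs q) | Some (i, inr q) => y_ i _ (VarOf ys q)
  | None => elt N s0 end.
pose b : tup N slots := fun t => value (unpickle t).
have bz z : tuple_env b (slot z) = value (Some z).
  rewrite /slot; move: (Some z) (pickleK z) => o E; by case: _ / E.
exists b; split=> i; apply: functional_extensionality_dep => s;
  apply: functional_extensionality_dep => -[q].
- exact: (bz (i, inl q)).
- exact: (bz (i, inr q)).
Qed.
End ParameterSlots.

(** The function moves t into the interval [s - d, s + d]. *)
Lemma fop2_trunc_lip (R : realType) (d : R) : 0 <= d ->
  lip2 (fun s t => Num.max (s - d) (Num.min (s + d) t)) 1.
Proof.
move=> d0 s s' t t'; rewrite mul1r.
have := ler_norm (s - s'); have := ler_norm (s' - s); rewrite (distrC s' s).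
have := ler_norm (t - t'); have := ler_norm (t' - t); rewrite (distrC t' t).
move: `|s - s'| `|t - t'| => a b h1 h2 h3 h4.
rewrite /Num.max /Num.min ler_norml; do !case: ifP => //; rewrite ?ltNge;
  try (move=> /negbFE + /negbFE); lra.
Qed.

Section UniformDefiningFormulas.
Variables (R : realType) (L : signature R) (T : theory L) (T_stable : stable T).
Variables (N : structure L) (N_model : models T N).
Variables (n m : nat) (xs : 'I_n -> srt L) (ys : 'I_m -> srt L) (s0 : srt L).
Variable phi : formula R (ctx_cat (vars xs) (vars ys)).

Local Notation dy := (slots xs ys s0).
Local Notation value U y := (ulim U (fun x : env N (vars xs) => feval phi (env_cat x y))).

Definition ctx0_drop V : @ctx_map L (ctx_cat V ctx0) V :=
  fun s v => match v with inl x => x | inr y => match y with end end.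

Lemma no_ladders_model G (c : env N G) : no_ladders c.
Proof. move=> X Y f eps; exact: (ladder_bound T_stable N_model). Qed.

Lemma Def2_feval G (c : env N G) V W (psi : formula R (ctx_cat V W)) :
  Def2 c (fun (v : env N V) w => feval psi (env_cat v w)).
Proof.
by apply: Def_ext (Def_feval c psi) => e; rewrite env_catK.
Qed.

Lemma level_formula (j : nat) (eps : R) : 0 < eps -> exists F : formula R (ctx_cat (vars ys) (vars dy)),
  forall U, UltraFilter U -> exists (a : nat -> env N (vars xs)) (y_ : nat -> env N (vars ys)),
  forall w : env N (vars dy),
    (forall i : nat, (fun s v => w s (slot_x ys s0 (pickle (j, i)) v)) = a i) ->
    (forall i : nat, (fun s v => w s (slot_y xs s0 (pickle (j, i)) v)) = y_ i) ->
  forall y, `|value U y - feval F (env_cat y w)| <= eps.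
Proof.
move=> eps0; have e20 : 0 < eps / 2 by lra.
pose c0 := @env0 R L N.
have dphi := Def2_feval c0 phi.
have [k [K [C [C0 hU]]]] := uniform_definition (@no_ladders_model _ c0) dphi e20.
pose ax (w : env N (vars dy)) (i : nat) : env N (vars xs) := fun s v => w s (slot_x ys s0 (pickle (j, i)) v).
pose ay (w : env N (vars dy)) (z : K) : env N (vars ys) :=
  fun s v => w s (slot_y xs s0 (pickle (j, nat_of_ord (enum_rank z))) v).
pose P (y : env N (vars ys)) w :=
  instance_value (fun x y => feval phi (env_cat x y)) k C (ax w) (ay w) y.
have id := @subst_id _ _ N (ctx_cat (vars ys) (vars dy)).
have dP : Def2 c0 P.
  have sx i : is_subst (fun e : env N (ctx_cat (vars ys) (vars dy)) => ax (esnd e) i).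
    exact: (subst_ren (fun s v => slot_x ys s0 (pickle (j, i)) v) (subst_snd id)).
  have sy z : is_subst (fun e : env N (ctx_cat (vars ys) (vars dy)) => ay (esnd e) z).
    exact: (subst_ren (fun s v => slot_y xs s0 (pickle (j, nat_of_ord (enum_rank z))) v) (subst_snd id)).
  have dinst i r : is_subst r -> Def c0 (fun e : env N (ctx_cat (vars ys) (vars dy)) =>
      feval phi (env_cat (ax (esnd e) i) (r e))) by move=> hr; exact: (Def2_subst dphi (sx i) hr).
  apply: Def_bigmax => z.
  apply: Def_ext (Def_lin 1 (- C) 0 (dinst k _ (sy z)) (Def_bigmax (iota 0 k) (fun i =>
    Def_absd (dinst i _ (subst_fst id)) (dinst i _ (sy z))))) => e.
  by congr clamp; rewrite mul1r addr0 mulNr.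
have [F0 hF0] := dP _ e20.
exists (fren (@ctx0_drop _) F0) => U UU; have [a [y_ h]] := hU U UU.
pose y' i := if insub i is Some o then y_ (enum_val (o : 'I_#|K|)) else env_elt N (vars ys).
exists a, y' => w wa wy y; rewrite feval_ren.
have := hF0 (env_cat y w); rewrite /P.
have -> : ax (esnd (env_cat y w)) = a by apply/funext => i; rewrite -wa.
have -> : ay (esnd (env_cat y w)) = y_.
  apply/funext => z; rewrite -[RHS]/(y_ z) -[z in RHS]enum_rankK.
  by rewrite -[LHS]/(ay w z) /ay wy /y' valK.
have -> : (fun s v => env_cat y w (ctx0_drop (V := ctx_cat (vars ys) (vars dy)) v)) =
          env_cat (env_cat y w) c0.
  by apply: functional_extensionality_dep => s; apply: functional_extensionality_dep => -[|[]].
have := h y; have -> : efst (env_cat y w) = y by [].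
set q := value U y; set r := instance_value _ _ _ _ _ _; set t := feval F0 _ => h1 h2.
by have := ler_distD r q t; lra.
Qed.

(** A forced limit: [sq j.+1] is [F j.+1] truncated to within 2^-j of [sq j], so that the sequence
    converges in every structure. At parameters that define an actual limit the truncation changes
    nothing, since the errors 2^-j / 2 and 2^-(j+1) / 2 add up to less than 2^-j. *)
Lemma uniform_defining_formulas : exists sq : nat -> formula R (ctx_cat (vars ys) (vars dy)),
  (forall (N' : structure L) (e : env N' _) j,
    `|feval (sq j) e - feval (sq j.+1) e| <= 2^-1 ^+ j) /\
  forall U, UltraFilter U -> exists b : tup N dy, forall y j,
    `|value U y - feval (sq j) (env_cat y (tuple_env b))| <= 2^-1 ^+ j.
Proof.
have pow0 j : 0 < 2^-1 ^+ j :> R by rewrite exprn_gt0// invr_gt0.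
have epos j : 0 < 2^-1 ^+ j / 2 :> R by rewrite divr_gt0.
have [F hF] := choice (fun j => level_formula j (epos j)).
pose sq := fix sq j := if j is j'.+1
  then fop2 (fop2_trunc_lip (ltW (pow0 j'))) (sq j') (F j'.+1) else F 0%N.
have sqS j : sq j.+1 = fop2 (fop2_trunc_lip (ltW (pow0 j))) (sq j) (F j.+1) by [].
exists sq; split=> [N' e j|U UU].
  rewrite sqS feval_op2; have := feval_range (sq j) e; have := feval_range (F j.+1) e.
  move: (feval _ e) (feval _ e) (2^-1 ^+ j) (pow0 j) => s t d d0 t1 s1.
  have h1 : Num.max (s - d) (Num.min (s + d) t) <= s + d.
    by rewrite ge_max ge_min lexx/= andbT; lra.
  have h2 : s - d <= Num.max (s - d) (Num.min (s + d) t) by rewrite le_max lexx.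
  move: (Num.max _ _) h1 h2 => u; case: (clampP u) => [[]|[[]|[]]]; rewrite ler_norml; lra.
have [a ha] := choice (fun j => hF j U UU); have [y_ hy_] := choice ha.
have [b [bx by_]] := slots_fill s0
  (fun t => if unpickle t is Some (j, i) then a (j : nat) (i : nat) else env_elt N (vars xs))
  (fun t => if unpickle t is Some (j, i) then y_ (j : nat) (i : nat) else env_elt N (vars ys)).
have hb j y : `|value U y - feval (F j) (env_cat y (tuple_env b))| <= 2^-1 ^+ j / 2.
  by apply: hy_ => i; [rewrite bx pickleK|rewrite by_ pickleK].
exists b => y; have E j : feval (sq j) (env_cat y (tuple_env b)) = feval (F j) (env_cat y (tuple_env b)).
  elim: j => // j IH; rewrite sqS feval_op2 IH.
  have := hb j y; have := hb j.+1 y; have := feval_range (F j.+1) (env_cat y (tuple_env b)).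
  have := pow0 j; rewrite exprS; set s := feval (F j) _; set t := feval (F j.+1) _.
  move: (2^-1 ^+ j) (value U y) => d q d0 t1; rewrite !ler_norml => h1 h2.
  by rewrite min_r ?max_r ?clamp_id//; lra.
by move=> j; rewrite E; apply: le_trans (hb j y) _; have := pow0 j; lra.
Qed.
End UniformDefiningFormulas.

(** * Canonical parameters *)

Section EqEmbedding.
Variables (R : realType) (L : signature R) (T : theory L).
Local Notation Leq := (eq_symbols T).

Definition emb_map (V : ctx L) (W : ctx Leq) := forall s, V s -> W (inl s).

Definition emb_ext (V : ctx L) (W : ctx Leq) (g : emb_map V W) s :
    emb_map (ctx_ext V s) (ctx_ext W (inl s)) :=
  fun s' v => match v with Old s1 v1 => Old (inl s : srt Leq) (g s1 v1) | New => New end.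

Fixpoint temb (V : ctx L) (W : ctx Leq) (g : emb_map V W) s (t : term V s) : term W (inl s) :=
  match t in term _ s return term W (inl s : srt Leq) with
  | Var s v => Var (g s v)
  | App f ts => @App Leq W f (fun i => temb g (ts i))
  end.

Fixpoint femb (V : ctx L) (W : ctx Leq) (g : emb_map V W) (phi : formula R V) : formula R W :=
  match phi with
  | Dist s t u => Dist (temb g t) (temb g u)
  | Rel r ts => @Rel R Leq W (inl r) (fun i => temb g (ts i))
  | Conn k u phis => Conn u (fun i => femb g (phis i))
  | Sup s psi => Sup (inl s : srt Leq) (femb (emb_ext g (s := s)) psi)
  | Inf s psi => Inf (inl s : srt Leq) (femb (emb_ext g (s := s)) psi)
  end.

Variable N : structure L.
Local Notation Neq := (eq_struct T N).

Definition real_env (V : ctx L) (W : ctx Leq) (g : emb_map V W) (e : env Neq W) : env N V :=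
  fun s v => e (inl s) (g s v).

Lemma teval_emb V W (g : emb_map V W) (e : env Neq W) s (t : term V s) :
  teval e (temb g t) = teval (real_env g e) t.
Proof.
elim: t => //= f ts IH; congr (fint N f _).
by apply: functional_extensionality_dep => i; exact: IH.
Qed.

Lemma real_env_ext V W (g : emb_map V W) (e : env Neq W) s (a : N s) :
  real_env (emb_ext g (s := s)) (env_ext (M := Neq) e (a : Neq (inl s))) = env_ext (real_env g e) a.
Proof.
apply: functional_extensionality_dep => s'.
by apply: functional_extensionality_dep; case.
Qed.

Lemma feval_emb V W (g : emb_map V W) (e : env Neq W) (phi : formula R V) :
  feval (femb g phi) e = feval phi (real_env g e).
Proof.
elim: phi W g e => {V} [V s t u|V r ts|V k u phis IH|V s psi IH|V s psi IH] W g e /=.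
- by rewrite !teval_emb.
- congr (rint N r _); apply: functional_extensionality_dep => i.
  exact: teval_emb.
- by congr (conn_fun u _); apply/rowP => i; rewrite !mxE IH.
- by congr sup; congr image; apply/funext => a; rewrite IH real_env_ext.
- by congr inf; congr image; apply/funext => a; rewrite IH real_env_ext.
Qed.

Lemma Def_emb G (c : env N G) G' (c' : env Neq G') (k : emb_map G G') V W (g : emb_map V W)
    (f : env N V -> R) :
  real_env k c' = c -> Def c f -> Def c' (fun e : env Neq W => f (real_env g e)).
Proof.
move=> <- df eps eps0; have [psi h] := df eps eps0.
exists (femb (fun s v => match v with inl x => inl (g s x) | inr y => inr (k s y) end) psi) => e.
rewrite feval_emb; apply: le_trans (h (real_env g e)); rewrite le_eqVlt; apply/orP; left.
apply/eqP; congr (`| _ - feval psi _|); apply: functional_extensionality_dep => s.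
by apply: functional_extensionality_dep => -[].
Qed.
End EqEmbedding.

Section FastLimits.
Variable R : realType.
Implicit Types (u : nat -> R) (l C : R).

Lemma fast_lim u l C : 0 <= C -> (forall j, `|l - u j| <= C * 2^-1 ^+ j) -> lim (u j @[j --> \oo]) = l.
Proof.
move=> C0 h; apply: cvg_lim => //; apply/cvgrPdist_le => eps eps0.
have h0 : geometric C (2^-1 : R) j @[j --> \oo] --> (0 : R).
  by apply: cvg_geometric; rewrite ger0_norm ?invr_ge0// invf_lt1//; lra.
move/cvgrPdist_le: h0 => /(_ eps eps0); apply: filterS => j /=.
rewrite sub0r normrN ger0_norm; last by rewrite mulr_ge0// exprn_ge0// invr_ge0.
by move=> hj; exact: le_trans (h j) hj.
Qed.

(** The intervals of radius 2 * 2^-j around [u j] are nested. *)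
Lemma fast_lim_dist u : (forall j, `|u j - u j.+1| <= 2^-1 ^+ j) ->
  forall j, `|lim (u j @[j --> \oo]) - u j| <= 2 * 2^-1 ^+ j.
Proof.
move=> hu; pose a j := u j + 2 * 2^-1 ^+ j; pose b j := u j - 2 * 2^-1 ^+ j.
have pow0 j : 0 < 2^-1 ^+ j :> R by rewrite exprn_gt0// invr_gt0.
have aS j : a j.+1 <= a j by have := hu j; rewrite /a exprS ler_norml; lra.
have bS j : b j <= b j.+1 by have := hu j; rewrite /b exprS ler_norml; lra.
have a_le j k : (j <= k)%N -> a k <= a j.
  by elim: k => [|k IH]; rewrite leq_eqVlt => /predU1P[->//|]//; rewrite ltnS => /IH; exact: le_trans.
have b_le j k : (j <= k)%N -> b j <= b k.
  elim: k => [|k IH]; rewrite leq_eqVlt => /predU1P[->//|]//; rewrite ltnS => /IH h.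
  exact: le_trans h (bS k).
have ba j k : b j <= a k.
  apply: le_trans (b_le _ _ (leq_maxl j k)) _; apply: le_trans _ (a_le _ _ (leq_maxr j k)).
  by rewrite /a /b; have := pow0 (maxn j k); lra.
pose l := sup (range b).
have lb j : b j <= l by apply: ub_le_sup; [exists (a 0%N) => _ [k _ <-]|exists j].
have la j : l <= a j by apply: ge_sup; [exists (b 0%N), 0%N|move=> _ [k _ <-]].
have hl j : `|l - u j| <= 2 * 2^-1 ^+ j.
  by have := lb j; have := la j; rewrite /a /b ler_norml; lra.
by rewrite (@fast_lim u l 2).
Qed.

Lemma small_pow2 (eps : R) : 0 < eps -> exists j, 2 * 2^-1 ^+ j <= eps.
Proof.
move=> eps0; have h2 : 1 < 2 :> R by lra.
have := @cvg_geometric R 2 2^-1; rewrite ger0_norm ?invr_ge0// invf_lt1//.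
move=> /(_ h2) /cvgrPdist_le /(_ eps eps0) /filter_ex [j].
rewrite /= sub0r normrN ger0_norm; last by rewrite mulr_ge0// exprn_ge0// invr_ge0.
by exists j.
Qed.
End FastLimits.

Lemma tuple_envK (R : realType) (S : symbols) (M : interp R S) (I : Type) (xs : I -> srt S)
    (e : env M (vars xs)) : tuple_env (fun i => e _ (VarOf xs i)) = e.
Proof.
by apply: functional_extensionality_dep => s; apply: functional_extensionality_dep => -[].
Qed.

Section EvaluationOfDefinablePredicates.
Variables (R : realType) (L : signature R) (T : theory L).
Variables (N : structure L) (N_model : models T N).

Lemma dp_eval_near (chi : defpred T) (a : tup N (dp_x chi)) b j :
  `|dp_eval a b - feval (dp_seq chi j) (env_cat (tuple_env a) (tuple_env b))| <= 2 * 2^-1 ^+ j.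
Proof.
apply: (@fast_lim_dist R (fun j => feval (dp_seq chi j) (env_cat (tuple_env a) (tuple_env b)))) => i.
exact: dp_fast.
Qed.

Variables (G : ctx L) (c : env N G).

Lemma Def2_dp_eval (chi : defpred T) : Def2 c (fun (x : env N (vars (dp_x chi))) (b : env N (vars (dp_y chi))) =>
  dp_eval (fun i => x _ (VarOf _ i)) (fun j => b _ (VarOf _ j))).
Proof.
apply: Def_lim => eps eps0; have [j hj] := small_pow2 eps0.
exists (fun e => feval (dp_seq chi j) (env_cat (efst e) (esnd e))); first exact: Def2_feval.
move=> e; apply: le_trans hj.
have := dp_eval_near (fun i => efst e (VarOf _ i)) (fun j => esnd e (VarOf (dp_y chi) j)) j.
by rewrite !tuple_envK.
Qed.
End EvaluationOfDefinablePredicates.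

Definition embctx (R : realType) (L : signature R) (T : theory L) (V : ctx L) : ctx (eq_symbols T) :=
  fun s => match s with inl s => V s | inr _ => void end.
Arguments embctx {R L} T V s.

Definition emb_id (R : realType) (L : signature R) (T : theory L) (V : ctx L) :
  emb_map V (embctx T V) := fun s v => v.
Arguments emb_id {R L} T V s _.

Lemma real_env_surj (R : realType) (L : signature R) (T : theory L) (N : structure L) (V : ctx L)
    (b : env N V) : exists e : env (eq_struct T N) (embctx T V), real_env (emb_id T V) e = b.
Proof.
by exists (fun s => match s return embctx T V s -> eq_struct T N s with
  | inl s => fun v => b s v | inr _ => fun v => match v with end end).
Qed.

(** * A compact definable set of canonical parameters *)

Section CanonicalBase.
Variables (R : realType) (L : signature R) (T : theory L).
Variables (N : structure L) (N_model : models T N) (A : params N).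
Variables (n m : nat) (xs : 'I_n -> srt L) (ys : 'I_m -> srt L) (s0 : srt L).
Variable phi : formula R (ctx_cat (vars xs) (vars ys)).
Variables (P : set_system (env N (vars xs))) (Z : set (set_system (env N (vars xs)))).
Hypotheses (gZ : good (Defs.incl A) P Z) (cZ : compactZ Z).
Local Notation dy := (slots xs ys s0).
Variable sq : nat -> formula R (ctx_cat (vars ys) (vars dy)).
Hypothesis sq_fast : forall (N' : structure L) (e : env N' _) j,
  `|feval (sq j) e - feval (sq j.+1) e| <= 2^-1 ^+ j.

Let f (x : env N (vars xs)) (y : env N (vars ys)) := feval phi (env_cat x y).
Let D U y := ulim U (f^~ y).

Hypothesis sq_def : forall U, UltraFilter U -> exists b : tup N dy, forall y j,
  `|D U y - feval (sq j) (env_cat y (tuple_env b))| <= 2^-1 ^+ j.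

Let chi : defpred T := @Defpred R L T m ys dy sq (fun N' _ e j => sq_fast e j).

Let chiv (y : env N (vars ys)) (b : env N (vars dy)) : R :=
  @dp_eval R L T N chi (fun i => y _ (VarOf ys i)) (fun j => b _ (VarOf dy j)).

Let df : Def2 (Defs.incl A) f := Def2_feval (Defs.incl A) phi.

Let uf y : unitf (f^~ y) := Def2_unitl y df.

Let uchi y b : 0 <= chiv y b <= 1 := dp_eval_range _ _.

Let uD U y : UltraFilter U -> 0 <= D U y <= 1.
Proof. by move=> UU; exact: ulim_range. Qed.

Lemma Def2_chiv : Def2 (Defs.incl A) chiv.
Proof. exact: (Def2_dp_eval N_model (Defs.incl A) chi). Qed.

Lemma chiv_value U : UltraFilter U -> exists b, forall y, chiv y b = D U y.
Proof.
move=> UU; have [b hb] := sq_def UU; exists (tuple_env b) => y.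
rewrite /chiv /dp_eval !tuple_envK; apply: (@fast_lim R _ _ 1) => // j.
by rewrite mul1r.
Qed.

Lemma canonical_parameter U : UltraFilter U ->
  exists z : imag N chi, forall a, sval z a = D U (tuple_env (a : tup N ys)).
Proof.
move=> UU; have [b hb] := chiv_value UU.
unshelve eexists (exist _ (fun a : tup N ys => D U (tuple_env a)) _) => //.
move=> eps eps0; exists (fun j => b _ (VarOf dy j)) => a.
have -> : dp_eval (chi := chi) a (fun j => b _ (VarOf dy j)) = chiv (tuple_env a) b by [].
by rewrite hb subrr normr0 ltW.
Qed.

(** The canonical parameters of the limits along all members of Z. They play the role of the set of
    conjugates over A of any one of them. *)
Let C : set (imag N chi) := [set z | exists2 U, Z U & forall a, sval z a = D U (tuple_env (a : tup N ys))].

(** Compactness of Z yields pointwise limits of the functions [D U]; the finite nets of [good_net]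
    make the convergence uniform in y, which is convergence in the metric of [imag]. *)
Lemma canonical_parameters_compact : compact C.
Proof.
rewrite compact_ultra => F UF FC.
have [V hV] : {V : imag N chi -> set_system (env N (vars xs)) & forall z, C z ->
    Z (V z) /\ forall a, sval z a = D (V z) (tuple_env (a : tup N ys))}.
  apply: (@choice _ _ (fun z V => C z -> Z V /\ forall a, sval z a = D V (tuple_env (a : tup N ys)))).
  move=> z; have [[U ZU hU]|nC] := pselect (C z); first by exists U.
  by exists setT => /nC.
have [U ZU hU] : exists2 U, Z U & forall Q, F [set z | V z Q] -> U Q.
  have [||Q FQ|U ZU hU] := cZ (B := [set Q | F [set z | V z Q]]); last by exists U.
  - exists setT; apply: filterS FC => z /hV [ZV _]; have := good_ultra gZ ZV => ?; exact: filterT.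
  - move=> Q Q' FQ FQ'; exists (Q `&` Q') => //; apply: filterS3 FC FQ FQ' => z /hV [ZV _] /= hQ hQ'.
    have := good_ultra gZ ZV => ?; exact: filterI.
  - by have [z [/hV [ZV _] hz]] := filter_ex (filterI FC FQ); exists (V z).
have UU := good_ultra gZ ZU; have [zU hzU] := canonical_parameter UU.
exists zU; split; first by exists U.
have lim_F y eps : 0 < eps -> F [set z | `|D (V z) y - D U y| <= eps].
  move=> eps0; have e20 : 0 < eps / 2 by lra.
  have [//|h] := in_ultra_setVsetC [set z | `|D (V z) y - D U y| <= eps] UF.
  have : U [set x | eps < `|f x y - D U y| + eps / 2].
    apply: hU; apply: filterS2 FC h => z /hV [ZV _] /negP; rewrite -ltNge => h.
    have UV := good_ultra gZ ZV; apply: filterS (ulim_near UV (uf y) e20) => x /=.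
    have := ler_distD (f x y) (D (V z) y) (D U y); rewrite (distrC (D (V z) y) (f x y)); rewrite /D; lra.
  move=> h'; have [x /= [h1 h2]] := filter_ex (filterI h' (ulim_near UU (uf y) e20)).
  by exfalso; move: h1 h2; rewrite /D; lra.
apply/cvg_ballP => eps eps0; have e40 : 0 < eps / 4 by lra.
have [Us [hUs hnet]] := good_net gZ df e40.
have : F [set z | exists2 U', List.In U' Us & C z /\ forall y, `|D (V z) y - D U' y| <= eps / 4].
  by apply: filterS FC => z Cz; have [ZV _] := hV z Cz; have [U' U'l h] := hnet _ ZV; exists U'.
move=> /(ultra_list UF (Q := fun U' => [set z | C z /\ forall y, `|D (V z) y - D U' y| <= eps / 4])).
move=> [U' U'l hU'].
have hUU' y : `|D U y - D U' y| <= eps / 2.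
  have [z [/= h1 [_ h2]]] := filter_ex (filterI (lim_F y (eps / 4) e40) hU').
  by have := ler_distD (D (V z) y) (D U y) (D U' y); have := h2 y; rewrite (distrC (D U y) (D (V z) y)); lra.
apply: filterS hU' => z [Cz hz]; have [ZV zV] := hV z Cz; rewrite /= ballEmdist /=.
have h : imag_dist zU z <= eps / 2 + eps / 4.
  apply: imag_dist_le => a; rewrite hzU zV.
  have := ler_distD (D U' (tuple_env (a : tup N ys))) (D U (tuple_env (a : tup N ys))) (D (V z) (tuple_env (a : tup N ys))).
  by have := hz (tuple_env (a : tup N ys)); have := hUU' (tuple_env (a : tup N ys)); rewrite (distrC (D (V z) _) (D U' _)); lra.
by apply: le_lt_trans h _; lra.
Qed.

Let gap b U := supT (fun y => `|chiv y b - D U y|).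

Let uabs (s t : R) : 0 <= s <= 1 -> 0 <= t <= 1 -> 0 <= `|s - t| <= 1.
Proof. by move=> s01 t01; rewrite normr_ge0 ler_norml; lra. Qed.

Let ugap b U : UltraFilter U -> unitf (fun y => `|chiv y b - D U y|).
Proof. by move=> UU y; apply: uabs; [exact: uchi|exact: uD]. Qed.

Let rho b := inf [set gap b U | U in Z].

Lemma rho_le b U : Z U -> rho b <= gap b U.
Proof.
move=> ZU; apply: ge_inf; last by exists U.
exists 0 => _ [V ZV <-]; have UV := good_ultra gZ ZV.
by have /andP[] := supT_range (env_elt N (vars ys)) (ugap b UV).
Qed.

Lemma rho_near b eps : 0 < eps -> exists2 U, Z U & gap b U < rho b + eps.
Proof.
move=> eps0; have [U0 ZU0] := good_ne gZ.
have hi : has_inf [set gap b U | U in Z].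
  split; first by exists (gap b U0), U0.
  exists 0 => _ [V ZV <-]; have UV := good_ultra gZ ZV.
  by have /andP[] := supT_range (env_elt N (vars ys)) (ugap b UV).
by have [_ [U ZU <-] h] := inf_adherent eps0 hi; exists U.
Qed.

(* By good_net the supremum over y in gap may be tested on a bounded number of
   points at once, after which the infimum over Z is taken by good_def. *)
Lemma Def_rho : Def (Defs.incl A) rho.
Proof.
apply: Def_lim => eps eps0; have e40 : 0 < eps / 4 by lra.
have [Us [hUs hnet]] := good_net gZ df e40.
pose d i (w : env N param) : env N (vars ys) := gett ys (slice i w).
pose gaps x b w := \big[Num.max/0]_(i <- iota 0 (size Us)) `|chiv (d i w) b - f x (d i w)|.
pose F (x : env N (vars xs)) (bw : env N (ctx_cat (vars dy) param)) := 1 - gaps x (efst bw) (esnd bw).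
have dF : Def2 (Defs.incl A) F.
  have id := @subst_id _ _ N (ctx_cat (vars xs) (ctx_cat (vars dy) param)).
  have sd i : is_subst (fun e : env N (ctx_cat (vars xs) (ctx_cat (vars dy) param)) => d i (esnd (esnd e))).
    exact: (subst_gett ys (subst_slice i (subst_snd (subst_snd id)))).
  apply: Def_neg; apply: Def_bigmax => i.
  exact: (Def_absd (Def2_subst Def2_chiv (sd i) (subst_fst (subst_snd id)))
                   (Def2_subst df (subst_fst id) (sd i))).
exists (fun b => supT (fun w : env N param => 1 - supZ Z (F^~ (env_cat b w)))).
  apply: Def_sup; apply: Def_neg; apply: Def_ext (good_def gZ dF) => e.
  by rewrite env_catK.
move=> b; have w0 := env_elt N (@param L).
have uF bw : unitf (F^~ bw) := Def2_unitl bw dF.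
have uQ : unitf (fun w : env N param => 1 - supZ Z (F^~ (env_cat b w))).
  by move=> w; have := supZ_range (good_ultra gZ) (good_ne gZ) (uF (env_cat b w)); lra.
set Q := supT _.
have FE x w : F x (env_cat b w) = 1 - gaps x b w by [].
rewrite ler_norml; apply/andP; split.
  rewrite lerBrDl; rewrite -lerBrDr; apply: supT_le => // w.
  have [U ZU hU] := rho_near b e40; have UU := good_ultra gZ ZU.
  have := supZ_ge (good_ultra gZ) ZU (uF (env_cat b w)).
  have : U [set x | forall i : 'I_(size Us), `|f x (d i w) - D U (d i w)| < eps / 4].
    by apply: filter_forall => i; exact: ulim_near.
  move=> hx; have : 1 - gap b U - eps / 4 <= ulim U (F^~ (env_cat b w)).
    apply: ulim_ge_cst => //; apply: filterS hx => x hx /=.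
    suff : gaps x b w <= gap b U + eps / 4 by rewrite FE; lra.
    apply: bmax_le.
      by have /andP[g0 _] := supT_range (env_elt N (vars ys)) (ugap b UU); rewrite addr_ge0// ltW.
    move=> i; rewrite mem_iota => /andP[_ il].
    have := hx (Ordinal il); have := supT_ge (d i w) (ugap b UU).
    have := ler_distD (D U (d i w)) (chiv (d i w) b) (f x (d i w)).
    rewrite (distrC (D U _) (f x _)) /= -/(gap b U); lra.
  lra.
have [y_ hy_] : {y_ : nat -> env N (vars ys) & forall i, (i < size Us)%N ->
    gap b (nth setT Us i) - eps / 4 < `|chiv (y_ i) b - D (nth setT Us i) (y_ i)|}.
  apply: (@choice _ _ (fun i y => (i < size Us)%N ->
    gap b (nth setT Us i) - eps / 4 < `|chiv y b - D (nth setT Us i) y|)) => i.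
  have [il|_] := boolP (i < size Us)%N; last by exists (env_elt N (vars ys)).
  have UU := good_ultra gZ (hUs _ (nth_In setT il)).
  by have [y hy] := supT_near (env_elt N (vars ys)) (ugap b UU) e40; exists y.
have [ws hws] := choice (fun i => gett_surj (y_ i)).
pose w := unslice ws; have dw i : d i w = y_ i by rewrite /d sliceK.
have : supZ Z (F^~ (env_cat b w)) <= 1 - (rho b - eps).
  apply: supZ_le (good_ne gZ) _ => U ZU; have UU := good_ultra gZ ZU.
  have [U' U'l hU'] := hnet U ZU; have [i il iU'] := In_nth setT U'l.
  apply: ulim_le_cst => //; apply: filterS (ulim_near UU (uf (y_ i)) e40) => x /=.
  rewrite FE => hx; suff : `|chiv (y_ i) b - f x (y_ i)| <= gaps x b w.
    have := hy_ i il; rewrite iU'; have := rho_le b (hUs _ U'l); have := hU' (y_ i).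
    rewrite -/(D U _) -/(D U' _) in hx *.
    have := ler_distD (f x (y_ i)) (chiv (y_ i) b) (D U' (y_ i)).
    have := ler_distD (D U (y_ i)) (f x (y_ i)) (D U' (y_ i)); lra.
  rewrite -dw; apply: (bmax_ge (fun i => `|chiv (d i w) b - f x (d i w)|)).
  by rewrite mem_iota.
have := supT_ge w uQ; rewrite -/Q; lra.
Qed.

Local Notation Leq := (eq_symbols T).
Local Notation Neq := (eq_struct T N).
Local Notation Aeq := (Defs.incl (@eq_params R L T N A)).

Definition eq_const : emb_map (pctx A) (pctx (@eq_params R L T N A)) := fun s v => v.

Lemma Def_real V (W : ctx Leq) (g : emb_map V W) (h : env N V -> R) :
  Def (Defs.incl A) h -> Def Aeq (fun e : env Neq W => h (real_env g e)).
Proof. exact: (@Def_emb R L T N _ _ _ Aeq eq_const). Qed.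

Let Rv (z : imag N chi) (y : env N (vars ys)) := sval z (fun i => y _ (VarOf ys i)).

Lemma Def_apply (W : ctx Leq) (v : W (inr chi)) (g : emb_map (vars ys) W) :
  Def Aeq (fun e : env Neq W => Rv (e (inr chi) v) (real_env g e)).
Proof.
apply: Def_ext (Def_feval Aeq (@Rel R Leq W (inr chi) (fun i : option 'I_m =>
  match i return term W (eq_dom (r := inr chi : rsym Leq) i) with
  | None => @Var Leq W (inr chi) v
  | Some i => @Var Leq W (inl (ys i)) (g _ (VarOf ys i))
  end))) => e.
by [].
Qed.

(** The distance from z to C is the infimum over b of rho(b) plus the distance from z to chi(-, b):
    one inequality is the triangle inequality, the other takes b defining a member of C. This
    reduces the claim to [rho], a predicate of real tuples. *)
Lemma canonical_parameters_definable : definable (@eq_params R L T N A)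
  (fun a : tup Neq (fun _ : 'I_1 => inr chi) => inf [set mdist (a ord0) c | c in C]).
Proof.
pose W0 : ctx Leq := vars (fun _ : 'I_1 => inr chi : srt Leq).
pose v0 : W0 (inr chi) := VarOf (fun _ : 'I_1 => inr chi : srt Leq) ord0.
pose rb (e : env Neq (embctx T (vars dy))) := real_env (emb_id T (vars dy)) e.
pose ry (e : env Neq (embctx T (vars ys))) := real_env (emb_id T (vars ys)) e.
pose near (z : imag N chi) b := supT (fun y => `|Rv z (ry y) - chiv (ry y) (rb b)|).
pose Delta (z : imag N chi) := infT (fun b => clamp (1 * rho (rb b) + 1 * near z b + 0)).
have dDelta : Def Aeq (fun e : env Neq W0 => Delta (e (inr chi) v0)).
  apply: Def_inf; apply: Def_lin.
    exact: (Def_real (fun s v => inr v : ctx_cat W0 (embctx T (vars dy)) (inl s)) Def_rho).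
  apply: Def_sup; apply: Def_absd.
    exact: (@Def_apply (ctx_cat (ctx_cat W0 (embctx T (vars dy))) (embctx T (vars ys)))
      (inl (inl v0)) (fun s v => inr v)).
  exact: (Def_real (fun s (v : ctx_cat (vars ys) (vars dy) s) => match v with
    | inl y => inr y | inr b => inl (inr b) end
    : ctx_cat (ctx_cat W0 (embctx T (vars dy))) (embctx T (vars ys)) (inl s)) Def2_chiv).
have unear z b : unitf (fun y => `|Rv z (ry y) - chiv (ry y) (rb b)|).
  by move=> y; apply: uabs; [exact: imag_range|exact: uchi].
have y0 := env_elt Neq (embctx T (vars ys)).
have near01 z b : 0 <= near z b <= 1 := supT_range y0 (unear z b).
have ge_near z b y : `|Rv z y - chiv y (rb b)| <= near z b.
  by have [y' <-] := real_env_surj T y; exact: (supT_ge y' (unear z b)).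
have DE z : inf [set mdist z c | c in C] = Delta z.
  have lbC : lbound [set mdist z c | c in C] 0 by move=> _ [c _ <-]; exact: mdist_ge0.
  have [U0 ZU0] := good_ne gZ; have [z0 hz0] := canonical_parameter (good_ultra gZ ZU0).
  have C0 : C z0 by exists U0.
  have uclamp (g : env Neq (embctx T (vars dy)) -> R) : unitf (fun b => clamp (g b)).
    by move=> b; exact: clamp_range.
  apply/eqP; rewrite eq_le; apply/andP; split.
    apply: (infT_ge (env_elt Neq (embctx T (vars dy)))) => b.
    have le1 : inf [set mdist z c | c in C] <= 1.
      apply: le_trans (mdist_le1 (z : Neq (inr chi)) z0).
      by apply: ge_inf; [exists 0|exists z0].
    apply: clamp_ge => //; apply/ler_addgt0Pr => eps eps0.
    have [U ZU hU] := rho_near (rb b) eps0; have UU := good_ultra gZ ZU.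
    have [c hc] := canonical_parameter UU.
    have : mdist z c <= near z b + gap (rb b) U.
      apply: imag_dist_le => a; rewrite hc.
      have := ge_near z b (tuple_env (a : tup N ys)).
      have := supT_ge (tuple_env (a : tup N ys)) (ugap (rb b) UU); rewrite -/(gap (rb b) U).
      have := ler_distD (chiv (tuple_env (a : tup N ys)) (rb b)) (sval z a) (D U (tuple_env (a : tup N ys))).
      have -> : Rv z (tuple_env (a : tup N ys)) = sval z a by [].
      lra.
    have : inf [set mdist z c | c in C] <= mdist z c.
      by apply: ge_inf; [exists 0|exists c => //; exists U].
    lra.
  apply: lb_le_inf; first by exists (mdist z z0), z0.
  move=> _ [c [U ZU hc] <-]; have UU := good_ultra gZ ZU.
  have [b0 hb0] := chiv_value UU; have [b hb] := real_env_surj T b0.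
  apply: le_trans (infT_le b (uclamp _)) _; apply: clamp_le; first exact: mdist_ge0.
  have h1 : rho (rb b) <= 0.
    apply: le_trans (rho_le _ ZU) _; apply: (supT_le (env_elt N (vars ys))) => y.
    by rewrite /rb hb hb0 subrr normr0.
  suff : near z b <= mdist z c by lra.
  apply: (supT_le y0) => y; rewrite /rb hb hb0.
  have := imag_dist_ge z c (fun i => ry y _ (VarOf ys i)).
  by rewrite hc tuple_envK.
move=> eps eps0; have [psi hpsi] := dDelta eps eps0; exists psi => a.
by rewrite DE; exact: (hpsi (tuple_env a)).
Qed.

Lemma canonical_definition U : Z U ->
  definable (M := Neq) (acl_eq T A) (xs := fun j => inl (ys j) : srt Leq)
    (fun y => D U (tuple_env (y : tup N ys))).
Proof.
move=> ZU eps eps0; have [z hz] := canonical_parameter (good_ultra gZ ZU).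
have zacl : acl_eq T A (inr chi : srt Leq) z.
  exists C; split; first by exists U.
  - exact: canonical_parameters_compact.
  - exact: canonical_parameters_definable.
pose W := ctx_cat (vars (fun j => inl (ys j) : srt Leq)) (pctx (acl_eq T A)).
exists (@Rel R Leq W (inr chi) (fun i : option 'I_m =>
  match i return term W (eq_dom (r := inr chi : rsym Leq) i) with
  | None => @Var Leq W (inr chi) (inr (exist _ (z : Neq (inr chi)) zacl))
  | Some i => @Var Leq W (inl (ys i)) (inl (VarOf (fun j => inl (ys j) : srt Leq) i))
  end)) => y /=.
by rewrite hz subrr normr0 ltW.
Qed.
End CanonicalBase.

Lemma nonforking_definable (R : realType) (L : signature R) (T : theory L) (T_stable : stable T)
    (N : structure L) (N_model : models T N) (A : params N) n m (xs : 'I_n -> srt L)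
    (ys : 'I_m -> srt L) (phi : formula R (ctx_cat (vars xs) (vars ys)))
    (P : set_system (env N (vars xs))) (Z : set (set_system (env N (vars xs)))) U :
  good (Defs.incl A) P Z -> compactZ Z -> Z U ->
  definable (M := eq_struct T N) (acl_eq T A) (xs := fun j => inl (ys j) : srt (eq_symbols T))
    (fun y => ulim U (fun x => feval phi (env_cat x (tuple_env (y : tup N ys))))).
Proof.
(* If ys is empty, there may be no sort for the unused parameters of the defining
   formulas, but the definition is then a constant. *)
move=> gZ cZ ZU; case: m ys phi => [|m] ys phi; last first.
  have [sq [sq_fast sq_def]] := uniform_defining_formulas T_stable N_model (ys ord0) phi.
  exact: (canonical_definition N_model gZ cZ sq_fast sq_def ZU).
have UU := good_ultra gZ ZU.
move=> eps eps0; pose y0 : tup N ys := fun i => match notF (ltn_ord i) with end.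
exists (fcst _ (ulim U (fun x => feval phi (env_cat x (tuple_env y0))))) => y.
have -> : y = y0 by apply: functional_extensionality_dep => -[].
have r01 := ulim_range UU (fun x => feval_range phi (env_cat x (tuple_env y0))).
by rewrite feval_cst// subrr normr0 ltW.
Qed.

(** * Elimination of imaginary variables *)

Section TermSubstitution.
Variables (R : realType) (S : symbols).

(** The arguments of the predicate of [chi] may be terms, while the formulas [dp_seq chi j] have
    variables in their places; hence terms have to be substituted. *)
Definition tsubst (V W : ctx S) := forall s, V s -> term W s.

Definition tsubst_ext (V W : ctx S) (g : tsubst V W) s : tsubst (ctx_ext V s) (ctx_ext W s) :=
  fun s' v => match v with
              | Old s1 v1 => tren (fun s2 v2 => Old s v2) (g s1 v1)
              | New => Var New
              end.

Fixpoint tsub (V W : ctx S) (g : tsubst V W) s (t : term V s) : term W s :=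
  match t in term _ s return term W s with
  | Var s v => g s v
  | App f ts => App f (fun i => tsub g (ts i))
  end.

Fixpoint fsub (V W : ctx S) (g : tsubst V W) (phi : formula R V) : formula R W :=
  match phi with
  | Dist s t u => Dist (tsub g t) (tsub g u)
  | Rel r ts => Rel r (fun i => tsub g (ts i))
  | Conn k u phis => Conn u (fun i => fsub g (phis i))
  | Sup s psi => Sup s (fsub (tsubst_ext g (s := s)) psi)
  | Inf s psi => Inf s (fsub (tsubst_ext g (s := s)) psi)
  end.

Variable M : interp R S.

Definition sub_env V W (g : tsubst V W) (e : env M W) : env M V := fun s v => teval e (g s v).

Lemma teval_sub V W (g : tsubst V W) (e : env M W) s (t : term V s) :
  teval e (tsub g t) = teval (sub_env g e) t.
Proof.
elim: t => //= f ts IH; congr (fint M f _).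
by apply: functional_extensionality_dep => i; exact: IH.
Qed.

Lemma sub_env_ext V W (g : tsubst V W) (e : env M W) s (a : M s) :
  sub_env (tsubst_ext g (s := s)) (env_ext e a) = env_ext (sub_env g e) a.
Proof.
apply: functional_extensionality_dep => s'.
by apply: functional_extensionality_dep => -[s1 v1|] //=; rewrite /sub_env /= teval_ren.
Qed.

Lemma feval_sub V W (g : tsubst V W) (e : env M W) (phi : formula R V) :
  feval (fsub g phi) e = feval phi (sub_env g e).
Proof.
elim: phi W g e => {V} [V s t u|V r ts|V k u phis IH|V s psi IH|V s psi IH] W g e /=.
- by rewrite !teval_sub.
- congr (rint M r _); apply: functional_extensionality_dep => i.
  exact: teval_sub.
- by congr (conn_fun u _); apply/rowP => i; rewrite !mxE IH.
- by congr sup; congr image; apply/funext => a; rewrite IH sub_env_ext.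
- by congr inf; congr image; apply/funext => a; rewrite IH sub_env_ext.
Qed.
End TermSubstitution.

Section Elimination.
Variables (R : realType) (L : signature R) (T : theory L).
Variables (N : structure L) (N_model : models T N).
Local Notation Leq := (eq_symbols T).
Local Notation Neq := (eq_struct T N).

(* A variable of sort chi is replaced by the countably many variables Y of
   chi(x, Y). *)
Inductive real_ctx (V : ctx Leq) : srt L -> Type :=
| RReal s : V (inl s) -> real_ctx V s
| RImag chi : V (inr chi) -> forall j, real_ctx V (dp_y chi j).

Lemma dp_imag_proof (chi : defpred T) (b : tup N (dp_y chi)) (eps : R) : 0 < eps ->
  exists b', forall a, `|dp_eval a b - dp_eval a b'| <= eps.
Proof. by move=> eps0; exists b => a; rewrite subrr normr0 ltW. Qed.

Definition dp_imag (chi : defpred T) (b : tup N (dp_y chi)) : imag N chi :=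
  exist _ (fun a => dp_eval a b) (dp_imag_proof b).

Definition eq_env (V : ctx Leq) (b : env N (real_ctx V)) : env Neq V :=
  fun s => match s return V s -> Neq s with
           | inl s => fun v => b s (RReal v)
           | inr chi => fun v => dp_imag (fun j => b _ (RImag v j))
           end.

(** The elements chi(-, b) are dense in the sort of [chi] by the definition of [imag]. By uniform
    continuity this suffices for quantifiers over imaginary sorts. *)
Lemma eq_env_dense V (e : env Neq V) (eps : R) : 0 < eps ->
  exists b : env N (real_ctx V), forall s v, mdist (e s v) (eq_env b v) <= eps.
Proof.
move=> eps0.
pose par chi (v : V (inr chi)) := projT1 (cid (svalP (e (inr chi) v : imag N chi) eps eps0)).
have parP chi (v : V (inr chi)) a : `|sval (e (inr chi) v : imag N chi) a - dp_eval a (par chi v)| <= eps.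
  by rewrite /par; case: cid.
exists (fun s u => match u in real_ctx _ s return N s with
  | RReal s v => e (inl s) v | RImag chi v j => par chi v j end) => -[s|chi] v.
  by rewrite mdistxx ltW.
by apply: imag_dist_le => a; exact: parP.
Qed.

(** In the case of [chi], an imaginary is within eps/8 of some chi(-, b), and this is close to
    [dp_seq chi j] for a fixed j, whose modulus of continuity is uniform in b. *)
Lemma eq_struct_uc : unif_cont Neq.
Proof.
have [ucf ucr] := structure_uc N; split=> [f eps eps0|[r|chi] eps eps0]; first exact: (ucf f eps eps0).
  exact: (ucr r eps eps0).
have e80 : 0 < eps / 8 by lra.
have [j hj] := small_pow2 e80.
have [d d0 hd] := feval_uc (structure_uc N) (dp_seq chi j) e80.
exists (Num.min d (eps / 8)); first by rewrite lt_min d0.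
move=> a a' haa'; pose x i := a (Some i) : N (dp_x chi i); pose x' i := a' (Some i) : N (dp_x chi i).
rewrite -[rint Neq _ a]/(sval (a None : imag N chi) x) -[rint Neq _ a']/(sval (a' None : imag N chi) x').
have h1 : `|sval (a None : imag N chi) x - sval (a' None : imag N chi) x| <= eps / 8.
  apply: le_trans (imag_dist_ge _ _ _) _; have /ltW := haa' None.
  by move=> h; apply: le_trans h _; rewrite ge_min lexx orbT.
have [b hb] := svalP (a' None : imag N chi) _ e80.
have h2 := hb x; have h3 := hb x'.
have h4 := dp_eval_near N_model x b j; have h5 := dp_eval_near N_model x' b j.
have h6 : `|feval (dp_seq chi j) (env_cat (tuple_env x) (tuple_env b)) -
  feval (dp_seq chi j) (env_cat (tuple_env x') (tuple_env b))| <= eps / 8.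
  apply: hd => s -[[i]|v] /=; last by rewrite mdistxx.
  by have := haa' (Some i); rewrite lt_min => /andP[].
move: h1 h2 h3 h4 h5 h6 hj.
set z := sval _ x; set z1 := sval _ x; set z2 := sval _ x'.
set p1 := dp_eval x b; set p2 := dp_eval x' b; set f1 := feval _ _; set f2 := feval _ _.
move: (2 * _) => q; rewrite !ler_norml; lra.
Qed.

(** All function symbols take values in real sorts, so a term of an imaginary sort is a variable;
    this is why the type of the result depends on the sort. *)
Fixpoint telim (V : ctx Leq) s (t : term V s) :
    match s with inl s => term (real_ctx V) s | inr chi => V (inr chi) end :=
  match t in term _ s
    return match s with inl s => term (real_ctx V) s | inr chi => V (inr chi) end with
  | Var s v => match s return V s ->
      match s with inl s => term (real_ctx V) s | inr chi => V (inr chi) end with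
      | inl s => fun v => Var (RReal v)
      | inr chi => fun v => v
      end v
  | App f ts => @App L (real_ctx V) f (fun i => @telim V (@fdom Leq f i) (ts i))
  end.

Lemma telimP V (b : env N (real_ctx V)) s (t : term V s) :
  match s return term V s -> Prop with
  | inl s => fun t => teval (eq_env b) t = teval b (telim t)
  | inr chi => fun t => t = Var (telim t)
  end t.
Proof.
elim: t => [[s1|chi] v|f ts IH] //=; congr (fint N f _).
by apply: functional_extensionality_dep => i; exact: (IH i).
Qed.

Definition ext_split (V : ctx Leq) s s' (v : ctx_ext V s s') : V s' + unit :=
  match v in ctx_ext _ _ s' return (V s' + unit)%type with Old s1 v => inl v | New => inr tt end.

(** Under a quantifier a whole environment for the extended context is quantified, but only its part
    for the new variable is read. This covers real and imaginary sorts alike. *)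
Definition real_ext (V : ctx Leq) s :
    ctx_map (real_ctx (ctx_ext V s)) (ctx_cat (real_ctx V) (real_ctx (ctx_ext V s))) :=
  fun s0 u => match u in real_ctx _ s0
      return ctx_cat (real_ctx V) (real_ctx (ctx_ext V s)) s0 with
    | RReal s' v => match ext_split v with inl v' => inl (RReal v') | inr _ => inr (RReal v) end
    | RImag chi v j => match ext_split v with inl v' => inl (RImag v' j) | inr _ => inr (RImag v j) end
    end.

Lemma eq_env_ext V s (b : env N (real_ctx V)) (w : env N (real_ctx (ctx_ext V s))) :
  eq_env (fun s0 u => env_cat b w (real_ext u)) = env_ext (eq_env b) (eq_env w New).
Proof.
apply: functional_extensionality_dep => s'; apply: functional_extensionality_dep => v.
by case: v => [[s1|chi] v1|] //; case: s w => [s1|chi] w.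
Qed.

Variables (G : ctx L) (c : env N G).

Definition imag_vars (V : ctx Leq) chi (v : V (inr chi)) : ctx_map (vars (dp_y chi)) (real_ctx V) :=
  fun s u => match u with VarOf j => RImag v j end.

Lemma Def_imag_dist V chi (v1 v2 : V (inr chi)) :
  Def c (fun b : env N (real_ctx V) => imag_dist (eq_env b v1) (eq_env b v2)).
Proof.
have id := @subst_id _ _ N (ctx_cat (real_ctx V) (vars (dp_x chi))).
pose val (b : env N (real_ctx V)) v (x : env N (vars (dp_x chi))) : R :=
  dp_eval (fun i => x _ (VarOf _ i)) (fun j => b _ (RImag v j)).
have dval v : Def2 c (val^~ v).
  exact: (Def2_subst (Def2_dp_eval N_model c chi) (subst_snd id) (subst_ren (imag_vars v) (subst_fst id))).
have dabs : Def2 c (fun b x => `|val b v1 x - val b v2 x|) := Def_absd (dval v1) (dval v2).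
apply: Def_ext (Def_sup dabs) => b; apply/eqP; rewrite eq_le; apply/andP; split.
  apply: (supT_le (env_elt N _)) => x.
  exact: (imag_dist_ge (eq_env b v1 : imag N chi) (eq_env b v2) (fun i => x _ (VarOf _ i))).
apply: imag_dist_le => a.
exact: (supT_ge (tuple_env a) (Def2_unit b dabs)).
Qed.

Lemma Def_dp_eval_terms V chi (ts : forall i, term (real_ctx V) (dp_x chi i)) (v : V (inr chi)) :
  Def c (fun b : env N (real_ctx V) => dp_eval (fun i => teval b (ts i)) (fun j => b _ (RImag v j))).
Proof.
apply: Def_lim => eps eps0; have [j hj] := small_pow2 eps0.
pose g : tsubst (ctx_cat (vars (dp_x chi)) (vars (dp_y chi))) (real_ctx V) := fun s u =>
  match u with
  | inl x => match x in vars _ s return term (real_ctx V) s with VarOf i => ts i end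
  | inr y => Var (imag_vars v y)
  end.
exists (feval (fsub g (dp_seq chi j))); first exact: Def_feval.
move=> b; apply: le_trans hj; rewrite feval_sub.
have -> : sub_env g b = env_cat (tuple_env (fun i => teval b (ts i))) (tuple_env (fun j => b _ (RImag v j))).
  apply: functional_extensionality_dep => s.
  by apply: functional_extensionality_dep => -[[i]|[k]].
exact: dp_eval_near.
Qed.

(** A quantifier over an imaginary becomes one over its real parameters, with the same value by
    density and uniform continuity. The result is a uniform limit of formulas, as [dp_eval] already
    is. *)
Lemma Def_elim V (psi : formula R V) : Def c (fun b : env N (real_ctx V) => feval psi (eq_env b)).
Proof.
have dense V' s (psi' : formula R (ctx_ext V' s)) (b : env N (real_ctx V')) (a : Neq s) (eps : R) : 0 < eps ->
    exists w, `|feval psi' (env_ext (eq_env b) a) -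
                feval psi' (eq_env (fun s0 u => env_cat b w (real_ext u)))| <= eps.
  move=> eps0; have [d d0 hd] := feval_uc eq_struct_uc psi' eps0; have d20 : 0 < d / 2 by lra.
  have [w hw] := eq_env_dense (env_ext (eq_env b) a) d20.
  exists w; rewrite eq_env_ext; apply: hd; apply: env_ext_near => [|s' v].
    by apply: le_lt_trans (hw s New) _; lra.
  by rewrite mdistxx.
elim: psi => {V} [V s t u|V r ts|V k u phis IH|V s psi IH|V s psi IH].
- case: s t u => [s|chi] t u.
    apply: Def_ext (Def_feval c (Dist (telim t) (telim u))) => b /=.
    by have := telimP b t; have := telimP b u; move=> /= -> ->.
  rewrite (telimP (env_elt N _) t) (telimP (env_elt N _) u).
  exact: Def_imag_dist.
- case: r ts => [r|chi] ts.
    apply: Def_ext (Def_feval c (@Rel R L _ r (fun i => telim (ts i)))) => b /=.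
    by congr (rint N r _); apply: functional_extensionality_dep => i; rewrite -(telimP b (ts i)).
  apply: Def_ext (Def_dp_eval_terms (fun i => telim (ts (Some i))) (telim (ts None))) => b /=.
  have -> : teval (eq_env b) (ts None) = eq_env b (telim (ts None)).
    by rewrite [ts None](telimP (env_elt N _) (ts None)).
  congr dp_eval; apply: functional_extensionality_dep => i.
  by rewrite -(telimP b (ts (Some i))).
- by apply: Def_ext (Def_conn u IH) => b /=.
- have dP : Def2 c (fun b w => feval psi (eq_env (fun s0 u => env_cat b w (real_ext u)))).
    have id := @subst_id _ _ N (ctx_cat (real_ctx V) (real_ctx (ctx_ext V s))).
    apply: Def_subst IH; have := subst_ren (@real_ext V s) (subst_cat (subst_fst id) (subst_snd id)).
    exact.
  apply: Def_ext (Def_sup dP) => b /=.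
  have ua : unitf (fun a : Neq s => feval psi (env_ext (eq_env b) a)) by move=> a; exact: feval_range.
  apply/eqP; rewrite eq_le; apply/andP; split.
    by apply: (supT_le (env_elt N _)) => w; rewrite eq_env_ext; exact: (supT_ge _ ua).
  apply: (supT_le (elt Neq s)) => a; apply/ler_addgt0Pr => eps eps0.
  have [w hw] := dense _ _ psi b a eps eps0.
  by have := supT_ge w (Def2_unit b dP); move: hw; rewrite ler_norml /=; lra.
- have dP : Def2 c (fun b w => feval psi (eq_env (fun s0 u => env_cat b w (real_ext u)))).
    have id := @subst_id _ _ N (ctx_cat (real_ctx V) (real_ctx (ctx_ext V s))).
    apply: Def_subst IH; have := subst_ren (@real_ext V s) (subst_cat (subst_fst id) (subst_snd id)).
    exact.
  apply: Def_ext (Def_inf dP) => b /=.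
  have ua : unitf (fun a : Neq s => feval psi (env_ext (eq_env b) a)) by move=> a; exact: feval_range.
  rewrite (infTE (elt Neq s) ua); apply/eqP; rewrite eq_le; apply/andP; split; last first.
    by apply: (infT_ge (env_elt N _)) => w; rewrite eq_env_ext; exact: (infT_le _ ua).
  apply: (infT_ge (elt Neq s)) => a; apply/ler_addgt0Pr => eps eps0.
  have [w hw] := dense _ _ psi b a eps eps0.
  by have := infT_le w (Def2_unit b dP); move: hw; rewrite ler_norml /=; lra.
Qed.
End Elimination.

(** * Parameters in the algebraic closure *)

Section AlgebraicParameters.
Variables (R : realType) (L : signature R) (T : theory L).
Variables (N : structure L) (N_model : models T N) (A : params N).
Local Notation Leq := (eq_symbols T).
Local Notation Neq := (eq_struct T N).
Local Notation Aeq := (Defs.incl (@eq_params R L T N A)).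

Definition drop_const (V : ctx Leq) : ctx_map (real_ctx (ctx_cat V (pctx (@eq_params R L T N A))))
    (ctx_cat (real_ctx V) (pctx A)) :=
  fun s u => match u in real_ctx _ s return ctx_cat (real_ctx V) (pctx A) s with
    | RReal s v => match v with inl x => inl (RReal x) | inr a => inr a end
    | RImag chi v j => match v with inl x => inl (RImag x j) | inr a => match svalP a with end end
    end.

Lemma Def_eq_elim V (F : env Neq V -> R) : Def Aeq F ->
  Def (Defs.incl A) (fun b : env N (real_ctx V) => F (eq_env b)).
Proof.
move=> dF; apply: Def_lim => eps eps0; have [psi h] := dF eps eps0.
exists (fun b => feval psi (env_cat (eq_env b) Aeq)); last by move=> b; exact: h.
move=> d d0; have [theta ht] := Def_elim N_model (Defs.incl A) psi d0.
exists (fren (fun s u => match u with inl x => drop_const x | inr y => inr y end) theta) => b.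
rewrite feval_ren; have := ht (fun s u => env_cat b (Defs.incl A) (drop_const u)).
have -> : eq_env (fun s u => env_cat b (Defs.incl A) (drop_const u)) = env_cat (eq_env b) Aeq.
  apply: functional_extensionality_dep => -[s|chi]; apply: functional_extensionality_dep => -[v|v] //.
  by case: (svalP v).
apply: le_trans; rewrite le_eqVlt; apply/orP; left; apply/eqP.
congr (`| _ - feval _ _|); apply: functional_extensionality_dep => s.
by apply: functional_extensionality_dep => -[].
Qed.

Variables (m : nat) (ys : 'I_m -> srt L).

Definition real_vars : ctx_map (vars (fun j => inl (ys j) : srt Leq)) (embctx T (vars ys)) :=
  fun s v => match v in vars _ s return embctx T (vars ys) s with VarOf j => VarOf ys j end.

Definition split_vars (V : ctx Leq) : ctx_map (real_ctx (ctx_cat (vars (fun j => inl (ys j) : srt Leq)) V))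
    (ctx_cat (vars ys) (real_ctx V)) :=
  fun s u => match u in real_ctx _ s return ctx_cat (vars ys) (real_ctx V) s with
    | RReal s v => match v with inl x => inl (real_vars x) | inr a => inr (RReal a) end
    | RImag chi v j => match v with inl x => match real_vars x with end | inr a => inr (RImag a j) end
    end.

Definition eq_tuple (y : env N (vars ys)) : env Neq (vars (fun j => inl (ys j) : srt Leq)) :=
  tuple_env (M := Neq) (xs := fun j => inl (ys j) : srt Leq) (fun j => y _ (VarOf ys j)).

Lemma Def2_split V (psi : formula R (ctx_cat (vars (fun j => inl (ys j) : srt Leq)) V)) :
  Def2 (Defs.incl A) (fun y (b : env N (real_ctx V)) =>
    feval psi (env_cat (eq_tuple y) (eq_env b))).
Proof.
have id := @subst_id _ _ N (ctx_cat (vars ys) (real_ctx V)).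
have d := Def_subst (subst_ren (@split_vars V) id) (Def_elim N_model (Defs.incl A) psi).
apply: Def_ext d => e /=; congr (feval psi _); apply: functional_extensionality_dep => s.
apply: functional_extensionality_dep => -[x|v]; first by case: x.
by case: s v => [s|chi] v.
Qed.

Variables (P : set_system (env N (vars ys))) (Z : set (set_system (env N (vars ys)))).
Hypothesis gZ : good (Defs.incl A) P Z.

Section FixedFormula.
Variables (k : nat) (sg : 'I_k -> srt Leq).
Variable psi : formula R (ctx_cat (vars (fun j => inl (ys j) : srt Leq)) (vars sg)).
Variables (C : forall i, set (Neq (sg i))) (e : tup Neq sg).
Arguments C : clear implicits.
Hypothesis Ce : forall i, C i (e i).
Hypothesis compactC : forall i, compact (C i).
Hypothesis defC : forall i, definable (@eq_params R L T N A)
  (fun a : tup Neq (fun _ : 'I_1 => sg i) => inf [set mdist (a ord0) c | c in C i]).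

Let value (y : env N (vars ys)) (w : env Neq (vars sg)) := feval psi (env_cat (eq_tuple y) w).
Let dist i (x : Neq (sg i)) : R := inf [set mdist x c | c in C i].

Let uvalue y w : 0 <= value y w <= 1 := feval_range psi _.

Lemma dist_le i x c : C i c -> dist x <= mdist x c.
Proof. by move=> Cc; apply: ge_inf; [exists 0 => _ [c' _ <-]; exact: mdist_ge0|exists c]. Qed.

Lemma dist_lt i (x : Neq (sg i)) (h : R) : dist x < h -> exists2 c, C i c & mdist x c < h.
Proof.
move=> xh; have h0 : 0 < h - dist x by lra.
have hi : has_inf [set mdist x c | c in C i].
  split; first by exists (mdist x (e i)), (e i).
  by exists 0 => _ [c _ <-]; exact: mdist_ge0.
have [_ [c Cc <-] hc] := inf_adherent h0 hi.
by exists c => //; move: hc; rewrite -/(dist x); lra.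
Qed.

Lemma Def_dist i : Def (Defs.incl A) (fun b : env N (real_ctx (vars sg)) => dist (eq_env b (VarOf sg i))).
Proof.
have id := @subst_id _ _ Neq (vars sg).
apply: (Def_eq_elim (F := fun w : env Neq (vars sg) => dist (w _ (VarOf sg i)))).
pose F (w : env Neq (vars (fun _ : 'I_1 => sg i))) := dist (w _ (VarOf (fun _ : 'I_1 => sg i) ord0)).
have dF : Def Aeq F.
  move=> eps eps0; have [theta ht] := defC i eps0; exists theta => w.
  by have := ht (fun j => w _ (VarOf (fun _ : 'I_1 => sg i) j)); rewrite tuple_envK.
pose g : ctx_map (vars (fun _ : 'I_1 => sg i)) (vars sg) :=
  fun s v => match v in vars _ s return vars sg s with VarOf _ => VarOf sg i end.
by apply: Def_ext (Def_subst (subst_ren g id) dF).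
Qed.

(* The parameters e are replaced by a supremum over all b whose imaginaries are
   close to the compact sets C i and for which sup_Z value(., b) is about the
   same; this supremum is a predicate over A, so it has the same value at the
   type P and at its nonforking extensions. *)
Lemma algebraic_parameters_le (y0 : env N (vars ys)) : P = principal_filter y0 ->
  value y0 (tuple_env e) <= supZ Z (value^~ (tuple_env e)).
Proof.
move=> PE; apply/ler_addgt0Pr => eps6 eps60; pose eps := eps6 / 6.
have eps0 : 0 < eps by rewrite /eps; lra.
have ucN := eq_struct_uc N_model.
have [d d0 hd] := feval_uc ucN psi eps0.
(* With the slope 1/h, the two penalties in [F] cost at most eps for errors up to [h * eps] and
   reduce [F] to 0 for errors of h or more. The bound d/16 leaves room for the four distances added
   up at the end. *)
pose h := Num.min (d / 16) eps; have h0 : 0 < h by rewrite lt_min eps0 andbT; lra.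
have [hd16 heps] : h <= d / 16 /\ h <= eps by rewrite /h !ge_min !lexx orbT.
have he0 : 0 < h * eps by rewrite mulr_gt0.
have [d2 d20 hd2] := feval_uc ucN psi he0.
pose g (w : env Neq (vars sg)) := supZ Z (value^~ w); pose g0 := g (tuple_env e).
have uv w : unitf (value^~ w) by move=> y; exact: uvalue.
have ug w : 0 <= g w <= 1 := supZ_range (good_ultra gZ) (good_ne gZ) (uv w).
pose far b : R := \big[Num.max/0]_(i <- enum 'I_k) dist (eq_env b (VarOf sg i)).
pose F y b := Num.min (value y (eq_env b)) (Num.min
  (clamp (- h^-1 * far b + 1)) (clamp (- h^-1 * `|g (eq_env b) - g0| + 1))).
have dF : Def2 (Defs.incl A) F.
  have id := @subst_id _ _ N (ctx_cat (vars ys) (real_ctx (vars sg))).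
  apply: Def_min; first exact: Def2_split.
  apply: Def_min; apply: Def_aff.
    exact: (Def_subst (subst_snd id) (Def_bigmax (enum 'I_k) (@Def_dist))).
  apply: (Def_subst (subst_snd id) (P := fun b => `|g (eq_env b) - g0|)).
  apply: Def_absd; last exact: Def_cst (ug _).
  exact: (good_def gZ (Def2_split psi)).
have dsup := Def_sup dF; have usup := Def_unit dsup.
pose b0 := env_elt N (real_ctx (vars sg)).
have lower : value y0 (tuple_env e) - eps <= supT (F y0).
  pose kp := Num.min (d / 2) (Num.min (d2 / 2) (h * eps)).
  have kp0 : 0 < kp by rewrite !lt_min he0 andbT; lra.
  have [kd kd2 kh] : [/\ kp <= d / 2, kp <= d2 / 2 & kp <= h * eps].
    by rewrite /kp !ge_min !lexx !orbT.
  have [b hb] := eq_env_dense (tuple_env e : env Neq (vars sg)) kp0.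
  have cat_near del : kp < del -> forall y s v, mdist (env_cat (eq_tuple y) (tuple_env e) v)
      (env_cat (eq_tuple y) (eq_env b) (v : ctx_cat _ (vars sg) s)) < del.
    by move=> kpd y s [v|v] /=; [rewrite mdistxx; lra|apply: le_lt_trans (hb s v) kpd].
  have hv y : `|value y (tuple_env e) - value y (eq_env b)| <= eps.
    by apply: hd; apply: cat_near; lra.
  have hg : `|g0 - g (eq_env b)| <= h * eps.
    apply: (supZ_dist (good_ultra gZ) (good_ne gZ) (uv _) (uv _)) => y.
    by apply: hd2; apply: cat_near; lra.
  have hfar : far b <= h * eps.
    apply: bmax_le; first exact: ltW.
    move=> i _; apply: le_trans (dist_le _ (Ce i)) _; apply: le_trans kh.
    by rewrite metric_sym; exact: (hb _ (VarOf sg i)).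
  apply: le_trans (supT_ge b (Def2_unit y0 dF)); rewrite /F !le_min.
  have uve := uvalue y0 (tuple_env e).
  have small t : t <= h * eps -> - h^-1 * t + 1 >= 1 - eps.
    move=> th; have : h^-1 * t <= h^-1 * (h * eps) by rewrite ler_pM2l// invr_gt0.
    by rewrite mulrA mulVf ?mul1r ?gt_eqF//; lra.
  apply/and3P; split; first by have := hv y0; rewrite ler_norml; lra.
    by apply: clamp_ge; [|have := small _ hfar]; lra.
  by apply: clamp_ge; [|have := small _ hg; rewrite distrC]; lra.
suff : supT (F y0) <= g0 + 4 * eps by rewrite /g0 /g /eps in lower *; lra.
have [U ZU] := good_ne gZ; have UU := good_ultra gZ ZU.
rewrite leNgt; apply/negP => hlt.
have EU : ulim U (fun y => supT (F y)) = supT (F y0).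
  by rewrite (good_ext gZ ZU dsup) PE ulim_principal.
have g00 : 0 <= g0 <= 1 := ug _.
have near_U : U [set y | exists b, supT (F y0) - 2 * eps < F y b].
  have : supT (F y0) - eps < ulim U (fun y => supT (F y)) by rewrite EU; lra.
  move=> /(ulim_gt UU usup); apply: filterS => y /= hy.
  by have [b hb] := supT_near b0 (Def2_unit y dF) eps0; exists b; lra.
pose good_at y b (c : tup Neq sg) := [/\ supT (F y0) - 2 * eps < value y (eq_env b),
  `|g (eq_env b) - g0| <= eps & forall i, C i (c i) /\ mdist (eq_env b (VarOf sg i)) (c i) < h].
have [bc hbc] : {bc : env N (vars ys) -> env N (real_ctx (vars sg)) * tup Neq sg &
    forall y, (exists b, supT (F y0) - 2 * eps < F y b) -> good_at y (bc y).1 (bc y).2}.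
  apply: (@choice _ _ (fun y bc => (exists b, supT (F y0) - 2 * eps < F y b) -> good_at y bc.1 bc.2)) => y.
  have [[b]|nb] := pselect (exists b, supT (F y0) - 2 * eps < F y b); last by exists (b0, e).
  rewrite /F !lt_min => /and3P[h1 h2 h3].
  have pos (t : R) : supT (F y0) - 2 * eps < clamp (- h^-1 * t + 1) -> t < h.
    move=> ht; have : 0 < clamp (- h^-1 * t + 1) by lra.
    by rewrite clamp_gt0 mulNr addrC subr_gt0 ltr_pdivrMl// mulr1.
  have hc i : {c : Neq (sg i) | C i c /\ mdist (eq_env b (VarOf sg i)) c < h}.
    apply: cid; have [|c Cc hc] := @dist_lt i (eq_env b (VarOf sg i)) h; last by exists c.
    apply: le_lt_trans (pos _ h2).
    by apply: (bmax_ge (fun i => dist (eq_env b (VarOf sg i)))); rewrite mem_enum.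
  exists (b, fun i => projT1 (hc i)) => _; split=> //=.
    by apply: ltW; apply: lt_le_trans (pos _ h3) _.
  by move=> i; exact: (projT2 (hc i)).
(* The parameters [b] vary with y, but they are close to points of the compact sets [C i], which
   converge along U. So for almost all y they can be replaced by those of a single [y1], and [value]
   compared with one instance. *)
have UC i : U [set y | C i ((bc y).2 i)].
  by apply: filterS near_U => y /hbc [_ _ /(_ i) []].
have hc i : {c : Neq (sg i) | (fun y => (bc y).2 i) @ U --> c}.
  apply: cid; have := @compactC i; rewrite compact_ultra.
  move=> /(_ _ (ultra_fmap (fun y => (bc y).2 i) UU) (UC i)) [c [_ hc]].
  by exists c.
pose c i := projT1 (hc i).
have d160 : 0 < d / 16 by lra.
have Uc : U [set y | forall i, mdist (c i) ((bc y).2 i) < d / 16].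
  apply: filter_forall => i; have := projT2 (hc i) => /cvg_ballP /(_ _ d160).
  by rewrite nearE /=; apply: filterS => y; rewrite ballEmdist.
have FU : Filter U by exact: filter_filter.
have Ug : U (_ `&` _) := @filterI _ U FU _ _ near_U Uc; have [y1 [/hbc [_ gy1 cy1] ny1]] := filter_ex Ug.
pose b1 := (bc y1).1; have : supT (F y0) - 3 * eps <= g (eq_env b1).
  apply: le_trans (supZ_ge (good_ultra gZ) ZU (uv (eq_env b1))).
  apply: ulim_ge_cst => //; apply: filterS Ug => y [/hbc [vy _ cy] ny] /=.
  suff : `|value y (eq_env (bc y).1) - value y (eq_env b1)| <= eps by rewrite ler_norml; lra.
  apply: hd => s [v|[i]] /=; first by rewrite mdistxx.
  have [_ h1] := cy i; have [_ h2] := cy1 i; have h3 := ny i; have h4 := ny1 i.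
  have := metric_triangle (eq_env (bc y).1 (VarOf sg i)) ((bc y).2 i) (eq_env b1 (VarOf sg i)).
  have := metric_triangle ((bc y).2 i) (c i) (eq_env b1 (VarOf sg i)).
  have := metric_triangle (c i) ((bc y1).2 i) (eq_env b1 (VarOf sg i)).
  rewrite (metric_sym ((bc y).2 i) (c i)) (metric_sym ((bc y1).2 i) (eq_env b1 _)).
  move: h1 h2 h3 h4; rewrite -/b1; lra.
by move: gy1; rewrite -/b1 ler_norml; lra.
Qed.
End FixedFormula.

(** Up to eps/2 the definition is a formula with finitely many parameters, each of which comes with
    its compact set from [acl]. *)
Lemma acl_definition_le (D : env N (vars ys) -> R) y0 : unitf D ->
  definable (M := Neq) (acl_eq T A) (xs := fun j => inl (ys j) : srt Leq)
    (fun y => D (tuple_env (y : tup N ys))) ->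
  P = principal_filter y0 -> D y0 <= supZ Z D.
Proof.
move=> uD defD PE; apply/ler_addgt0Pr => eps eps0; have e20 : 0 < eps / 2 by lra.
have [psi0 hpsi0] := defD _ e20.
have [k [sg [f [psi hpsi]]]] := formula_finite psi0.
pose e : tup Neq sg := fun i => sval (f i).
have hC i : {C : set (Neq (sg i)) | [/\ C (e i), compact C & definable (@eq_params R L T N A)
    (fun a : tup Neq (fun _ : 'I_1 => sg i) => inf [set mdist (a ord0) c | c in C])]}.
  by apply: cid; exact: (svalP (f i)).
pose value y := feval psi (env_cat (eq_tuple y) (tuple_env e)).
have hD y : `|D y - value y| <= eps / 2.
  have -> : value y = feval psi0 (env_cat (eq_tuple y) (Defs.incl (acl_eq T A))) by rewrite hpsi.
  by rewrite -[y in D y]tuple_envK; exact: (hpsi0 (fun j => y _ (VarOf ys j))).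
have := @algebraic_parameters_le k sg psi (fun i => projT1 (hC i)) e
  (fun i => let: And3 h _ _ := projT2 (hC i) in h)
  (fun i => let: And3 _ h _ := projT2 (hC i) in h)
  (fun i => let: And3 _ _ h := projT2 (hC i) in h) y0 PE.
have uv : unitf value by move=> y; exact: feval_range.
have := supZ_dist (good_ultra gZ) (good_ne gZ) uv uD (e := eps / 2).
rewrite -/(value y0) => h1 h2.
have : `|supZ Z value - supZ Z D| <= eps / 2 by apply: h1 => y; rewrite distrC.
by have := hD y0; move: h2; rewrite !ler_norml -/value; lra.
Qed.
End AlgebraicParameters.

(** * Elementary extensions *)

Section GoodConstants.
Variables (R : realType) (S : symbols) (N : interp R S).

Lemma Def_const (G G' : ctx S) (c : env N G) (c' : env N G') V (F : env N V -> R) :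
  (forall s v, exists u, c' s u = c s v) -> Def c F -> Def c' F.
Proof.
move=> hc dF eps eps0; have [psi h] := dF eps eps0.
pose k s v := projT1 (cid (hc s v)).
have kE s v : c' s (k s v) = c s v := projT2 (cid (hc s v)).
exists (fren (cat_map (fun s => id) k) psi) => e; rewrite feval_ren.
apply: le_trans (h e); rewrite le_eqVlt; apply/orP; left; apply/eqP.
congr (`| _ - feval _ _|); apply: functional_extensionality_dep => s.
by apply: functional_extensionality_dep => -[v|v] //=; rewrite kE.
Qed.

Lemma Def2_formula (G : ctx S) (c : env N G) V W (phi : formula R (ctx_cat (ctx_cat V W) G)) :
  Def2 c (fun v w => feval phi (env_cat (env_cat v w) c)).
Proof. by apply: Def_ext (Def_formula c phi) => e; rewrite env_catK. Qed.

(** The constants of A appear in N both as values of the map c and as elements of the image of A;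
    goodness depends only on the set that they form. *)
Lemma good_const (G G' : ctx S) (c : env N G) (c' : env N G') X (P : set_system (env N X)) Z :
  (forall s v, exists u, c' s u = c s v) -> (forall s v, exists u, c s u = c' s v) ->
  good c P Z -> good c' P Z.
Proof.
move=> cc' c'c [Zne ZU Zext Zdef Znet]; split=> //.
- by move=> U psi ZU' /(Def_const c'c); exact: Zext.
- by move=> V phi /(Def_const c'c) /Zdef; exact: Def_const.
- by move=> V phi eps /(Def_const c'c); exact: Znet.
Qed.
End GoodConstants.

Section ElementaryExtension.
Variables (R : realType) (L : signature R) (N N2 : structure L).
Variables (e : env N2 (fun s => N s)) (eE : elem_equiv (@self R L N) e).
Arguments e : clear implicits.

Definition env_lift V (v : env N V) : env N2 V := fun s x => e s (v s x).

Lemma feval_lift V (phi : formula R V) (v : env N V) : feval phi (env_lift v) = feval phi v.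
Proof.
have := eE (fren (W := fun s => N s) v phi).
by rewrite !feval_ren => <-.
Qed.

Lemma env_lift_cat V W (v : env N V) (w : env N W) : env_lift (env_cat v w) = env_cat (env_lift v) (env_lift w).
Proof.
apply: functional_extensionality_dep => s.
by apply: functional_extensionality_dep => -[].
Qed.

Definition restricts X (U : set_system (env N X)) (F : set_system (env N2 X)) :=
  forall V (phi : formula R (ctx_cat X V)) (v : env N V),
    ulim U (fun x => feval phi (env_cat x v)) = ulim F (fun x => feval phi (env_cat x (env_lift v))).

Definition restrictZ X (Z : set (set_system (env N2 X))) : set (set_system (env N X)) :=
  [set U | UltraFilter U /\ exists2 F, Z F & restricts U F].

Lemma restricts_ex X (F : set_system (env N2 X)) : UltraFilter F ->
  exists2 U : set_system (env N X), UltraFilter U & restricts U F.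
Proof.
move=> UF; have [U UU hU] := transfer_ultra eE UF; exists U => // V phi v.
have := hU (fren (cat_map (fun s => id) (v : ctx_map V (fun s => N s))) phi).
have cat_ren (K : structure L) (x : env K X) (w : env K (fun s => N s)) :
    feval (fren (cat_map (fun s => id) (v : ctx_map V (fun s => N s))) phi) (env_cat x w) =
    feval phi (env_cat x (fun s u => w s (v s u))).
  rewrite feval_ren; congr (feval phi _); apply: functional_extensionality_dep => s.
  by apply: functional_extensionality_dep => -[].
rewrite (eq_ulim U (g := fun x => feval phi (env_cat x v))) => [->|x].
  by apply: eq_ulim => x; rewrite cat_ren.
by rewrite cat_ren.
Qed.

Variables (X : ctx L) (Z2 : set (set_system (env N2 X))).
Hypothesis Z2U : forall F, Z2 F -> UltraFilter F.

Lemma supZ_restrict V (phi : formula R (ctx_cat X V)) (v : env N V) :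
  supZ (restrictZ Z2) (fun x => feval phi (env_cat x v)) =
  supZ Z2 (fun x => feval phi (env_cat x (env_lift v))).
Proof.
rewrite /supZ; congr sup; apply/seteqP; split => [_ [U [UU [F ZF hF]] <-]|_ [F ZF <-]].
  by exists F.
have [U UU hU] := restricts_ex (Z2U ZF).
by exists U; [split=> //; exists F|].
Qed.

Variables (G : ctx L) (c : env N G).

Definition assoc_ctx V : ctx_map (ctx_cat (ctx_cat X V) G) (ctx_cat X (ctx_cat V G)) :=
  fun s u => match u with
    | inl (inl x) => inl x | inl (inr y) => inr (inl y) | inr z => inr (inr z) end.

Lemma feval_assoc (K : structure L) V (phi : formula R (ctx_cat (ctx_cat X V) G))
    (x : env K X) (v : env K V) (d : env K G) :
  feval (fren (@assoc_ctx V) phi) (env_cat x (env_cat v d)) = feval phi (env_cat (env_cat x v) d).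
Proof.
rewrite feval_ren; congr (feval phi _); apply: functional_extensionality_dep => s.
by apply: functional_extensionality_dep => -[[]|].
Qed.

(** By elementarity, the formulas that define the suprema in N2 define them in N as well. Good sets
    obtained in this way in two submodels are thus given by common formulas, which separate choices
    would not guarantee. *)
Lemma good_restrict (P : set_system (env N X)) (P2 : set_system (env N2 X)) :
  UltraFilter P -> UltraFilter P2 -> restricts P P2 -> good (env_lift c) P2 Z2 ->
  good c P (restrictZ Z2).
Proof.
move=> UP UP2 PP2 g2; have restr_ne : restrictZ Z2 !=set0.
  have [F ZF] := good_ne g2; have [U UU hU] := restricts_ex (Z2U ZF).
  by exists U; split=> //; exists F.
have restrU U : restrictZ Z2 U -> UltraFilter U by case.
have uphi (K : structure L) V (phi : formula R (ctx_cat (ctx_cat X V) G)) (v : env K V) (d : env K G) :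
    unitf (fun x => feval phi (env_cat (env_cat x v) d)) by move=> x; exact: feval_range.
split=> //.
- move=> U psi [UU [F ZF hF]] dpsi; have upsi := Def_unit dpsi.
  apply/eqP; rewrite -subr_eq0 -normr_le0; apply/ler_addgt0Pr => eps eps0; rewrite add0r.
  have e20 : 0 < eps / 2 by lra.
  have [psi' h] := dpsi _ e20; pose p' (x : env N X) := feval psi' (env_cat x c).
  have up' : unitf p' by move=> x; exact: feval_range.
  have E : ulim U p' = ulim P p'.
    rewrite (hF G psi' c) (PP2 G psi' c).
    exact: (good_ext g2 ZF (Def_formula (env_lift c) psi')).
  have h1 : `|ulim U psi - ulim U p'| <= eps / 2 by apply: ulim_dist => //; exact: filterE.
  have h2 : `|ulim P psi - ulim P p'| <= eps / 2 by apply: ulim_dist => //; exact: filterE.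
  by move: h1 h2; rewrite E !ler_norml; lra.
- move=> V phi dphi eps eps0; have e20 : 0 < eps / 2 by lra.
  have [phi' h] := dphi _ e20.
  have [theta ht] := good_def g2 (Def2_formula (env_lift c) phi') e20.
  exists theta => v.
  have h1 : `|supZ (restrictZ Z2) (phi^~ v) -
    supZ (restrictZ Z2) (fun x => feval phi' (env_cat (env_cat x v) c))| <= eps / 2.
    apply: supZ_dist => //; first exact: Def2_unitl v dphi.
    by move=> x; exact: (h (env_cat x v)).
  have := ht (env_lift v); rewrite -env_lift_cat feval_lift.
  have -> : supZ Z2 (fun x => feval phi' (env_cat (env_cat x (env_lift v)) (env_lift c))) =
            supZ (restrictZ Z2) (fun x => feval phi' (env_cat (env_cat x v) c)).
    rewrite -[LHS](_ : supZ Z2 (fun x => feval (fren (@assoc_ctx V) phi') (env_cat x (env_lift (env_cat v c)))) = _).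
      rewrite -supZ_restrict; congr supZ; apply/funext => x; exact: feval_assoc.
    by congr supZ; apply/funext => x; rewrite env_lift_cat; exact: feval_assoc.
  by move: h1; rewrite !ler_norml; lra.
move=> V phi eps dphi eps0; have e30 : 0 < eps / 3 by lra.
have [phi' h] := dphi _ e30.
have [Fs [hFs hnet]] := good_net g2 (Def2_formula (env_lift c) phi') e30.
have [r hr] : {r : set_system (env N2 X) -> set_system (env N X) & forall F, UltraFilter F ->
    UltraFilter (r F) /\ restricts (r F) F}.
  apply: (@choice _ _ (fun F U => UltraFilter F -> UltraFilter U /\ restricts U F)) => F.
  have [UF|nUF] := pselect (UltraFilter F); last by exists setT => /nUF.
  by have [U UU hU] := restricts_ex UF; exists U.
have value U F v : UltraFilter U -> restricts U F -> `|ulim U (phi^~ v) -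
    ulim F (fun x => feval phi' (env_cat (env_cat x (env_lift v)) (env_lift c)))| <= eps / 3.
  move=> UU hF; have -> : ulim F (fun x => feval phi' (env_cat (env_cat x (env_lift v)) (env_lift c))) =
      ulim U (fun x => feval phi' (env_cat (env_cat x v) c)).
    rewrite -(eq_ulim F (fun x => feval_assoc phi' x (env_lift v) (env_lift c))).
    rewrite -(eq_ulim U (fun x => feval_assoc phi' x v c)) (hF _ _ (env_cat v c)).
    by rewrite env_lift_cat.
  apply: ulim_dist => //; first exact: Def2_unitl v dphi.
  by apply: filterE => x; exact: (h (env_cat x v)).
exists (map r Fs); split=> [U /List.in_map_iff [F [<- Fl]]|U [UU [F ZF hF]]].
  by have [] := hr F (Z2U (hFs _ Fl)) => UF hF; split=> //; exists F => //; exact: hFs.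
have [F' F'l hF'] := hnet F ZF; exists (r F'); first by apply/List.in_map_iff; exists F'.
move=> v; have [UF' rF'] := hr F' (Z2U (hFs _ F'l)).
have := value U F v UU hF; have := value (r F') F' v UF' rF'; have := hF' (env_lift v).
by rewrite !ler_norml; lra.
Qed.
End ElementaryExtension.

(** The type of N over the common constants is transferred to M and realized in an ultrapower of M;
    the realization is an elementary embedding of N. The two images of a constant agree because
    their distance is the value of a formula of that type. *)
Lemma amalgam (R : realType) (L : signature R) (M N : structure L) H (c : env M H) (d : env N H) :
  elem_equiv c d -> exists (K : structure L) (i : env K (fun s => M s)) (j : env K (fun s => N s)),
    [/\ forall T, models T M -> models T K, elem_equiv (@self R L M) i, elem_equiv (@self R L N) j &
        forall s v, i s (c s v) = j s (d s v)].
Proof.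
move=> cd; have UN := principal_filter_ultra (@self R L N).
have [W UW hW] := transfer_ultra cd UN.
have [K [i [j [mod Ei Eij]]]] := realize_ultra (@self R L M) UW.
have hWp phi : ulim W (fun x => feval phi (env_cat x c)) = feval phi (env_cat (@self R L N) d).
  by rewrite hW ulim_principal// => x; exact: feval_range.
exists K, i, j; split=> // [sigma|s v].
  have := Eij (fren (fun s x => inl x) sigma).
  rewrite feval_ren -[X in _ = X](_ : ulim W (fun x => feval (fren (fun s x => inl x) sigma) (env_cat x c)) = _).
    by rewrite hWp feval_ren => ->.
  by apply: eq_ulim => x; rewrite !feval_ren.
pose eq_c : formula R (ctx_cat (fun s => N s) H) := Dist (Var (inl (d s v))) (Var (inr v)).
pose eq_M : formula R (ctx_cat (fun s => N s) (fun s => M s)) := Dist (Var (inl (d s v))) (Var (inr (c s v))).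
have h1 : feval eq_M (env_cat j i) = ulim W (fun x => feval eq_c (env_cat x c)) by rewrite Eij.
have : mdist (j s (d s v)) (i s (c s v)) = 0.
  by move: h1; rewrite hWp /= mdistxx.
by move=> /mdist_positivity.
Qed.

Lemma maxr_dist (R : realType) (s s' t t' e : R) : `|s - s'| <= e -> `|t - t'| <= e ->
  `|Num.max s t - Num.max s' t'| <= e.
Proof.
by have [h1|h1] := leP s t; have [h2|h2] := leP s' t'; rewrite !ler_norml; lra.
Qed.

Lemma bmax_dist (R : realType) (I : eqType) (r : seq I) (F F' : I -> R) (e : R) : 0 <= e ->
  (forall i, `|F i - F' i| <= e) ->
  `|\big[Num.max/0]_(i <- r) F i - \big[Num.max/0]_(i <- r) F' i| <= e.
Proof.
move=> e0 h; elim: r => [|a r IH]; first by rewrite !big_nil subrr normr0.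
by rewrite !big_cons; exact: maxr_dist.
Qed.

(** Each member of a finite net contributes its [instance_value], a Lipschitz function of instances
    f(x, b). This makes the supremum a phi-predicate, hence visible to phi-types. *)
Lemma supZ_combination (R : realType) (S : symbols) (N : interp R S) (G : ctx S) (c : env N G)
    X Y (f : env N X -> env N Y -> R) (P : set_system (env N Y)) Z (eps : R) :
  no_ladders c -> Def2 c f -> good c P Z -> 0 < eps ->
  exists k (u : connective R k) (b : 'I_k -> env N Y), forall x,
    `|supZ Z (f x) - u (\row_i f x (b i))| <= eps.
Proof.
move=> ladders df gZ eps0; have e20 : 0 < eps / 2 by lra.
have uf x : unitf (f x) := Def2_unit x df.
have [Us [hUs hnet]] := good_net gZ (Def2_flip df) e20.
have [k [F [C [C0 hdef]]]] := uniform_definition ladders (Def2_flip df) e20.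
have [ay hay] : {ay : set_system (env N Y) -> (nat -> env N Y) * (F -> env N X) &
    forall U, UltraFilter U -> forall x,
      `|ulim U (f x) - instance_value (fun y x => f x y) k C (ay U).1 (ay U).2 x| <= eps / 2}.
  apply: (@choice _ _ (fun U ay => UltraFilter U -> forall x,
      `|ulim U (f x) - instance_value (fun y x => f x y) k C ay.1 ay.2 x| <= eps / 2)) => U.
  have [UU|nUU] := pselect (UltraFilter U); last by exists (fun=> env_elt N Y, fun=> env_elt N X) => /nUU.
  by have [a [y h]] := hdef U UU; exists (a, y).
pose a i := (ay (nth setT Us i)).1; pose x_ i := (ay (nth setT Us i)).2.
pose I : finType := ('I_(size Us) * 'I_k)%type.
pose at_ (v : 'I_#|I| -> R) i j := if insub j is Some o then v (enum_rank (i, o)) else 0.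
pose h (v : 'I_#|I| -> R) := \big[Num.max/0]_(i <- enum 'I_(size Us))
  \big[Num.max/0]_(z <- enum F) clamp (f (x_ i z) (a i k) -
    C * \big[Num.max/0]_(j <- iota 0 k) `|at_ v i j - f (x_ i z) (a i j)|).
have hC v w (e : R) : 0 <= e -> (forall t, `|v t - w t| <= e) -> `|h v - h w| <= C * e.
  move=> e0 vw; have Ce0 : 0 <= C * e by rewrite mulr_ge0.
  apply: bmax_dist => // i; apply: bmax_dist => // z; apply: le_trans (clamp_dist _ _) _.
  rewrite opprB addrC addrA subrK distrC -mulrBr normrM ger0_norm// ler_wpM2l//.
  apply: bmax_dist => // j; apply: le_trans (ler_dist_dist _ _) _.
  rewrite opprB addrA subrK /at_; case: insub => [o|]; first exact: vw.
  by rewrite subrr normr0.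
pose b (t : 'I_#|I|) : env N Y := let ij : I := enum_val t in a ij.1 ij.2.
exists #|I|, (lip_connective hC), b => x.
have -> : lip_connective hC (\row_t f x (b t)) =
    clamp (h (fun t => f x (b t))).
  by congr (clamp (h _)); apply/funext => t; rewrite mxE.
have Z01 := supZ_range (good_ultra gZ) (good_ne gZ) (uf x).
rewrite -[X in `|X - _|]clamp_id//; apply: le_trans (clamp_dist _ _) _.
have -> : h (fun t => f x (b t)) = \big[Num.max/0]_(i <- enum 'I_(size Us))
    instance_value (fun y x => f x y) k C (a i) (x_ i) x.
  apply: eq_bigr => i _; apply: eq_bigr => z _; congr (clamp (_ - _ * _)).
  apply: eq_big_seq => j; rewrite mem_iota => /andP[_ jk].
  by rewrite /at_ insubT /b enum_rankK.
have close (i : 'I_(size Us)) : Z (nth setT Us i) /\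
    `|ulim (nth setT Us i) (f x) - instance_value (fun y x => f x y) k C (a i) (x_ i) x| <= eps / 2.
  have ZU := hUs _ (nth_In setT (ltn_ord i)); split=> //.
  exact: (hay _ (good_ultra gZ ZU)).
have e2 : eps / 2 <= eps by lra.
rewrite ler_distl; apply/andP; split.
  rewrite -lerBrDr opprK; apply: bmax_le; first by case/andP: Z01 => z0 _; rewrite addr_ge0// ltW.
  move=> i _; have [ZU] := close i; have := supZ_ge (good_ultra gZ) ZU (uf x).
  by rewrite ler_norml; lra.
apply: supZ_le (good_ne gZ) _ => U ZU; have [U' U'l hU'] := hnet U ZU.
have [i il iU'] := In_nth setT U'l; have [_] := close (Ordinal il).
have := bmax_ge (fun i : 'I_(size Us) => instance_value (fun y x => f x y) k C (a i) (x_ i) x)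
  (_ : Ordinal il \in enum 'I_(size Us)).
rewrite mem_enum => /(_ isT) /=; have := hU' x; rewrite iU' !ler_norml.
by set q := bigop _ _ _; set q' := instance_value _ _ _ _ _ _; lra.
Qed.

(** * The bound on nonforking extensions *)

Section TypesAsUltrafilters.
Variables (R : realType) (L : signature R) (G : ctx L) (M : structure L) (c : env M G).
Variables (n : nat) (xs : 'I_n -> srt L).

Definition represents (U : set_system (env M (vars xs))) (p : types c xs) :=
  UltraFilter U /\ forall phi, val p phi = ulim U (fun x => feval phi (env_cat x c)).

Lemma represents_ex (p : types c xs) : exists U, represents U p.
Proof.
have [N [d [a [cd pE]]]] := set_mem (valP p).
have [U UU hU] := transfer_ultra cd (principal_filter_ultra (tuple_env a)).
exists U; split=> // phi; rewrite pE hU ulim_principal// => x; exact: feval_range.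
Qed.

Lemma represented_type U : UltraFilter U -> exists p : types c xs, represents U p.
Proof.
move=> UU; have [N [d [a [_ cd ha]]]] := realize_ultra c UU.
pose p0 (phi : formula R (ctx_cat (vars xs) G)) := ulim U (fun x => feval phi (env_cat x c)).
have tp : is_type c p0.
  exists N, d, (fun i => a _ (VarOf xs i)); split=> // phi.
  by rewrite tuple_envK ha.
pose p : types c xs := exist _ p0 (mem_set tp).
by exists p.
Qed.

Lemma represents_range U p phi : represents U p -> 0 <= val p phi <= 1.
Proof. by move=> [UU ->]; apply: ulim_range => x; exact: feval_range. Qed.
End TypesAsUltrafilters.

Lemma restr_ulim (R : realType) (L : signature R) (G H : ctx L) (M N : structure L) (c : env M G)
    (d : env N H) (f : ctx_map G H) (cd : elem_equiv c (fun s v => d s (f s v))) n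
    (xs : 'I_n -> srt L) (p : types d xs) U phi : represents U p ->
  val (restr cd p) phi = ulim U (fun x => feval phi (env_cat x (fun s v => d s (f s v)))).
Proof.
move=> [UU hU]; rewrite [LHS]hU; apply: eq_ulim => x; rewrite feval_ren; congr (feval _ _).
apply: functional_extensionality_dep => s.
by apply: functional_extensionality_dep => -[].
Qed.

Lemma phi_definition_ulim (R : realType) (L : signature R) (N : structure L) n m
    (xs : 'I_n -> srt L) (ys : 'I_m -> srt L) (phi : formula R (ctx_cat (vars xs) (vars ys)))
    (q : model_types N xs) U y : represents U q ->
  phi_definition phi q y = ulim U (fun x => feval phi (env_cat x (tuple_env y))).
Proof.
move=> [UU hU]; rewrite /phi_definition hU; apply: eq_ulim => x; rewrite feval_ren.
congr (feval _ _); apply: functional_extensionality_dep => s.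
by apply: functional_extensionality_dep => -[].
Qed.

Section NonforkingBound.
Variables (R : realType) (L : signature R) (T : theory L) (T_stable : stable T).
Variables (M : structure L) (M_model : models T M).
Variables A B : params M.
Arguments A : clear implicits.
Arguments B : clear implicits.
Hypothesis AB : forall s, A s `<=` B s.
Variables (n : nat) (xs : 'I_n -> srt L).

Lemma instance_phi_predicate m (ys : 'I_m -> srt L) (phi : formula R (ctx_cat (vars xs) (vars ys)))
    (b : tup M ys) (Theta : formula R (ctx_cat (vars xs) (pctx B))) (p q : types_over B xs) :
  (forall a, feval Theta (env_cat (tuple_env a) (Defs.incl B)) = feval phi (env_cat (tuple_env a) (tuple_env b))) ->
  same_phi_type phi p q -> val p Theta = val q Theta.
Proof.
move=> hTheta pq.
have fast (a : tup M xs) j : `|feval Theta (env_cat (tuple_env a) (Defs.incl B)) -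
    feval Theta (env_cat (tuple_env a) (Defs.incl B))| <= 2^-1 ^+ j.
  by rewrite subrr normr0 exprn_ge0// invr_ge0.
have lim_cst (r : R) : lim ((fun=> r) j @[j --> \oo]) = r by exact: lim_cst.
have := pq (@DefpredOver R L M B n xs (fun=> Theta) fast); rewrite /dpo_type /= !lim_cst; apply.
move=> eps eps0.
have proj_lip (v w : 'I_1 -> R) e : 0 <= e -> (forall i, `|v i - w i| <= e) ->
  `|v ord0 - w ord0| <= 1 * e by move=> _ /(_ ord0); rewrite mul1r.
exists 1%N, (lip_connective proj_lip), (fun=> b) => a.
have r01 := feval_range phi (env_cat (tuple_env a) (tuple_env b)).
by rewrite /dpo_eval /= lim_cst hTheta !mxE clamp_id// subrr normr0 ltW.
Qed.

(** Let b be the parameters of [Theta] in M and b' their copy in N. The chain is p(Theta) = D(b') <=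
    lim_U GN = lim_P GM = sup_Z theta(-, b). The inequality comes from [acl_definition_le] and the
    exchange of limits, the next equality from the agreement of p and q on a phi-predicate, the last
    one from symmetry. *)
Lemma nonforking_le (p : types_over B xs) P Z (Theta : formula R (ctx_cat (vars xs) (pctx B))) :
  nonforking T A p -> represents P p -> good (Defs.incl A) P Z ->
  val p Theta <= supZ Z (fun x => feval Theta (env_cat x (Defs.incl B))).
Proof.
move=> nf [UP hP] gZ; set cB := Defs.incl B; set cA := Defs.incl A.
have [m [ys [f [theta htheta]]]] := formula_finite Theta.
have [N [c [cE [q [N_model same defD]]]]] := nf m ys theta.
have [U repU] := represents_ex q; have [UU _] := repU.
pose b : env M (vars ys) := tuple_env (fun i => cB _ (f i)).
pose b' : env N (vars ys) := tuple_env (fun i => c _ (f i)).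
(* M and N are related only through B. A good set for the type of b over A, taken in K and
   restricted to both models, makes [GM] and [GN] limits of the same formulas [psi l] over A. *)
have [K [i [j [K_model Ei Ej ij]]]] := amalgam cE.
pose cK : env K (pctx A) := env_lift i cA; pose bK : env K (vars ys) := env_lift i b.
pose cN : env N (pctx A) := fun s v => c s (incl_map AB v).
have cKE : cK = env_lift j cN.
  apply: functional_extensionality_dep => s; apply: functional_extensionality_dep => v.
  exact: (ij s (incl_map AB v)).
have bKE : bK = env_lift j b'.
  apply: functional_extensionality_dep => s; apply: functional_extensionality_dep => -[k].
  exact: (ij _ (f k)).
have UbK := principal_filter_ultra bK; have Ub := principal_filter_ultra b.
have Ub' := principal_filter_ultra b'.
have ladM : no_ladders cA := @no_ladders_model _ _ _ T_stable _ M_model _ cA.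
have ladN : no_ladders cN := @no_ladders_model _ _ _ T_stable _ N_model _ cN.
have ladK : no_ladders cK := @no_ladders_model _ _ _ T_stable _ (K_model _ M_model) _ cK.
have [ZK gK _] := good_exists ladK UbK.
have uth (K' : structure L) (y : env K' (vars ys)) :
  unitf (fun x : env K' (vars xs) => feval theta (env_cat x y)) by move=> x; exact: feval_range.
have restr_principal (N' : structure L) (e : env K (fun s => N' s)) (eE : elem_equiv (@self R L N') e) y :
    bK = env_lift e y -> restricts e (principal_filter y) (principal_filter bK).
  move=> E V phi v; rewrite !ulim_principal ?E; last 2 first.
  - by move=> x; exact: feval_range.
  - by move=> x; exact: feval_range.
  by rewrite -env_lift_cat feval_lift.
pose Y := restrictZ i ZK; pose Y' := restrictZ j ZK.
have gY : good cA (principal_filter b) Y.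
  exact: (good_restrict Ei (good_ultra gK) Ub UbK (restr_principal _ _ Ei _ erefl) gK).
have gY' : good cN (principal_filter b') Y'.
  by apply: (good_restrict Ej (good_ultra gK) Ub' UbK (restr_principal _ _ Ej _ bKE)); rewrite -cKE.
have ZKU := good_ultra gK.
pose f_ (K' : structure L) (x : env K' (vars xs)) (y : env K' (vars ys)) := feval theta (env_cat x y).
have dK : Def2 cK (@f_ K) := Def2_feval cK theta.
have dM : Def2 cA (@f_ M) := Def2_feval cA theta.
have dN : Def2 cN (@f_ N) := Def2_feval cN theta.
(* The factor 1/4 makes consecutive approximations differ by at most 2^-l, as [DefpredOver]
   requires. *)
have pow0 l : 0 < 4^-1 * 2^-1 ^+ l :> R by rewrite mulr_gt0 ?exprn_gt0 ?invr_gt0.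
have [psi hpsi] := choice (fun l => good_def gK (Def2_flip dK) (pow0 l)).
have close (N' : structure L) (e : env K (fun s => N' s)) (eE : elem_equiv (@self R L N') e) c' :
    cK = env_lift e c' -> forall l x, `|supZ (restrictZ e ZK) (f_ N' x) - feval (psi l) (env_cat x c')| <=
      4^-1 * 2^-1 ^+ l.
  move=> cE' l x; have := hpsi l (env_lift e x).
  rewrite cE' -env_lift_cat (feval_lift eE).
  suff -> : supZ (restrictZ e ZK) (f_ N' x) = supZ ZK (fun y => f_ K (env_lift e x) y) by [].
  have := supZ_restrict eE ZKU (fren (@swap_map _ _ (vars xs) (vars ys)) theta) x.
  set F1 := (X in supZ _ X = _); set F2 := (X in _ = supZ _ X).
  have -> : F1 = f_ N' x by apply/funext => y; exact: feval_swap.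
  have -> // : F2 = f_ K (env_lift e x) by apply/funext => y; exact: feval_swap.
pose GM x := supZ Y (f_ M x); pose GN x := supZ Y' (f_ N x).
have hM l x : `|GM x - feval (psi l) (env_cat x cA)| <= 4^-1 * 2^-1 ^+ l := close _ _ Ei cA erefl l x.
have hN l x : `|GN x - feval (psi l) (env_cat x cN)| <= 4^-1 * 2^-1 ^+ l := close _ _ Ej cN cKE l x.
pose psiB l := fren (cat_map (fun s => id) (incl_map AB)) (psi l).
have psiBE (K' : structure L) (x : env K' (vars xs)) (w : env K' (pctx B)) l :
    feval (psiB l) (env_cat x w) = feval (psi l) (env_cat x (fun s v => w s (incl_map AB v))).
  rewrite feval_ren; congr (feval _ _); apply: functional_extensionality_dep => s.
  by apply: functional_extensionality_dep => -[].
have hMB l x : `|GM x - feval (psiB l) (env_cat x cB)| <= 4^-1 * 2^-1 ^+ l by rewrite psiBE; exact: hM.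
have fast (a : tup M xs) l : `|feval (psiB l) (env_cat (tuple_env a) cB) -
    feval (psiB l.+1) (env_cat (tuple_env a) cB)| <= 2^-1 ^+ l.
  have := hMB l (tuple_env a); have := hMB l.+1 (tuple_env a); have := pow0 l.
  by rewrite exprS !ler_norml; lra.
pose pred := @DefpredOver R L M B n xs psiB fast.
have quarter : 0 <= 4^-1 :> R by rewrite invr_ge0.
have predE a : dpo_eval pred a = GM (tuple_env a).
  by apply: (fast_lim quarter) => l; exact: hMB.
have predP : phi_predicate theta pred.
  move=> eps eps0; have [k [u [w hw]]] := supZ_combination ladM dM gY eps0.
  exists k, u, (fun t j => w t _ (VarOf ys j)) => a; rewrite predE.
  have -> : (\row_t feval theta (env_cat (tuple_env a) (tuple_env (fun j => w t _ (VarOf ys j))))) =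
            \row_t f_ M (tuple_env a) (w t) by apply/rowP => t; rewrite !mxE tuple_envK.
  exact: hw.
have uG (K' : structure L) (W : set (set_system (env K' (vars ys)))) : W !=set0 ->
    (forall V, W V -> UltraFilter V) -> unitf (fun x => supZ W (f_ K' x)).
  by move=> W0 WU x; apply: supZ_range => // y; exact: feval_range.
have uGM : unitf GM := uG _ _ (good_ne gY) (good_ultra gY).
have uGN : unitf GN := uG _ _ (good_ne gY') (good_ultra gY').
have limM : dpo_type pred p = ulim P GM.
  apply: (fast_lim quarter) => l; rewrite hP; apply: ulim_dist => //.
    by move=> x; exact: feval_range.
  by apply: filterE => x; exact: hMB.
have valq phi : val (model_restriction cE q) phi = ulim U (fun x => feval phi (env_cat x c)).
  exact: restr_ulim.
have limN : dpo_type pred (model_restriction cE q) = ulim U GN.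
  apply: (fast_lim quarter) => l; rewrite valq; apply: ulim_dist => //.
    by move=> x; exact: feval_range.
  by apply: filterE => x /=; rewrite psiBE; exact: hN.
have GE : ulim U GN = ulim P GM by rewrite -limM -limN; exact: same.
pose D (y : env N (vars ys)) := ulim U ((f_ N)^~ y).
have uf_ (K' : structure L) y : unitf ((f_ K')^~ y) by move=> x; exact: feval_range.
have uD : unitf D by move=> y; exact: ulim_range.
have defD' : definable (M := eq_struct T N) (acl_eq T (image_params A c))
    (xs := fun l => inl (ys l) : srt (eq_symbols T)) (fun y => D (tuple_env (y : tup N ys))).
  move=> eps eps0; have [chi hchi] := defD eps eps0; exists chi => y.
  by rewrite -[D _](phi_definition_ulim theta y repU); exact: hchi.
have gY2 : good (Defs.incl (image_params A c)) (principal_filter b') Y'.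
  apply: good_const gY' => [s v|s v].
    have h : image_params A c (cN s v) by exists (incl_map AB v) => //; exact: svalP v.
    by exists (exist _ (cN s v) h).
  have [[z Bz] Az cz] := svalP v; exists (exist _ z Az).
  rewrite /Defs.incl -cz /cN /incl_map /=.
  by congr (c s (exist _ z _)); exact: Prop_irrelevance.
have Dle : D b' <= ulim U GN.
  apply: le_trans (acl_definition_le N_model gY2 uD defD' erefl) _.
  apply: supZ_le (good_ne gY') _ => V ZV; have UV := good_ultra gY' ZV.
  rewrite (ulim_exchange ladN dN UU UV) -[leRHS]addr0; apply: ulim_le => //.
    by move=> x; apply: ulim_range => y; exact: feval_range.
  apply: filterE => x /=; rewrite addr0.
  by apply: (supZ_ge (good_ultra gY') ZV) => y; exact: feval_range.
have <- : val (model_restriction cE q) Theta = val p Theta.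
  by apply: (instance_phi_predicate (b := fun k => cB _ (f k)) _ same) => a; rewrite htheta.
rewrite valq; have -> : ulim U (fun x => feval Theta (env_cat x c)) = D b'.
  by apply: eq_ulim => x; rewrite htheta.
have -> : (fun x => feval Theta (env_cat x cB)) = (f_ M)^~ b by apply/funext => x; rewrite htheta.
apply: le_trans Dle _; rewrite GE; have := good_symmetry ladM gZ gY UP Ub dM.
rewrite ulim_principal => [->//|y].
exact: (supZ_range (good_ultra gZ) (good_ne gZ) (uf_ _ _)).
Qed.
End NonforkingBound.

(** * The topology of types *)

Lemma cvg_initial (S : choiceType) (T : topologicalType) (f : S -> T) (F : set_system S) (s : S) :
  Filter F -> f @ F --> f s -> F --> (s : initial_topology f).
Proof.
move=> FF hF A /= [_ [[B Bop <-] Bfs sBfA]].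
have /hF FB : nbhs (f s) B by apply: open_nbhs_nbhs.
by apply: filterS sBfA _; exact: FB.
Qed.

Section TopologyOfTypes.
Variables (R : realType) (L : signature R) (G : ctx L) (M : structure L) (c : env M G).
Variables (n : nat) (xs : 'I_n -> srt L).

Lemma types_eval_continuous phi : continuous (fun p : types c xs => val p phi : R).
Proof.
pose P := prod_topology (fun _ : formula R (ctx_cat (vars xs) G) => R).
have h1 : continuous (set_val : types c xs -> P) := @initial_continuous _ _ _.
pose ev (t : forall i : formula R (ctx_cat (vars xs) G), (fun=> R) i : topologicalType) : R := t phi.
have h2 : continuous (ev : P -> R).
  move=> t A hA; have /cvg_sup /(_ phi) h : nbhs (t : P) --> (t : P) by exact: cvg_id.
  by apply: h; exact: (@initial_continuous _ _ ev t A hA).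
by move=> p; exact: (continuous_comp (h1 p) (h2 _)).
Qed.

Lemma types_cvg (F : set_system (types c xs)) (p : types c xs) : Filter F ->
  (forall phi, (fun p' => val p' phi) @ F --> (val p phi : R)) -> F --> p.
Proof.
move=> FF h; pose P := prod_topology (fun _ : formula R (ctx_cat (vars xs) G) => R).
apply: (@cvg_initial (types c xs) P (set_val : types c xs -> P) F p FF); apply/cvg_sup => phi.
move=> A /= [_ [[B Bop <-] Bp sBA]].
have FB : F [set p' | B (val p' phi)] := h phi B (open_nbhs_nbhs (conj Bop Bp)).
suff : F [set p' | A (set_val p')] by [].
by apply: filterS FB => p' Bp'; exact: (sBA (set_val p') Bp').
Qed.

Lemma types_near (F : set_system (types c xs)) (p : types c xs) : Filter F ->
  (forall phi (e : R), 0 < e -> F [set p' | `|val p phi - val p' phi| < e]) -> F --> p.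
Proof. by move=> FF h; apply: types_cvg => phi; apply/cvgrPdist_lt => e e0; exact: h. Qed.

Lemma types_eval (p : types c xs) : exists (N : structure L) (d : env N G) (a : tup N xs),
  forall phi, val p phi = feval phi (env_cat (tuple_env a) d).
Proof. by have [N [d [a [_ pE]]]] := set_mem (valP p); exists N, d, a. Qed.

Lemma types_nbhs_eval (p : types c xs) phi (e : R) : 0 < e ->
  nbhs p [set p' : types c xs | `|val p phi - val p' phi| < e].
Proof. by have /cvgrPdist_lt h := @types_eval_continuous phi p; move=> /h. Qed.

(** The minimum of two formulas is a formula, so the sets {theta > 0} are closed under finite
    intersections and form a basis, not merely a subbasis. *)
Lemma types_basis (U : set (types c xs)) p : open U -> U p ->
  exists2 theta, 0 < val p theta & forall p' : types c xs, 0 < val p' theta -> U p'.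
Proof.
move=> oU Up; apply: contrapT => nh.
pose B (Q : set (types c xs)) := exists2 theta, 0 < val p theta &
  Q = [set p' : types c xs | 0 < val p' theta /\ ~ U p'].
have [||Q [theta h ->]|F UF hF] := @ultra_of_base _ B.
- eexists; exists (fcst _ 1); last by [].
  by have [N [d [a ->]]] := types_eval p; rewrite feval_cst ?ltr01// ler01 lexx.
- move=> _ _ [theta h ->] [theta' h' ->].
  have minE (p' : types c xs) : (0 < val p' (fneg (fmax (fneg theta) (fneg theta')))) =
      (0 < val p' theta) && (0 < val p' theta').
    have [N [d [a E]]] := types_eval p'; rewrite !E feval_neg feval_max !feval_neg.
    by rewrite subr_gt0 gt_max !gtrBl.
  eexists; first by exists (fneg (fmax (fneg theta) (fneg theta'))); rewrite ?minE ?h.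
  by move=> p' /= []; rewrite minE => /andP[].
- apply: contrapT => nQ; apply: nh; exists theta => // p' h'; apply: contrapT => nU.
  by apply: nQ; exists p'.
have Fp : F --> p.
  apply: types_near => phi e e0.
  pose theta := flin (-1) 0 e (fabsd phi (fcst _ (val p phi))) (fcst _ 0).
  have p01 : 0 <= val p phi <= 1.
    by have [N [d [a ->]]] := types_eval p; exact: feval_range.
  have thetaE (p' : types c xs) : (0 < val p' theta) = (`|val p' phi - val p phi| < e).
    have [N [d [a E]]] := types_eval p'; rewrite !E feval_lin clamp_gt0 feval_absd feval_cst//.
    by rewrite mul0r addr0 mulN1r addrC subr_gt0.
  have : B [set p' : types c xs | 0 < val p' theta /\ ~ U p'].
    by exists theta => //; rewrite thetaE subrr normr0.
  by move=> /hF; apply: filterS => p' /= [+ _]; rewrite thetaE distrC.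
have FU : F U := Fp _ (open_nbhs_nbhs (conj oU Up)).
have : B [set p' : types c xs | 0 < val p' (fcst _ 1) /\ ~ U p'].
  exists (fcst _ 1) => //.
  by have [N [d [a ->]]] := types_eval p; rewrite feval_cst ?ltr01// ler01 lexx.
by move=> /hF Fn; have [p' [Up' [_ nUp']]] := filter_ex (filterI FU Fn).
Qed.
End TopologyOfTypes.

Lemma good_same_type (R : realType) (S : symbols) (N : interp R S) (G : ctx S) (c : env N G) X
    (P P' : set_system (env N X)) Z : UltraFilter P -> UltraFilter P' ->
  (forall psi : formula R (ctx_cat X G),
    ulim P (fun x => feval psi (env_cat x c)) = ulim P' (fun x => feval psi (env_cat x c))) ->
  good c P Z -> good c P' Z.
Proof.
move=> UP UP' PP' [Zne ZU Zext Zdef Znet]; split=> // U psi UZ dpsi.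
rewrite (Zext U psi UZ dpsi); have upsi := Def_unit dpsi.
apply/eqP; rewrite -subr_eq0 -normr_le0; apply/ler_addgt0Pr => eps eps0; rewrite add0r.
have e20 : 0 < eps / 2 by lra.
have [theta h] := dpsi _ e20.
have uth : unitf (fun x => feval theta (env_cat x c)) by move=> x; exact: feval_range.
pose th x := feval theta (env_cat x c).
have h1 : `|ulim P psi - ulim P th| <= eps / 2 by apply: ulim_dist => //; exact: filterE.
have h2 : `|ulim P' psi - ulim P' th| <= eps / 2 by apply: ulim_dist => //; exact: filterE.
by move: h1 h2; rewrite /th (PP' theta) !ler_norml; lra.
Qed.

(** * Nonforking extensions as members of good sets *)

Section NonforkingExtensions.
Variables (R : realType) (L : signature R) (T : theory L) (T_stable : stable T).
Variables (M : structure L) (M_model : models T M).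
Variables A B : params M.
Arguments A : clear implicits.
Arguments B : clear implicits.
Hypothesis AB : forall s, A s `<=` B s.
Variables (n : nat) (xs : 'I_n -> srt L).
Local Notation cA := (Defs.incl A).
Local Notation cB := (Defs.incl B).
Local Notation value Theta := (fun x => feval Theta (env_cat x cB)).

(** M itself serves as the model containing B, with the extension of p that [U] represents over all
    of M; [nonforking_definable] provides its definitions. *)
Lemma represented_nonforking (p : types_over B xs) P Z U :
  good cA P Z -> compactZ Z -> Z U -> represents U p -> nonforking T A p.
Proof.
move=> gZ cZ ZU [UU hU] m ys phi; have cE : elem_equiv cB cB by [].
have [q hq] := represented_type (@self R L M) UU.
exists M, cB, cE, q; split=> //.
  suff -> : model_restriction cE q = p by [].
  by apply: val_inj; apply/funext => psi; rewrite hU; exact: (restr_ulim cE).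
have -> : image_params A cB = A.
  apply: functional_extensionality_dep => s; apply/seteqP; split=> [_ [b Ab <-] //|a Aa].
  by exists (exist _ a (AB Aa)).
move=> eps eps0; have [chi hchi] := nonforking_definable T_stable M_model phi gZ cZ ZU eps0.
by exists chi => y; rewrite (phi_definition_ulim phi y hq); exact: hchi.
Qed.

(** The bound is applied to 1 - gap, where [gap] is the largest deviation of finitely many formulas
    from their values at p. As p gives it the value 1, some member of Z is close to p on all these
    formulas, and compactness of Z concludes. *)
Lemma extension_in (p : types_over B xs) P Z : good cA P Z -> compactZ Z ->
  (forall Theta, val p Theta <= supZ Z (value Theta)) -> exists2 U, Z U & represents U p.
Proof.
move=> gZ cZ hle; have [U0 [UU0 hU0]] := represents_ex p.
pose near l (eps : R) : set (env M (vars xs)) := [set x | forall Theta, List.In Theta l ->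
  `|feval Theta (env_cat x cB) - val p Theta| < eps].
have [||Q [l [eps [eps0 ->]]]|U ZU hU] := cZ [set Q | exists l eps, 0 < eps /\ Q = near l eps].
- by exists (near [::] 1), [::], 1.
- move=> _ _ [l [e [e0 ->]]] [l' [e' [e'0 ->]]].
  exists (near (l ++ l') (Num.min e e')).
    by exists (l ++ l'), (Num.min e e'); rewrite lt_min e0.
  move=> x hx; split=> Theta lTheta.
    have := hx Theta (List.in_or_app _ _ _ (or_introl lTheta)).
    by rewrite lt_min => /andP[].
  have := hx Theta (List.in_or_app _ _ _ (or_intror lTheta)).
  by rewrite lt_min => /andP[].
- pose gap := fix gap l : formula R (ctx_cat (vars xs) (pctx B)) := if l is Theta :: l'
    then fmax (fabsd Theta (fcst _ (val p Theta))) (gap l') else fcst _ 0.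
  have p01 Theta := represents_range Theta (conj UU0 hU0).
  have gapS Theta l' x : feval (gap (Theta :: l')) (env_cat x cB) =
      Num.max `|feval Theta (env_cat x cB) - val p Theta| (feval (gap l') (env_cat x cB)).
    by rewrite feval_max feval_absd feval_cst.
  have gap_near x e : feval (gap l) (env_cat x cB) < e -> near l e x.
    rewrite /near /mkset; elim: (l) => [_ Theta []|Theta l' IH].
    rewrite gapS gt_max => /andP[h1 h2] Theta' [<-//|]; exact: IH.
  have u1 : unitf (value (gap l)) by move=> x; exact: feval_range.
  have gap0 : ulim U0 (value (gap l)) = 0.
    apply/eqP; rewrite eq_le; case/andP: (ulim_range UU0 u1) => -> _; rewrite andbT.
    apply/ler_addgt0Pr => d d0; rewrite add0r; apply: ulim_le_cst => //.
    have : U0 (near l d).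
      by apply: filter_list => Theta _; rewrite hU0; apply: ulim_near => // x; exact: feval_range.
    apply: filterS => x; rewrite /near /mkset; elim: (l) => [_|Theta l' IH h].
      by rewrite feval_cst ?lexx ?ler01 ?ltW.
    rewrite gapS ge_max IH ?andbT; last by move=> Theta' h'; apply: h; right.
    by apply: ltW; apply: h; left.
  have ugap : unitf (value (fneg (gap l))) by move=> x; exact: feval_range.
  have g1 : 1 <= supZ Z (value (fneg (gap l))).
    apply: le_trans (hle _); rewrite hU0; apply/ler_addgt0Pr => d d0; rewrite -lerBlDr.
    apply: ulim_ge_cst => //; have : ulim U0 (value (gap l)) < d by rewrite gap0.
    by move=> /(ulim_lt UU0 u1); apply: filterS => x; rewrite /mkset feval_neg; lra.
  have [U ZU hU] := supZ_near (good_ultra gZ) (good_ne gZ) ugap eps0.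
  exists U => //; have UU := good_ultra gZ ZU.
  have : 1 - eps < ulim U (value (fneg (gap l))) by lra.
  move=> /(ulim_gt UU ugap); apply: filterS => x; rewrite /mkset feval_neg => h.
  by apply: gap_near; lra.
exists U => //; have UU := good_ultra gZ ZU; split=> // Theta.
apply/esym; apply: ulim_eq => // [x|e e0]; first exact: feval_range.
have : U (near [:: Theta] e) by apply: hU; exists [:: Theta], e.
by apply: filterS => x /(_ Theta (or_introl erefl)) /ltW.
Qed.

Lemma represents_restriction (p : types_over B xs) U : represents U p ->
  represents U (restriction AB p).
Proof. by move=> hU; split=> [|phi]; [case: hU|exact: (restr_ulim (incl_map_equiv AB))]. Qed.

(* Through symmetry, the bound at p0 is the value at p0 of the predicate
   x |-> sup theta(x, b') over A, b' ranging over the nonforking extensions of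
   the type of b; hence it is continuous in p0. *)
Lemma nonforking_bound :
  exists g : formula R (ctx_cat (vars xs) (pctx B)) -> types_over A xs -> R,
  [/\ forall Theta (eps : R), 0 < eps -> exists psi, forall p0, `|g Theta p0 - val p0 psi| <= eps,
      forall p, nonforking T A p <-> (forall Theta, val p Theta <= g Theta (restriction AB p)) &
      forall Theta p0 t, t < g Theta p0 ->
        exists p, [/\ nonforking T A p, restriction AB p = p0 & t < val p Theta]].
Proof.
have lad : no_ladders cA := @no_ladders_model _ _ _ T_stable _ M_model _ cA.
have [PZ hPZ] : {PZ : types_over A xs -> set_system (env M (vars xs)) * set (set_system (env M (vars xs))) &
    forall p0, [/\ represents (PZ p0).1 p0, good cA (PZ p0).1 (PZ p0).2 & compactZ (PZ p0).2]}.
  apply: (@choice _ _ (fun p0 PZ => [/\ represents PZ.1 p0, good cA PZ.1 PZ.2 & compactZ PZ.2])) => p0.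
  have [P hP] := represents_ex p0; have [Z gZ cZ] := good_exists lad (proj1 hP).
  by exists (P, Z).
exists (fun Theta p0 => supZ (PZ p0).2 (value Theta)); split.
- move=> Theta eps eps0; have [m [ys [f [theta htheta]]]] := formula_finite Theta.
  pose b : env M (vars ys) := tuple_env (fun i => cB _ (f i)).
  have Ub := principal_filter_ultra b; have [Y gY _] := good_exists lad Ub.
  have dtheta := Def2_feval cA theta.
  have [psi hpsi] := good_def gY (Def2_flip dtheta) eps0; exists psi => p0.
  have [[UP hP] gZ _] := hPZ p0; rewrite hP.
  have -> : value Theta = fun x => feval theta (env_cat x b) by apply/funext => x; rewrite htheta.
  have := good_symmetry lad gZ gY UP Ub dtheta.
  rewrite ulim_principal => [->|y]; last first.
    by apply: (supZ_range (good_ultra gZ) (good_ne gZ)) => x; exact: feval_range.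
  apply: ulim_dist => [x|x|]; [|exact: feval_range|exact: filterE].
  by apply: (supZ_range (good_ultra gY) (good_ne gY)) => y; exact: feval_range.
- move=> p; have [hP gZ cZ] := hPZ (restriction AB p); split=> [nf Theta|hle].
    have [U hU] := represents_ex p; have hU' := represents_restriction hU.
    apply: (nonforking_le T_stable M_model AB Theta nf hU).
    apply: good_same_type gZ; [exact: proj1 hP|exact: proj1 hU|move=> psi].
    by rewrite -(proj2 hP) -(proj2 hU').
  have [U ZU hU] := extension_in gZ cZ hle.
  exact: (represented_nonforking gZ cZ ZU hU).
- move=> Theta p0 t ht; have [hP gZ cZ] := hPZ p0.
  have e0 : 0 < supZ (PZ p0).2 (value Theta) - t by rewrite subr_gt0.
  have uv : unitf (value Theta) by move=> x; exact: feval_range.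
  have [U ZU hU] := supZ_near (good_ultra gZ) (good_ne gZ) uv e0.
  have UU := good_ultra gZ ZU; have [p hp] := represented_type cB UU.
  exists p; split; first exact: (represented_nonforking gZ cZ ZU hp).
    apply: val_inj; apply/funext => psi.
    rewrite (proj2 (represents_restriction hp)) (proj2 hP).
    exact: (good_ext gZ ZU (Def_formula cA psi)).
  by rewrite (proj2 hp); move: hU; rewrite opprB addrC subrK.
Qed.
End NonforkingExtensions.

Theorem theorem2p15 (R : realType) (L : signature R) (T : theory L)
    (T_stable : stable T) (M : structure L) (M_model : models T M)
    (A B : params M) (AB : forall s, A s `<=` B s)
    (n : nat) (xs : 'I_n -> srt L) :
  let X : set (types_over B xs) := nonforking T A (B := B) (xs := xs) in
  let rho : types_over B xs -> types_over A xs := restriction AB (xs := xs) in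
  [/\ compact X,
      {within X, continuous rho},
      rho @` X = setT &
      forall U : set (types_over B xs), open U -> open (rho @` (X `&` U))].
Proof.
move=> X rho.
have [g [g_near g_nf g_ex]] := nonforking_bound T_stable M_model AB xs.
split.
- rewrite compact_ultra => F UF FX.
  have [V hV] := choice (fun p : types_over B xs => represents_ex p).
  have UV p : UltraFilter (V p) := proj1 (hV p).
  (* The limit of the types along F: integrating ultrafilters that represent them gives an
     ultrafilter again, so the limit of the values is a type. *)
  have [p hp] := represented_type (Defs.incl B) (ultra_bind UF UV).
  have uval phi : unitf (fun p' : types_over B xs => val p' phi).
    by move=> p'; exact: represents_range (hV p').
  have pE phi : val p phi = ulim F (fun p' => val p' phi).
    rewrite (proj2 hp) ulim_bind//; last by move=> x; exact: feval_range.
    by apply: eq_ulim => p'; rewrite (proj2 (hV p')).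
  exists p; split; last first.
    apply: types_near => phi e e0; rewrite pE.
    by apply: filterS (ulim_near UF (uval phi) e0) => p' /=; rewrite distrC.
  apply/g_nf => Theta; apply/ler_addgt0Pr => eps eps0.
  have e20 : 0 < eps / 2 by rewrite divr_gt0.
  have [psi hpsi] := g_near Theta _ e20; rewrite pE.
  have hF : F [set p' : types_over B xs | val p' Theta <= val (rho p') psi + eps / 2].
    apply: filterS FX => p' /g_nf /(_ Theta) h; apply: le_trans h _.
    by have := hpsi (rho p'); rewrite ler_norml => /andP[_]; rewrite lerBlDl addrC.
  have := ulim_le UF (uval Theta) (uval (fren (cat_map (fun s => id) (incl_map AB)) psi)) hF.
  have rhoE : val (rho p) psi = val p (fren (cat_map (fun s => id) (incl_map AB)) psi) := erefl.
  rewrite -!pE -rhoE => h; apply: le_trans h _.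
  have := hpsi (rho p); rewrite ler_norml => /andP[h _].
  by move: h; rewrite /rho; move: (val _ psi) (g Theta _) => s t; lra.
- apply: continuous_subspaceT => p.
  apply: (types_near (fmap_filter rho (nbhs_filter p))) => phi e e0.
  exact: (types_nbhs_eval p (fren (cat_map (fun s => id) (incl_map AB)) phi) e0).
- apply/seteqP; split=> // p0 _.
  have [psi hpsi] := g_near (fcst _ 0) 1 ltr01.
  (* Any formula and any number below its bound yield a nonforking extension of p0. *)
  have [p [Xp <- _]] := g_ex (fcst _ 0) p0 (g (fcst _ 0) p0 - 1) ltac:(lra).
  by exists p.
move=> U oU; rewrite openE => _ [p [Xp Up] <-].
have [theta theta0 hU] := types_basis oU Up.
have gp : 0 < g theta (rho p) by apply: lt_le_trans theta0 _; exact: (proj1 (g_nf p) Xp).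
(* Two approximations by [psi] and the size of the neighbourhood cost a quarter each, the last one
   strictly, so [g theta p0] stays positive. *)
have e40 : 0 < g theta (rho p) / 4 by rewrite divr_gt0.
have [psi hpsi] := g_near theta _ e40.
apply: filterS (types_nbhs_eval (rho p) psi e40) => p0; rewrite /mkset => hp0.
have gp0 : 0 < g theta p0.
  move: (hpsi (rho p)) (hpsi p0) hp0 gp; rewrite !ler_norml ltr_norml.
  by move: (g theta (rho p)) (g theta p0) (val (rho p) psi) (val p0 psi) => s t r q; lra.
by have [p' [Xp' <- hp']] := g_ex theta p0 0 gp0; exists p' => //; split=> //; exact: hU.
Qed.
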